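(* Suppose the structural, smoothness, noise and bounded-subgradient assumptions stated in the context hold ($\operatorname{dom} f$ and $\operatorname{dom} g$ are not required to be compact). Let $\epsilon>0$, $\mu_x=\gamma$, $\theta=1$, $\lambda=\frac{1}{2\gamma}$, and let $$\tau=\min\Big\{\tfrac{1}{L_{yx}+L_{xx}+2\gamma},\ \tfrac{1}{L_{xy}},\ \tfrac{1}{480\gamma}\cdot\tfrac{\epsilon^2}{\delta_x^2}\Big\},\qquad \sigma=\min\Big\{\tfrac{1}{L_{yx}+2L_{yy}},\ \tfrac{1}{4512\gamma}\cdot\tfrac{\epsilon^2}{\delta_y^2}\Big\},\qquad N=\Big\lceil 33\max\Big\{\tfrac{4}{\gamma\tau},\tfrac{8}{\mu_y\sigma}\Big\}\Big\rceil .$$ Let $(x_0^0,y_0^0)\in\operatorname{dom} f\times\operatorname{dom} g$, and let $\{x_0^t\}_{t\ge 0}$ be generated by SAPD+ (without variance reduction) with parameters $\tau,\sigma,\theta,\mu_x$ and $N_t=N$ for all $t$. Then $$\frac{1}{T+1}\sum_{t=0}^{T}\mathbb{E}\big[\|\nabla\phi_\lambda(x_0^t)\|^2\big]\le \epsilon^2\qquad\text{for all } T\ge 96\,\mathcal{G}(x_0^0,y_0^0)\cdot\frac{\gamma}{\epsilon^2}+1,$$ and computing a point $x_\epsilon$ such that $\mathbb{E}[\|\nabla\phi_\lambda(x_\epsilon)\|]\le\epsilon$ requires $C_\epsilon$ stochastic first-order oracle calls in total, where $$C_\epsilon=\mathcal{O}\Big(\Big(\tfrac{\max\{L_{xx}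,L_{yx},L_{xy}\}}{\gamma}+\tfrac{\max\{L_{yy},L_{yx}\}}{\mu_y}\Big)\gamma\,\epsilon^{-2}+\Big(\tfrac{\delta_x^2}{\gamma}+\tfrac{\delta_y^2}{\mu_y}\Big)\gamma^2\,\epsilon^{-4}\Big)\,\mathcal{G}(x_0^0,y_0^0).$$
   Context: Let $\mathcal X=\mathbb R^n$, $\mathcal Y=\mathbb R^m$ with Euclidean norm $\|\cdot\|$, and $\mathrm{prox}_{\lambda h}(x)=\arg\min_w\{h(w)+\frac{1}{2\lambda}\|w-x\|^2\}$. Consider $\min_{x\in\mathcal X}\max_{y\in\mathcal Y}\mathcal L(x,y)$ with $\mathcal L(x,y)=f(x)+\Phi(x,y)-g(y)$. Structural assumption: $f:\mathcal X\to\mathbb R\cup\{+\infty\}$, $g:\mathcal Y\to\mathbb R\cup\{+\infty\}$ are proper, closed, convex; $\Phi:\mathcal X\times\mathcal Y\to\mathbb R$ is such that (i) for any $y\in\operatorname{dom} g$, $\Phi(\cdot,y)$ is $\gamma$-weakly convex (i.e. $x\mapsto\Phi(x,y)+\frac{\gamma}{2}\|x\|^2$ is convex), with $\gamma>0$, and bounded from below; (ii) for any $x\in\operatorname{dom} f$, $\Phi(x,\cdot)$ is $\mu_y$-strongly concave with $\mu_y>0$; (iii) $\Phi$ is differentiable on an open set containing $\operatorname{dom} f\times\operatorname{dom} g$. Smoothness assumption: there are $L_{xx},L_{yy}\ge0$, $L_{xy},L_{yx}>0$ with $\|\nabla_x\Phi(x,y)-\nabla_x\Phi(\bar x,\bar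 y)\|\le L_{xx}\|x-\bar x\|+L_{xy}\|y-\bar y\|$ and $\|\nabla_y\Phi(x,y)-\nabla_y\Phi(\bar x,\bar y)\|\le L_{yx}\|x-\bar x\|+L_{yy}\|y-\bar y\|$ for all $x,\bar x\in\operatorname{dom} f$, $y,\bar y\in\operatorname{dom} g$. Since $\Phi(\cdot,y)$ is then $L_{xx}$-weakly convex, $\gamma\le L_{xx}$ by convention. Bounded-subgradient assumption: there exist $B_f,B_g>0$ such that $\inf\{\|s_f\|: s_f\in\partial f(x)\}\le B_f$ for all $x\in\operatorname{dom} f$ and $\inf\{\|s_g\|: s_g\in\partial g(y)\}\le B_g$ for all $y\in\operatorname{dom} g$. SAPD$(\tau,\sigma,\theta,\mu_x,x_0,y_0,N)$: set $\tilde q_0=0$; for $k=0,\dots,N-1$: $\tilde s_k=\tilde\nabla_y\Phi(x_k,y_k;\omega_k^y)+\theta\tilde q_k$; $y_{k+1}=\mathrm{prox}_{\sigma g}(y_k+\sigma\tilde s_k)$; $x_{k+1}=\mathrm{prox}_{\tau f}\big(x_k-\tau[\tilde\nabla_x\Phi(x_k,y_{k+1};\omega_k^x)+(\mu_x+\gamma)(x_k-x_0)]\big)$; $\tilde q_{k+1}=\tilde\nabla_y\Phi(x_{k+1},y_{k+1};\omega_{k+1}^y)-\tilde\nabla_y\Phi(x_k,y_k;\omega_k^y)$. Output $\frac1N\sum_{k=0}^{N-1}(x_{k+1},y_{k+1})$. Here $\tilde\nabla_x\Phi(\cdot,\cdot;\omega)$, $\tilde\nabla_y\Phi(\cdot,\cdot;\omega)$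 are stochastic gradient estimates; one evaluation is one stochastic first-order oracle call. (SAPD targets $\min_x\max_y\mathcal L(x,y)+\frac{\mu_x+\gamma}{2}\|x-x_0\|^2$.) Noise assumption: for arbitrary starting point and $\mu_x>0$, there are $\delta_x,\delta_y\ge0$ such that along SAPD iterates, for all $k\ge0$: $\mathbb E[\tilde\nabla_x\Phi(x_k,y_{k+1};\omega_k^x)\mid x_k,y_{k+1}]=\nabla_x\Phi(x_k,y_{k+1})$; $\mathbb E[\tilde\nabla_y\Phi(x_k,y_k;\omega_k^y)\mid x_k,y_k]=\nabla_y\Phi(x_k,y_k)$; $\mathbb E[\|\tilde\nabla_x\Phi(x_k,y_{k+1};\omega_k^x)-\nabla_x\Phi(x_k,y_{k+1})\|^2\mid x_k,y_{k+1}]\le\delta_x^2$; $\mathbb E[\|\tilde\nabla_y\Phi(x_k,y_k;\omega_k^y)-\nabla_y\Phi(x_k,y_k)\|^2\mid x_k,y_k]\le\delta_y^2$. SAPD+ (without variance reduction): for $t=0,1,\dots,T$, $(x_0^{t+1},y_0^{t+1})=\mathrm{SAPD}(\tau,\sigma,\theta,\mu_x,x_0^t,y_0^t,N_t)$. Notation: $\phi(x)=\max_{y\in\mathcal Y}\mathcal L(x,y)$, which is $\gamma$-weakly convex. For $\lambda\in(0,\gamma^{-1})$ its Moreau envelope is $\phi_\lambda(x)=\min_{w}\phi(w)+\frac1{2\lambda}\|w-x\|^2$, which is differentiable with $\nabla\phi_\lambda(x)=\lambda^{-1}(x-\mathrm{prox}_{\lambda\phi}(x))$. $\mathcal G(x,y)=\sup_{y'\in\mathcal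 Y}\mathcal L(x,y')-\inf_{x'\in\mathcal X}\mathcal L(x',y)$. The terms $\epsilon^2/\delta_x^2$, $\epsilon^2/\delta_y^2$ are $+\infty$ if $\delta_x=0$, $\delta_y=0$. $\mathcal O(\cdot)$ is understood as $\epsilon\to0$ with an absolute hidden constant.
   Formalization: The noise assumption's conditional expectations are taken given the current point together with all earlier gradient estimates of the run, not the current point alone; with noise correlated across iterations through a hidden variable, the literal conditioning makes the claim false. *)

(* Defs.v *)
From HB Require Import structures.
From mathcomp Require Export all_boot all_order all_algebra.
From mathcomp Require Export all_classical all_reals all_analysis.

Set Implicit Arguments.
Unset Strict Implicit.
Unset Printing Implicit Defensive.

Export Order.TTheory GRing.Theory Num.Theory numFieldNormedType.Exports.

Local Open Scope classical_set_scope.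
Local Open Scope ring_scope.

Section Euclidean.
Context {R : realType} {n : nat}.
Implicit Types (u v x w s : 'rV[R]_n).

Definition dotp u v : R := \sum_(i < n) u 0 i * v 0 i.

(* The norm that the library puts on ['rV[R]_n] is the sup norm, hence this
   separate Euclidean norm; both induce the same topology. *)
Definition enorm v : R := Num.sqrt (\sum_(i < n) v 0 i ^+ 2).

Definition gradient (h : 'rV[R]_n -> R) x : 'rV[R]_n :=
  \row_(i < n) 'D_(delta_mx 0 i) (h : 'rV[R]_n -> R^o) x.

End Euclidean.

Section ConvexAnalysis.
Context {R : realType} {n : nat}.
Implicit Types (h : 'rV[R]_n -> \bar R) (x w s : 'rV[R]_n).
Local Open Scope ereal_scope.

Definition edom h : set 'rV[R]_n := [set x | h x < +oo].

Definition proper_fun h : Prop := (forall x, -oo < h x) /\ edom h !=set0.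

Definition closed_fun h : Prop :=
  closed [set z : 'rV[R]_n * R | h z.1 <= z.2%:E].

(* With [0 * +oo = 0] the inequality is trivial at [t = 0] and [t = 1]. *)
Definition convex_efun h : Prop :=
  forall x w (t : R), (0 <= t <= 1)%R ->
    h (t *: x + (1 - t) *: w)%R <= t%:E * h x + (1 - t)%:E * h w.

Definition subdifferential h x : set 'rV[R]_n :=
  [set s | forall w, h x + (dotp s (w - x))%:E <= h w].

Definition prox_objective (lam : R) h x w : \bar R :=
  h w + ((2 * lam)^-1 * enorm (w - x) ^+ 2)%:E.

(* [get] returns the minimizer; it is unique in all the uses below. *)
Definition prox (lam : R) h x : 'rV[R]_n :=
  get [set w | forall w', prox_objective lam h x w <= prox_objective lam h x w'].

Definition moreau (lam : R) h x : R :=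
  fine (ereal_inf (range (prox_objective lam h x))).

End ConvexAnalysis.

Section Minimax.
Context {R : realType} {n m : nat}.
Variables (f : 'rV[R]_n -> \bar R) (g : 'rV[R]_m -> \bar R).
Variable Phi : 'rV[R]_n -> 'rV[R]_m -> R.

Definition grad_x x y : 'rV[R]_n := gradient (fun x' => Phi x' y) x.
Definition grad_y x y : 'rV[R]_m := gradient (fun y' => Phi x y') y.

(* In [\bar R], [+oo - +oo = -oo], so that points outside of [edom g] never
   contribute to a supremum over [y], also when [x] is not in [edom f]. *)
Definition Lag x y : \bar R := (f x + (Phi x y)%:E - g y)%E.

Definition primal x : \bar R := ereal_sup (range (Lag x)).

Definition gap x y : \bar R :=
  (ereal_sup (range (Lag x)) - ereal_inf (range (fun x' => Lag x' y)))%E.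

Record structural_assumption (gamma muy : R) : Prop := {
  f_proper : proper_fun f;
  f_closed : closed_fun f;
  f_convex : convex_efun f;
  g_proper : proper_fun g;
  g_closed : closed_fun g;
  g_convex : convex_efun g;
  gamma_gt0 : 0 < gamma;
  Phi_weakly_convex : forall y, edom g y ->
    convex_function [set: 'rV[R]_n]
      (fun x => Phi x y + gamma / 2 * enorm x ^+ 2);
  Phi_bounded_below : forall y, edom g y ->
    exists c : R, forall x, c <= Phi x y;
  muy_gt0 : 0 < muy;
  Phi_strongly_concave : forall x, edom f x ->
    convex_function [set: 'rV[R]_m]
      (fun y => - (Phi x y + muy / 2 * enorm y ^+ 2));
  Phi_differentiable : exists O : set ('rV[R]_n * 'rV[R]_m),
    [/\ open O, edom f `*` edom g `<=` O &
        forall z, O z ->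
          differentiable
            (fun z' : 'rV[R]_n * 'rV[R]_m => (Phi z'.1 z'.2 : R^o)) z]
}.

Record smoothness_assumption (gamma Lxx Lxy Lyx Lyy : R) : Prop := {
  Lxx_ge0 : 0 <= Lxx;
  Lyy_ge0 : 0 <= Lyy;
  Lxy_gt0 : 0 < Lxy;
  Lyx_gt0 : 0 < Lyx;
  gamma_le_Lxx : gamma <= Lxx;
  grad_x_lip : forall x x' y y', edom f x -> edom f x' -> edom g y -> edom g y' ->
    enorm (grad_x x y - grad_x x' y')
      <= Lxx * enorm (x - x') + Lxy * enorm (y - y');
  grad_y_lip : forall x x' y y', edom f x -> edom f x' -> edom g y -> edom g y' ->
    enorm (grad_y x y - grad_y x' y')
      <= Lyx * enorm (x - x') + Lyy * enorm (y - y')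
}.

Definition bounded_subgradient_assumption : Prop :=
  exists Bf Bg : R, [/\ 0 < Bf, 0 < Bg,
    forall x, edom f x ->
      (ereal_inf [set (enorm s)%:E | s in subdifferential f x] <= Bf%:E)%E &
    forall y, edom g y ->
      (ereal_inf [set (enorm s)%:E | s in subdifferential g y] <= Bg%:E)%E].

End Minimax.

Section ConditionalExpectation.
Context {R : realType} {d : measure_display} {Omega : measurableType d}.
Variable P : probability Omega R.
Implicit Types (F : set_system Omega) (V Z : Omega -> R).

Definition sigma_generated (H : set (Omega -> R)) : set_system Omega :=
  <<s [set A | exists h (B : set R), [/\ H h, measurable B & A = h @^-1` B]] >>.

Definition coordinates {p : nat} (V : Omega -> 'rV[R]_p) : set (Omega -> R) :=
  range (fun (i : 'I_p) w => V w 0 i).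

(* [Z] is a version of [E[V | F]]. *)
Definition is_cond_exp F V Z : Prop :=
  [/\ F `<=` measurable,
      P.-integrable setT (EFin \o V),
      forall B : set R, measurable B -> F (Z @^-1` B) &
      forall A, F A -> (\int[P]_(w in A) (Z w)%:E = \int[P]_(w in A) (V w)%:E)%E].

Definition cond_exp_eq F V (W : Omega -> R) : Prop :=
  exists2 Z, is_cond_exp F V Z & {ae P, forall w, Z w = W w}.

Definition cond_exp_vec_eq {p : nat} F (V W : Omega -> 'rV[R]_p) : Prop :=
  forall i, cond_exp_eq F (fun w => V w 0 i) (fun w => W w 0 i).

Definition cond_exp_le F V (c : R) : Prop :=
  exists2 Z, is_cond_exp F V Z & {ae P, forall w, Z w <= c}.

End ConditionalExpectation.

Section Algorithm.
Context {R : realType} {n m : nat} {S : Type}.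
Variables (f : 'rV[R]_n -> \bar R) (g : 'rV[R]_m -> \bar R).
(* stochastic oracles: [gX x y w] and [gY x y w] are the estimates, for the
   sample [w], of the two partial gradients at [(x, y)] *)
Variable gX : 'rV[R]_n -> 'rV[R]_m -> S -> 'rV[R]_n.
Variable gY : 'rV[R]_n -> 'rV[R]_m -> S -> 'rV[R]_m.
Variables (gamma tau sigma theta mux : R).

(* the triple (x_k, y_k, q_k) of the run that starts at [(x0, y0)] and uses the
   samples [wx k] and [wy k] *)
Fixpoint sapd_state (wx wy : nat -> S) (x0 : 'rV[R]_n) (y0 : 'rV[R]_m) (k : nat) :
    'rV[R]_n * 'rV[R]_m * 'rV[R]_m :=
  if k is k'.+1 then
    let: (x, y, q) := sapd_state wx wy x0 y0 k' in
    let s := gY x y (wy k') + theta *: q in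
    let y1 := prox sigma g (y + sigma *: s) in
    let x1 := prox tau f
      (x - tau *: (gX x y1 (wx k') + (mux + gamma) *: (x - x0))) in
    (x1, y1, gY x1 y1 (wy k'.+1) - gY x y (wy k'))
  else (x0, y0, 0).

Definition sapd_x wx wy x0 y0 k := (sapd_state wx wy x0 y0 k).1.1.
Definition sapd_y wx wy x0 y0 k := (sapd_state wx wy x0 y0 k).1.2.

Definition sapd wx wy x0 y0 (N : nat) : 'rV[R]_n * 'rV[R]_m :=
  (N%:R^-1 *: \sum_(k < N) sapd_x wx wy x0 y0 k.+1,
   N%:R^-1 *: \sum_(k < N) sapd_y wx wy x0 y0 k.+1).

Context {Omega : Type}.
(* [wx t k] and [wy t k] are the samples of iteration [k] of the [t]-th call *)
Variables wx wy : nat -> nat -> Omega -> S.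
Variables (x00 : 'rV[R]_n) (y00 : 'rV[R]_m) (Nt : nat -> nat).

Fixpoint sapd_plus (t : nat) (w : Omega) : 'rV[R]_n * 'rV[R]_m :=
  if t is t'.+1 then
    let: (x0, y0) := sapd_plus t' w in
    sapd (fun k => wx t' k w) (fun k => wy t' k w) x0 y0 (Nt t')
  else (x00, y00).

Definition iter_x t k w :=
  sapd_x (fun k => wx t k w) (fun k => wy t k w)
    (sapd_plus t w).1 (sapd_plus t w).2 k.
Definition iter_y t k w :=
  sapd_y (fun k => wx t k w) (fun k => wy t k w)
    (sapd_plus t w).1 (sapd_plus t w).2 k.

Definition est_x t k w := gX (iter_x t k w) (iter_y t k.+1 w) (wx t k w).
Definition est_y t k w := gY (iter_x t k w) (iter_y t k w) (wy t k w).

End Algorithm.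

Section Noise.
Context {R : realType} {n m : nat}.
Context {d : measure_display} {Omega : measurableType d}.
Variable P : probability Omega R.
Variable Phi : 'rV[R]_n -> 'rV[R]_m -> R.
(* [xs t k], [ys t k]: iterates; [ex t k], [ey t k]: gradient estimates returned
   at iteration [k] of the [t]-th call, at the points [(xs t k, ys t k.+1)] and
   [(xs t k, ys t k)] *)
Variables (xs ex : nat -> nat -> Omega -> 'rV[R]_n).
Variables (ys ey : nat -> nat -> Omega -> 'rV[R]_m).
Variable Nt : nat -> nat.

(* coordinates of the estimates returned before iteration [k] of call [t] *)
Definition past t k : set (Omega -> R) :=
  [set h | exists s j, [/\ (s < t) && (j < Nt s) || (s == t) && (j < k) &
      (coordinates (ex s j) `|` coordinates (ey s j)) h]]%N.

(* Conditioning on the current point is understood, as usual for stochastic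
   first-order methods, together with the part of the run that precedes the draw
   of the sample.  The earlier iterates are functions of the earlier estimates,
   and need not be listed. *)
Definition hist_y t k : set_system Omega :=
  sigma_generated (coordinates (xs t k) `|` coordinates (ys t k) `|` past t k).
Definition hist_x t k : set_system Omega :=
  sigma_generated (coordinates (xs t k) `|` coordinates (ys t k.+1)
    `|` coordinates (ey t k) `|` past t k).

Record noise_assumption (deltax deltay : R) : Prop := {
  unbiased_x : forall t k, (k < Nt t)%N ->
    cond_exp_vec_eq P (hist_x t k) (ex t k)
      (fun w => grad_x Phi (xs t k w) (ys t k.+1 w));
  unbiased_y : forall t k, (k < Nt t)%N ->
    cond_exp_vec_eq P (hist_y t k) (ey t k)
      (fun w => grad_y Phi (xs t k w) (ys t k w));
  variance_x : forall t k, (k < Nt t)%N ->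
    cond_exp_le P (hist_x t k)
      (fun w => enorm (ex t k w - grad_x Phi (xs t k w) (ys t k.+1 w)) ^+ 2)
      (deltax ^+ 2);
  variance_y : forall t k, (k < Nt t)%N ->
    cond_exp_le P (hist_y t k)
      (fun w => enorm (ey t k w - grad_y Phi (xs t k w) (ys t k w)) ^+ 2)
      (deltay ^+ 2)
}.

End Noise.

Section Complexity.
Context {R : realType} {n : nat}.
Context {d : measure_display} {Omega : measurableType d}.
Variable P : probability Omega R.
Local Open Scope ereal_scope.

(* Oracle calls of one SAPD run of [N] iterations: one estimate of grad_x at each
   k = 0, ..., N-1 and one estimate of grad_y at each k = 0, ..., N. *)
Definition sapd_calls (N : nat) : nat := (N + N.+1)%N.

Definition outer_mean (T : nat) (a : nat -> \bar R) : \bar R :=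
  (T.+1%:R^-1)%:E * \sum_(0 <= t < T.+1) a t.

(* Number of oracle calls spent to compute a point at which [gr] has expected
   norm at most [eps].  The point is [x0 t] with [t] uniform on {0, ..., T} and
   independent of the run, so that the expected norm is the mean over [t]; the
   iterates x0 0, ..., x0 T cost [T] runs of SAPD. *)
Definition sfo_complexity (gr : 'rV[R]_n -> 'rV[R]_n)
    (x0 : nat -> Omega -> 'rV[R]_n) (N : nat) (eps : R) : \bar R :=
  ereal_inf [set (T * sapd_calls N)%N%:R%:E | T in
    [set T | outer_mean T (fun t => 'E_P[fun w => enorm (gr (x0 t w))]) <= eps%:E]].

End Complexity.

(* [eps ^+ 2 / delta ^+ 2], equal to [+oo] when [delta = 0] *)
Definition noise_ratio {R : realType} (eps delta : R) : \bar R :=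
  if delta == 0 then +oo%E else (eps ^+ 2 / delta ^+ 2)%:E.

(* Main.v *)
(* With [L^c(x, y) = L(x, y) + gamma |x - c|^2], the contraction principle applied
   to a forward-backward step gives a saddle point (X(c), Y(c)) of [L^c]; it is
   Lipschitz in c, and the gradient of the Moreau envelope at c is
   2 gamma (c - X(c)).  Let (x_t, y_t) be the starting point of call t, and
     a_t = gamma |x_t - X(x_t)|^2,   b_t = mu |y_t - Y(x_t)|^2,
     D_t = gamma |x_{t+1} - X(x_t)|^2 + mu |y_{t+1} - Y(x_t)|^2.
   One call is analysed with the fixed comparison point (X(x_t), Y(x_t)), not with
   a supremum inside of the expectation: the errors pair with noise-free iterates
   that do not depend on them, so these products have mean zero, and
     E D_t <= (E a_t + E b_t) / 33 + O(tau deltax^2 + sigma deltay^2).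
   Along the run, the Moreau envelope decreases by at least a_t - D_t, and
   b_{t+1} <= 4 D_t + 4 a_t.  Summing these three inequalities bounds the mean of
   the a_t, hence of |grad|^2 = 4 gamma a_t.  A
   subgradient of f, and one of g, gives an affine minorant, which makes the
   proximal maps well-defined. *)

(* Momentum makes the error of one [y]-estimate act twice, on the next [y] and on the one after,
   which also feels the [x]-step in between. The noise-free iterates therefore look two steps ahead:
   [sapd_yhat] redoes these steps without that error and depends only on what precedes it. Square
   integrability of the iterates is no hypothesis, and the gradients are controlled on the domains
   only. Proximal maps, partial gradients and saddle points are all Lipschitz, and a Lipschitz map
   preserves square integrability and measurability for a sub-sigma-algebra, also when its domain is
   not measurable. So these properties pass from the estimates to every quantity in the proof. Write
   A, B, D for the sums over t of E a_t, E b_t, E D_t, and G for the initial gap. Then A <= G + D, B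
   <= 2 G + 4 D + 4 A and D <= (A + B) / 33 + noise, where noise is the summed noise term;
   elimination gives 24 A <= 31 G + 33 noise. With K instead of 33 the left factor is K - 9, so the
   contraction must be stronger than 1/9, which is what the choice of N ensures. *)
Require Import Defs.
From mathcomp Require Import measurable_realfun ring lra.

Set Implicit Arguments.
Unset Strict Implicit.
Unset Printing Implicit Defensive.

Local Open Scope classical_set_scope.
Local Open Scope ring_scope.

(** * Inner product and Euclidean norm on row vectors *)

Section EuclideanTheory.
Context {R : realType} {n : nat}.
Implicit Types (u v w : 'rV[R]_n) (a b c : R).

Lemma dotpC u v : dotp u v = dotp v u.
Proof. by apply: eq_bigr => i _; rewrite mulrC. Qed.

Lemma dotpDl u v w : dotp (u + v) w = dotp u w + dotp v w.
Proof. by rewrite /dotp -big_split; apply: eq_bigr => i _; rewrite mxE mulrDl. Qed.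

Lemma dotpZl a u v : dotp (a *: u) v = a * dotp u v.
Proof. by rewrite /dotp mulr_sumr; apply: eq_bigr => i _; rewrite mxE mulrA. Qed.

Lemma dotpNl u v : dotp (- u) v = - dotp u v.
Proof. by rewrite -scaleN1r dotpZl mulN1r. Qed.

Lemma dotpDr u v w : dotp w (u + v) = dotp w u + dotp w v.
Proof. by rewrite !(dotpC w) dotpDl. Qed.

Lemma dotpZr a u v : dotp v (a *: u) = a * dotp v u.
Proof. by rewrite !(dotpC v) dotpZl. Qed.

Lemma dotpNr u v : dotp v (- u) = - dotp v u.
Proof. by rewrite !(dotpC v) dotpNl. Qed.

Lemma dotp0l u : dotp 0 u = 0.
Proof. by rewrite -(scale0r u) dotpZl mul0r. Qed.

Lemma dotp0r u : dotp u 0 = 0.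
Proof. by rewrite dotpC dotp0l. Qed.

Lemma dotp_ge0 u : 0 <= dotp u u.
Proof. by apply: sumr_ge0 => i _; rewrite -expr2 sqr_ge0. Qed.

Lemma enorm_ge0 u : 0 <= enorm u.
Proof. exact: sqrtr_ge0. Qed.

Lemma enorm2E u : enorm u ^+ 2 = dotp u u.
Proof.
rewrite sqr_sqrtr; last by apply: sumr_ge0 => i _; rewrite sqr_ge0.
by apply: eq_bigr => i _; rewrite expr2.
Qed.

End EuclideanTheory.

(** Turns an identity between squared norms into a polynomial one in inner products. The loop gives
    [dotp a b] and [dotp b a] the same orientation, so that [ring] and [lra] see a single atom. *)
Ltac dotp_expand :=
  rewrite ?enorm2E ?(dotpDl, dotpDr, dotpNl, dotpNr, dotpZl, dotpZr, dotp0l, dotp0r);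
  repeat match goal with
  | |- context [dotp ?a ?b] =>
    tryif constr_eq a b then fail else
    match goal with |- context [dotp b a] => rewrite (dotpC b a) end
  end.

Section EuclideanInequalities.
Context {R : realType} {n : nat}.
Implicit Types (u v w : 'rV[R]_n) (a b c : R).

Lemma dotp_le_young c u v : 0 < c ->
  2 * dotp u v <= c * enorm u ^+ 2 + c^-1 * enorm v ^+ 2.
Proof.
move=> c0; have : 0 <= c^-1 * dotp (c *: u - v) (c *: u - v).
  by rewrite mulr_ge0 ?invr_ge0 ?(ltW c0) ?dotp_ge0.
have -> : c^-1 * dotp (c *: u - v) (c *: u - v)
  = c * enorm u ^+ 2 + c^-1 * enorm v ^+ 2 - 2 * dotp u v.
  by dotp_expand; field; rewrite gt_eqF.
by rewrite subr_ge0.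
Qed.

Lemma enorm0 : enorm (0 : 'rV[R]_n) = 0.
Proof. by apply/eqP; rewrite -sqrf_eq0 enorm2E dotp0l. Qed.

Lemma enorm_eq0 u : (enorm u == 0) = (u == 0).
Proof.
apply/idP/eqP => [|->]; last by rewrite enorm0.
rewrite -sqrf_eq0 enorm2E => /eqP h; apply/rowP => i; rewrite mxE.
have : forall j : 'I_n, true -> 0 <= u 0 j * u 0 j by move=> j _; rewrite -expr2 sqr_ge0.
move=> /(psumr_eq0P) /(_ h) /(_ i isT) /eqP.
by rewrite mulf_eq0 orbb => /eqP.
Qed.

Lemma enormN u : enorm (- u) = enorm u.
Proof. by congr Num.sqrt; apply: eq_bigr => i _; rewrite mxE sqrrN. Qed.

Lemma enormB u v : enorm (u - v) = enorm (v - u).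
Proof. by rewrite -enormN opprB. Qed.

Lemma enormZ a u : enorm (a *: u) = `|a| * enorm u.
Proof.
apply/eqP; rewrite -(@eqrXn2 _ 2) ?mulr_ge0 ?enorm_ge0// exprMn.
by rewrite real_normK ?num_real// !enorm2E dotpZl dotpZr mulrA expr2.
Qed.

Lemma dotp_le u v : dotp u v <= enorm u * enorm v.
Proof.
have [/eqP|u0] := eqVneq (enorm u) 0.
  by rewrite enorm_eq0 => /eqP ->; rewrite dotp0l enorm0 mul0r.
have [/eqP|v0] := eqVneq (enorm v) 0.
  by rewrite enorm_eq0 => /eqP ->; rewrite dotp0r enorm0 mulr0.
have up : 0 < enorm u by rewrite lt_def u0 enorm_ge0.
have vp : 0 < enorm v by rewrite lt_def v0 enorm_ge0.
(* For this weight both terms on the right of Young's inequality equal |u| |v|. *)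
have := @dotp_le_young (enorm v / enorm u) u v (divr_gt0 vp up).
have -> : enorm v / enorm u * enorm u ^+ 2 + (enorm v / enorm u)^-1 * enorm v ^+ 2
  = 2 * (enorm u * enorm v) by field; rewrite u0 v0.
by rewrite ler_pM2l.
Qed.

Lemma dotp_ge u v : - (enorm u * enorm v) <= dotp u v.
Proof. by rewrite lerNl -dotpNl -(enormN u) dotp_le. Qed.

Lemma ler_enormD u v : enorm (u + v) <= enorm u + enorm v.
Proof.
rewrite -(@ler_pXn2r _ 2) ?nnegrE ?addr_ge0 ?enorm_ge0// sqrrD.
have := dotp_le u v; rewrite !enorm2E; dotp_expand; lra.
Qed.

Lemma ler_enormBD w u v : enorm (u - v) <= enorm (u - w) + enorm (w - v).
Proof. by have := ler_enormD (u - w) (w - v); rewrite addrA subrK. Qed.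

Lemma ler_abs_enorm u i : `|u 0 i| <= enorm u.
Proof.
rewrite -(@ler_pXn2r _ 2) ?nnegrE ?enorm_ge0// real_normK ?num_real// enorm2E.
rewrite /dotp (bigD1 i)//= -expr2 lerDl sumr_ge0// => j _.
by rewrite -expr2 sqr_ge0.
Qed.

Lemma enorm_le_sum u : enorm u <= \sum_(i < n) `|u 0 i|.
Proof.
rewrite -(@ler_pXn2r _ 2) ?nnegrE ?enorm_ge0// ?sumr_ge0// enorm2E expr2.
rewrite mulr_suml; apply: ler_sum => i _.
rewrite (bigD1 i)//= mulrDr -normrM ger0_norm -?expr2 ?sqr_ge0//.
by rewrite lerDl mulr_ge0// sumr_ge0.
Qed.

Lemma enorm_le_mx_norm u : enorm u <= n%:R * `|u|.
Proof.
apply: (le_trans (enorm_le_sum u)).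
apply: (@le_trans _ _ (\sum_(i < n) `|u|)); last by rewrite sumr_const card_ord mulr_natl.
apply: ler_sum => i _; rewrite {2}/Num.norm/= mx_normrE.
exact: (le_bigmax _ (fun ij : 'I_1 * 'I_n => `|u ij.1 ij.2|) (0, i)).
Qed.

Lemma mx_norm_le_enorm u : `|u| <= enorm u.
Proof.
rewrite {1}/Num.norm/= mx_normrE; apply/bigmax_leP; split; first exact: enorm_ge0.
by move=> [i j] _ /=; rewrite (ord1 i) ler_abs_enorm.
Qed.

Lemma enormD2_le u v : enorm (u + v) ^+ 2 <= 2 * enorm u ^+ 2 + 2 * enorm v ^+ 2.
Proof. by have := dotp_ge0 (u - v); dotp_expand; lra. Qed.

Lemma enorm2_addZ a u v :
  enorm (u + a *: v) ^+ 2 = enorm u ^+ 2 + 2 * a * dotp v u + a ^+ 2 * enorm v ^+ 2.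
Proof. by dotp_expand; ring. Qed.

(** Jensen's inequality: each |x k - u|^2 lies above its tangent at the mean [b], and the linear
    parts sum to zero. It carries bounds on the iterates over to the averaged output of a run. *)
Lemma enorm_mean_le (N : nat) (x : nat -> 'rV[R]_n) u : (0 < N)%N ->
  enorm (N%:R^-1 *: \sum_(k < N) x k - u) ^+ 2 <=
  N%:R^-1 * \sum_(k < N) enorm (x k - u) ^+ 2.
Proof.
move=> N0; set b := _ *: _.
have NR : (0 : R) < N%:R by rewrite ltr0n.
have bE : \sum_(k < N) x k = N%:R *: b by rewrite scalerA divff ?scale1r ?gt_eqF.
have key : forall k : 'I_N, true ->
    enorm (b - u) ^+ 2 + 2 * dotp (x k - b) (b - u) <= enorm (x k - u) ^+ 2.
  by move=> k _; have := dotp_ge0 (x k - b); dotp_expand; lra.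
have : \sum_(k < N) (enorm (b - u) ^+ 2 + 2 * dotp (x k - b) (b - u))
    <= \sum_(k < N) enorm (x k - u) ^+ 2 by exact: ler_sum.
rewrite big_split/= sumr_const card_ord -mulr_sumr.
have -> : \sum_(k < N) dotp (x k - b) (b - u) = 0.
  have -> : \sum_(k < N) dotp (x k - b) (b - u) = dotp (\sum_(k < N) (x k - b)) (b - u).
    elim/big_ind2 : _; [by rewrite dotp0l|by move=> ? ? ? ? -> ->; rewrite dotpDl|by []].
  by rewrite sumrB sumr_const card_ord bE scaler_nat subrr dotp0l.
rewrite mulr0 addr0 -[_ ^+ 2 *+ N]mulr_natl => h.
rewrite -(@ler_pM2l _ N%:R)//.
by rewrite mulVKf ?gt_eqF.
Qed.

End EuclideanInequalities.

Section EuclideanLimits.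
Context {R : realType} {n : nat}.
Implicit Types (w : nat -> 'rV[R]_n) (p : 'rV[R]_n).

Lemma cvg_enorm w p : w @ \oo --> p <-> enorm (w k - p) @[k --> \oo] --> 0.
Proof.
split=> [wp|wp].
  have h0 : (n%:R : R) * `|w k - p| @[k --> \oo] --> 0.
    rewrite -[X in _ --> X](mulr0 (n%:R : R)).
    apply: cvgM; first exact: cvg_cst.
    apply/norm_cvg0P; rewrite -(subrr p); apply: cvgB => //; exact: cvg_cst.
  apply: (squeeze_cvgr _ (cvg_cst 0) h0).
  by near=> k; rewrite enorm_ge0 enorm_le_mx_norm.
apply/cvgrPdist_lt => e e0.
have /cvgrPdist_lt /(_ _ e0) := wp.
apply: filterS => k; rewrite sub0r normrN ger0_norm ?enorm_ge0// => h.
by rewrite distrC (le_lt_trans (mx_norm_le_enorm _)).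
Unshelve. all: by end_near.
Qed.

Lemma cauchy_rate_cvg w (r : nat -> R) : r @ \oo --> 0 ->
  (forall k l, (k <= l)%N -> enorm (w k - w l) <= r k) -> cvg (w @ \oo).
Proof.
move=> r0 wr; apply: (@cauchy_cvg _ (w @ \oo)); apply/cauchy_exP => e e0.
have /cvgrPdist_lt /(_ _ e0) [K _ hK] := r0.
exists (w K); exists K => // l /= Kl.
rewrite -ball_normE /ball_/= (le_lt_trans (mx_norm_le_enorm _))//.
rewrite (le_lt_trans (wr _ _ Kl))//.
by have := hK K (leqnn K); rewrite sub0r normrN; apply: le_lt_trans; rewrite ler_norm.
Qed.

Lemma cvg_enorm_dist w p q : w @ \oo --> p ->
  enorm (w k - q) @[k --> \oo] --> enorm (p - q).
Proof.
move=> /cvg_enorm wp.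
have h (s : R) : enorm (p - q) + s * enorm (w k - p) @[k --> \oo] --> enorm (p - q).
  rewrite -[X in _ --> X]addr0 -(mulr0 s); apply: cvgD; first exact: cvg_cst.
  by apply: cvgM wp; exact: cvg_cst.
apply: (squeeze_cvgr _ (h (- 1)) (h 1)); near=> k.
have := ler_enormBD p (w k) q; have := ler_enormBD (w k) p q.
rewrite (enormB p (w k)); lra.
Unshelve. all: by end_near.
Qed.

Lemma cvg_enorm_unique w p q : w @ \oo --> p -> w @ \oo --> q -> p = q.
Proof. by move=> wp wq; apply: (@cvg_unique _ _ (w @ \oo)). Qed.

End EuclideanLimits.

(** * Existence of proximal points, with quadratic growth *)

Section ProximalMap.
Context {R : realType} {n : nat}.
Variable h : 'rV[R]_n -> \bar R.
Hypotheses (h_proper : proper_fun h) (h_closed : closed_fun h).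
Hypotheses (h_convex : convex_efun h).
Variables (z0 s0 : 'rV[R]_n).
Hypotheses (h_z0 : edom h z0) (h_s0 : subdifferential h z0 s0).
Implicit Types (x w u : 'rV[R]_n).

Let hr x : R := fine (h x).

Lemma edom_fineK x : edom h x -> h x = (fine (h x))%:E.
Proof. by move=> hx; rewrite fineK// fin_real// (h_proper.1 x)//=. Qed.

Lemma edom_convex x w t : edom h x -> edom h w -> 0 <= t <= 1 ->
  edom h (t *: x + (1 - t) *: w).
Proof.
move=> hx hw t01; apply: le_lt_trans (h_convex x w t01) _.
by rewrite (edom_fineK hx) (edom_fineK hw) -!EFinM -EFinD ltry.
Qed.

Lemma fine_convex x w t : edom h x -> edom h w -> 0 <= t <= 1 ->
  fine (h (t *: x + (1 - t) *: w)) <= t * fine (h x) + (1 - t) * fine (h w).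
Proof.
move=> hx hw t01; have := h_convex x w t01.
rewrite (edom_fineK (edom_convex hx hw t01)) (edom_fineK hx) (edom_fineK hw).
by rewrite -!EFinM -EFinD lee_fin.
Qed.

Let q (a : R) u x := hr x + a * enorm (x - u) ^+ 2.

Let q_ge (a : R) u : 0 < a -> exists c : R, forall x, edom h x -> c <= q a u x.
Proof.
move=> a0; exists (hr z0 + dotp s0 (u - z0) - a^-1 * enorm s0 ^+ 2) => x hx.
have := h_s0 x; rewrite (edom_fineK h_z0) (edom_fineK hx) -EFinD lee_fin.
have := @dotp_le_young R n a (- (x - u)) s0 a0.
rewrite enormN /q /hr => h1 h2.
have : dotp s0 (x - z0) = dotp s0 (x - u) + dotp s0 (u - z0).
  by rewrite -dotpDr addrA subrK.
have := dotpNl (x - u) s0; rewrite (dotpC (x - u) s0).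
have : 0 <= a * enorm (x - u) ^+ 2 by rewrite mulr_ge0 ?sqr_ge0 ?(ltW a0).
have : 0 <= a^-1 * enorm s0 ^+ 2 by rewrite mulr_ge0 ?sqr_ge0 ?invr_ge0 ?(ltW a0).
lra.
Qed.

(** Parallelogram identity: if two nearly optimal points were far apart, their midpoint would beat
    the infimum. Hence minimizing sequences are Cauchy. *)
Let q_mid (a : R) u x w : edom h x -> edom h w ->
  edom h (2^-1 *: x + (1 - 2^-1) *: w) /\
  q a u (2^-1 *: x + (1 - 2^-1) *: w) + a / 4 * enorm (x - w) ^+ 2
    <= (q a u x + q a u w) / 2.
Proof.
move=> hx hw; have t01 : 0 <= (2^-1 : R) <= 1 by apply/andP; split; lra.
split; first exact: edom_convex.
have := fine_convex hx hw t01; rewrite /q /hr; set m := fine _.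
have -> : enorm (2^-1 *: x + (1 - 2^-1) *: w - u) ^+ 2
  = (enorm (x - u) ^+ 2 + enorm (w - u) ^+ 2) / 2 - enorm (x - w) ^+ 2 / 4.
  by dotp_expand; field.
lra.
Qed.

Let q_min (a : R) u : 0 < a ->
  exists2 p, edom h p & forall x, edom h x -> q a u p <= q a u x.
Proof.
move=> a0; have [c qc] := q_ge u a0.
pose Q := [set q a u x | x in edom h].
have Qinf : has_inf Q.
  by split; [exists (q a u z0), z0|exists c => _ [x hx <-]; exact: qc].
pose I := inf Q.
have I_le x : edom h x -> I <= q a u x.
  by move=> hx; apply: ge_inf; [exact: Qinf.2|exists x].
have /choice [w hw] : forall k : nat, exists x, edom h x /\ q a u x < I + k.+1%:R^-1.
  move=> k; have [|_ [x hx <-] xI] := @inf_adherent _ Q k.+1%:R^-1 _ Qinf.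
    by rewrite invr_gt0 ltr0n.
  by exists x.
have wcvg : cvg (w @ \oo).
  (* Values within 1/(k+1) of the infimum and [q_mid] give a/4 |w k - w l|^2 <= 1/(k+1), whence this
     radius. *)
  pose r (k : nat) : R := Num.sqrt (4 / a * k.+1%:R^-1).
  apply: (@cauchy_rate_cvg _ _ w r).
    rewrite /r -[X in _ --> X]sqrtr0.
    apply: (@continuous_cvg _ _ _ _ _ _ Num.sqrt); first exact: sqrt_continuous.
    rewrite -[X in _ --> X](mulr0 (4 / a)); apply: cvgM; first exact: cvg_cst.
    exact: cvg_harmonic.
  move=> k l kl; rewrite -(@ler_pXn2r _ 2) ?nnegrE ?enorm_ge0 ?sqrtr_ge0//.
  have rk0 : (0 : R) <= k.+1%:R^-1 by rewrite invr_ge0.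
  rewrite [r k ^+ 2]sqr_sqrtr ?mulr_ge0 ?invr_ge0 ?(ltW a0)//.
  have [hm] := @q_mid a u _ _ (hw k).1 (hw l).1.
  have := I_le _ hm; have := (hw k).2; have := (hw l).2.
  have lk : (l.+1%:R^-1 : R) <= k.+1%:R^-1 by rewrite lef_pV2 ?posrE ?ltr0n// ler_nat ltnS.
  move=> h1 h2 h3 h4.
  have h5 : a / 4 * enorm (w k - w l) ^+ 2 <= k.+1%:R^-1.
    move: h1 h2 h3 h4 lk; move: (k.+1%:R^-1) (l.+1%:R^-1) (q a u _) (q a u _) (q a u _) => K L q1 q2 q3; lra.
  rewrite -(@ler_pM2l _ (a / 4)) ?divr_gt0//; apply: (le_trans h5).
  by rewrite mulrA (_ : a / 4 * (4 / a) = 1) ?mul1r//; field; rewrite gt_eqF.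
pose p := lim (w @ \oo).
have wp : w @ \oo --> p by exact: wcvg.
(* [rk k] bounds [h (w k)] from above and converges, so the points [(w k, rk k)] of the closed
   epigraph have their limit there. *)
pose rk (k : nat) : R := I + k.+1%:R^-1 - a * enorm (w k - u) ^+ 2.
have rkp : rk @ \oo --> I + 0 - a * enorm (p - u) ^+ 2.
  apply: cvgB; first by apply: cvgD; [exact: cvg_cst|exact: cvg_harmonic].
  apply: cvgM; first exact: cvg_cst.
  by rewrite expr2; apply: cvgM; exact: cvg_enorm_dist.
have hp : (h p <= (I + 0 - a * enorm (p - u) ^+ 2)%:E)%E.
  suff : (fun k => (w k, rk k)) @ \oo --> (p, I + 0 - a * enorm (p - u) ^+ 2).
    apply: (closed_cvg _ h_closed).
    apply: nearW => k /=; rewrite (edom_fineK (hw k).1) lee_fin.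
    by have := (hw k).2; rewrite /q /rk /hr; move: (k.+1%:R^-1) => K; lra.
  exact: (@cvg_pair _ _ _ (@eventually) (nbhs p) (nbhs (I + 0 - a * enorm (p - u) ^+ 2)) _ _ _ w rk wp rkp).
have dp : edom h p by apply: le_lt_trans hp _; rewrite ltry.
exists p => // x hx; have := I_le x hx.
by move: hp; rewrite (edom_fineK dp) lee_fin /q -/(hr p); lra.
Qed.

Lemma prox_proximal (tau : R) u (p := prox tau h u) : 0 < tau -> edom h p /\
  forall x, edom h x ->
    fine (h p) + (2 * tau)^-1 * enorm (p - u) ^+ 2 + (2 * tau)^-1 * enorm (x - p) ^+ 2
    <= fine (h x) + (2 * tau)^-1 * enorm (x - u) ^+ 2.
Proof.
move=> tau0; set a := (2 * tau)^-1.
have a0 : 0 < a by rewrite invr_gt0 mulr_gt0.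
have qE w : edom h w -> prox_objective tau h u w = (q a u w)%:E.
  by move=> hw; rewrite /prox_objective (edom_fineK hw) -EFinD.
have [p0 hp0 p0min] := q_min u a0.
have pmin : forall w, (prox_objective tau h u p <= prox_objective tau h u w)%E.
  (* On an empty set [get] returns a default value; the minimizer [p0] excludes that branch. *)
  rewrite /p /prox; case: xgetP => [y -> //|].
  move=> /(_ p0); case=> w.
  have [hw|hw] := ltP (h w) +oo%E; first by rewrite !qE// lee_fin p0min.
  by move: hw; rewrite leye_eq /prox_objective => /eqP ->; rewrite addye// leey.
have hp : edom h p.
  rewrite /edom/= ltNge leye_eq; apply/negP => /eqP hpE.
  by have := pmin p0; rewrite (qE _ hp0) /prox_objective hpE addye// leye_eq.
split=> // x hx.
have pm w : edom h w -> q a u p <= q a u w.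
  by move=> hw; have := pmin w; rewrite !qE// lee_fin.
(* minimality along the segment from [p] to [x], divided by its parameter *)
have key t : 0 < t <= 1 ->
    q a u p + (1 - t) * (a * enorm (x - p) ^+ 2) <= q a u x.
  move=> /andP[t0 t1]; have t01 : 0 <= t <= 1 by rewrite ltW.
  have := pm _ (edom_convex hx hp t01).
  have := fine_convex hx hp t01; rewrite /q /hr; set m := fine (h (_ + _)).
  have -> : enorm (t *: x + (1 - t) *: p - u) ^+ 2 = t * enorm (x - u) ^+ 2
    + (1 - t) * enorm (p - u) ^+ 2 - t * (1 - t) * enorm (x - p) ^+ 2.
    by dotp_expand; ring.
  move=> h1 h2; rewrite -(@ler_pM2l _ t)//; lra.
have : q a u p + a * enorm (x - p) ^+ 2 <= q a u x; last by rewrite /q /hr; lra.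
apply/ler_addgt0Pl => e e0; set b := a * _ in key *.
have b0 : 0 <= b by rewrite mulr_ge0 ?sqr_ge0 ?(ltW a0).
(* With this parameter [t * b <= e], so [key] loses at most [e]; this replaces the limit at 0. *)
have tpos : 0 < e / (e + b) <= 1.
  by rewrite divr_gt0 ?ltr_wpDr//= ler_pdivrMr ?ltr_wpDr// mul1r lerDl.
have : e / (e + b) * b <= e.
  by rewrite mulrAC ler_pdivrMr ?ltr_wpDr// ler_pM2l// lerDr ltW.
have := key _ tpos; lra.
Qed.

End ProximalMap.

(** * First-order inequalities for convex and for smooth functions *)

Section GradientInequalities.
Context {R : realType} {n : nat}.
Implicit Types (F : 'rV[R]_n -> R) (x v w : 'rV[R]_n).

Lemma derive_gradient F x v : differentiable (F : 'rV[R]_n -> R^o) x ->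
  'D_v (F : 'rV[R]_n -> R^o) x = dotp (gradient F x) v.
Proof.
move=> dF; rewrite deriveE// {1}(row_sum_delta v) linear_sum /dotp.
apply: eq_bigr => i _; rewrite linearZ /gradient mxE deriveE// mulrC.
by [].
Qed.

(** The convexity inequality on a segment is divided by the parameter, which then tends to 0. The
    sign of [a] is free: [gamma / 2] expresses weak convexity in [x], and [- (mu / 2)], for the
    function [- Phi x], strong concavity in [y]. *)
Lemma convex_gradient_le F (a : R) x w :
  convex_function [set: 'rV[R]_n] (fun x => F x + a * enorm x ^+ 2) ->
  differentiable (F : 'rV[R]_n -> R^o) x ->
  F x + dotp (gradient F x) (w - x) - a * enorm (w - x) ^+ 2 <= F w.
Proof.
move=> cF dF; set v := w - x.
have key t : 0 < t < 1 ->
    t^-1 * (F (t *: v + x) - F x) <= F w - F x + a * enorm v ^+ 2 * (1 - t).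
  move=> /andP[t0 t1].
  have t01 : Itv.spec (@Itv.num_sem R) (Itv.Real `[0%Z, 1%Z]) t.
    by rewrite /Itv.spec/= /Itv.num_sem/= num_real /= in_itv/= !ltW.
  have := cF (Itv.mk t01) w x; rewrite !inE => /(_ I I).
  have -> : (conv (Itv.mk t01) (w : convex_lmodType 'rV[R]_n) x) = t *: v + x.
    by rewrite /v scalerBr -addrA; congr (_ + _); rewrite addrC -[X in X - _]scale1r -scalerBl.
  rewrite -[leRHS]/(t * (F w + a * enorm w ^+ 2) + (1 - t) * (F x + a * enorm x ^+ 2)).
  have -> : enorm (t *: v + x) ^+ 2 =
      t * enorm w ^+ 2 + (1 - t) * enorm x ^+ 2 - t * (1 - t) * enorm v ^+ 2.
    by rewrite /v; dotp_expand; ring.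
  move=> h; rewrite -(@ler_pM2l _ t)// mulVKf ?gt_eqF//; lra.
have := @diff_derivable _ _ _ _ _ v dF; rewrite /derivable => dv.
have {}dv : t^-1 * (F (t *: v + x) - F x) @[t --> 0^'+] --> dotp (gradient F x) v.
  rewrite -derive_gradient//.
  exact: cvg_dnbhs_at_right dv.
have rv : F w - F x + a * enorm v ^+ 2 * (1 - t) @[t --> 0^'+] -->
    F w - F x + a * enorm v ^+ 2 * (1 - 0).
  apply: cvgD; first exact: cvg_cst.
  apply: cvgM; first exact: cvg_cst.
  apply: cvgB; first exact: cvg_cst.
  by apply: cvg_at_right_filter; exact: cvg_id.
suff : dotp (gradient F x) v <= F w - F x + a * enorm v ^+ 2 * (1 - 0) by lra.
apply: ler_cvg_to dv rv _.
near=> t; apply: key; apply/andP; split => //.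
Unshelve. all: by end_near.
Qed.
(** Along the segment, [k] is [F] minus the nonconstant part of its upper model; the Lipschitz bound
    makes [k'] nonpositive, and the mean value theorem concludes. The argument stays inside [D],
    because the gradient of [Phi] is controlled on [edom f] alone. *)
Lemma descent_le (D : set 'rV[R]_n) F (L : R) x w :
  (forall t : R, 0 <= t <= 1 -> D (t *: w + (1 - t) *: x)) ->
  (forall u, D u -> differentiable (F : 'rV[R]_n -> R^o) u) ->
  (forall u, D u -> enorm (gradient F u - gradient F x) <= L * enorm (u - x)) ->
  F w <= F x + dotp (gradient F x) (w - x) + L / 2 * enorm (w - x) ^+ 2.
Proof.
move=> segD dF lipF; set v := w - x.
have D_ (t : R) : 0 <= t <= 1 -> D (t *: v + x).
  move=> /segD; congr D.
  by rewrite /v scalerBl scale1r scalerBr addrA addrAC.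
pose k t := F (t *: v + x) - (t * dotp (gradient F x) v + L / 2 * enorm v ^+ 2 * t ^+ 2).
pose k' t := dotp (gradient F (t *: v + x)) v -
  (dotp (gradient F x) v + L / 2 * enorm v ^+ 2 * (t *+ 2)).
have dk (t : R) : 0 <= t <= 1 -> is_derive t (1 : R) (k : R -> R^o) (k' t).
  move=> t01; have dFt := dF _ (D_ t t01).
  have hF : is_derive t (1 : R) (fun t => F (t *: v + x) : R^o) (dotp (gradient F (t *: v + x)) v).
    rewrite -derive_gradient//.
    have E : (fun h : R => h^-1 *: ((((fun t => F (t *: v + x)) \o shift t) (h *: 1) : R^o)
        - F (t *: v + x))) =
      (fun h : R => h^-1 *: (((F : _ -> R^o) \o shift (t *: v + x)) (h *: v) - F (t *: v + x))).
      apply/funext => h /=; congr (_ *: (F _ - _)).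
      by rewrite scaler1 scalerDl addrA.
    split; last by rewrite /derive E.
    by rewrite /derivable E; exact: (@diff_derivable _ _ _ _ _ v dFt).
  pose a := dotp (gradient F x) v; pose b := L / 2 * enorm v ^+ 2.
  have hp : is_derive t (1 : R) ((a *: id : R -> R^o) + b *: (id ^+ 2 : R -> R^o)) (a + b * (t *+ 2)).
    apply: is_derive_eq; rewrite /= !scaler1 -/a expr1.
    by rewrite /GRing.scale/= mulr_natl.
  have -> : k = (fun t => F (t *: v + x)) - ((a *: id : R -> R^o) + b *: (id ^+ 2 : R -> R^o)).
    by apply/funext => s; rewrite /k !fctE /GRing.scale/= -/a mulrC.
  exact: is_deriveB.
have [||c c01] := @MVT_segment R k k' 0 1 ler01.
- by move=> t; rewrite in_itv/= => /andP[t0 t1]; apply: dk; rewrite !ltW.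
- apply: derivable_within_continuous => t; rewrite in_itv/= => t01.
  by have [] := dk _ t01.
move: (c01); rewrite in_itv/= => /[dup] c01' /andP[c0 c1].
have -> : k 1 = F w - (dotp (gradient F x) v + L / 2 * enorm v ^+ 2).
  by rewrite /k scale1r subrK mul1r expr1n mulr1.
have -> : k 0 = F x by rewrite /k scale0r add0r mul0r expr0n/= mulr0 addr0 subr0.
rewrite /k' subr0 mulr1.
have h1 : dotp (gradient F (c *: v + x)) v - dotp (gradient F x) v <= L * c * enorm v ^+ 2.
  rewrite -dotpNl -dotpDl (le_trans (dotp_le _ _))// expr2 mulrA ler_wpM2r ?enorm_ge0//.
  rewrite (le_trans (lipF _ (D_ _ c01')))// addrK enormZ ger0_norm//.
  by rewrite mulrA.
rewrite -mulr_natr; lra.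
Qed.
End GradientInequalities.

(** Picard iteration. The contraction is measured by [enorm]: comparing with the sup norm would cost
    a dimensional factor and destroy the rate. *)
Lemma contraction_fixpoint (R : realType) (n : nat) (S : 'rV[R]_n -> 'rV[R]_n) (r : R) :
  0 <= r < 1 -> (forall u v, enorm (S u - S v) <= r * enorm (u - v)) ->
  exists u, S u = u.
Proof.
move=> /andP[r0 r1] Sr; have r1' : 0 < 1 - r by rewrite subr_gt0.
pose w k := iter k S 0; pose C := enorm (w 0%N - w 1%N) / (1 - r).
have w0 j : enorm (w 0%N - w j) <= C.
  elim: j => [|j ih].
    by rewrite subrr enorm0 divr_ge0 ?enorm_ge0// ltW.
  rewrite (le_trans (ler_enormBD (w 1%N) _ _))//.
  have : enorm (w 1%N - w j.+1) <= r * C.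
    by rewrite (le_trans (Sr _ _))// ler_wpM2l.
  have : C * (1 - r) = enorm (w 0%N - w 1%N) by rewrite /C divfK// gt_eqF.
  lra.
have wk k j : enorm (w k - w (k + j)%N) <= C * r ^+ k.
  elim: k => [|k ih]; first by rewrite expr0 mulr1 add0n.
  rewrite addSn (le_trans (Sr _ _))// exprS mulrCA.
  by rewrite ler_wpM2l.
have wcvg : cvg (w @ \oo).
  apply: (@cauchy_rate_cvg _ _ w (geometric C r)).
    by apply: cvg_geometric; rewrite ger0_norm.
  by move=> k l /subnKC <-; exact: wk.
pose u := lim (w @ \oo); have wu : w @ \oo --> u by exact: wcvg.
exists u; apply: (@cvg_enorm_unique _ _ (fun k => w k.+1)); last by rewrite cvg_shiftS.
apply/cvg_enorm.
have h : r * enorm (w k - u) @[k --> \oo] --> 0.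
  rewrite -(mulr0 r); apply: cvgM; first exact: cvg_cst.
  by apply/cvg_enorm.
apply: (squeeze_cvgr _ (cvg_cst 0) h); near=> k.
by rewrite enorm_ge0 Sr.
Unshelve. all: by end_near.
Qed.

Lemma enorm2_row_mx (R : realType) (n m : nat) (u : 'rV[R]_n) (v : 'rV[R]_m) :
  enorm (row_mx u v) ^+ 2 = enorm u ^+ 2 + enorm v ^+ 2.
Proof.
rewrite !enorm2E /dotp big_split_ord/=; congr (_ + _); apply: eq_bigr => i _.
  by rewrite row_mxEl.
by rewrite row_mxEr.
Qed.

(* What the assumptions on [f], [g] and [Phi] amount to on the domains, in terms
   of real numbers only. *)
Record saddle_setting (R : realType) (n m : nat)
    (f : 'rV[R]_n -> \bar R) (g : 'rV[R]_m -> \bar R)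
    (Phi : 'rV[R]_n -> 'rV[R]_m -> R)
    (gamma mu Lxx Lxy Lyx Lyy : R) : Prop := {
  set_gamma_gt0 : 0 < gamma;
  set_mu_gt0 : 0 < mu;
  set_Lxx_ge0 : 0 <= Lxx;
  set_Lyy_ge0 : 0 <= Lyy;
  set_Lxy_gt0 : 0 < Lxy;
  set_Lyx_gt0 : 0 < Lyx;
  set_f_fineK : forall x, edom f x -> f x = (fine (f x))%:E;
  set_g_fineK : forall y, edom g y -> g y = (fine (g y))%:E;
  set_f_convex : forall x w t, edom f x -> edom f w -> 0 <= t <= 1 ->
    edom f (t *: x + (1 - t) *: w);
  set_g_convex : forall x w t, edom g x -> edom g w -> 0 <= t <= 1 ->
    edom g (t *: x + (1 - t) *: w);
  set_f_prox : forall tau u, 0 < tau -> edom f (prox tau f u) /\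
    forall x, edom f x ->
      fine (f (prox tau f u)) + (2 * tau)^-1 * enorm (prox tau f u - u) ^+ 2
        + (2 * tau)^-1 * enorm (x - prox tau f u) ^+ 2
      <= fine (f x) + (2 * tau)^-1 * enorm (x - u) ^+ 2;
  set_g_prox : forall tau u, 0 < tau -> edom g (prox tau g u) /\
    forall x, edom g x ->
      fine (g (prox tau g u)) + (2 * tau)^-1 * enorm (prox tau g u - u) ^+ 2
        + (2 * tau)^-1 * enorm (x - prox tau g u) ^+ 2
      <= fine (g x) + (2 * tau)^-1 * enorm (x - u) ^+ 2;
  set_weakly_convex : forall x x' y, edom f x -> edom g y ->
    Phi x y + dotp (grad_x Phi x y) (x' - x) - gamma / 2 * enorm (x' - x) ^+ 2
      <= Phi x' y;
  set_strongly_concave : forall x y y', edom f x -> edom g y ->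
    Phi x y' <= Phi x y + dotp (grad_y Phi x y) (y' - y)
      - mu / 2 * enorm (y' - y) ^+ 2;
  set_descent : forall x x' y, edom f x -> edom f x' -> edom g y ->
    Phi x' y <= Phi x y + dotp (grad_x Phi x y) (x' - x)
      + Lxx / 2 * enorm (x' - x) ^+ 2;
  set_grad_x_lip : forall x x' y y', edom f x -> edom f x' -> edom g y -> edom g y' ->
    enorm (grad_x Phi x y - grad_x Phi x' y')
      <= Lxx * enorm (x - x') + Lxy * enorm (y - y');
  set_grad_y_lip : forall x x' y y', edom f x -> edom f x' -> edom g y -> edom g y' ->
    enorm (grad_y Phi x y - grad_y Phi x' y')
      <= Lyx * enorm (x - x') + Lyy * enorm (y - y')
}.

(** The infimum of an empty set is [+oo], so any finite bound forces a subgradient. *)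
Lemma subgradient_exists (R : realType) (n : nat) (h : 'rV[R]_n -> \bar R) (B : R) x :
  (ereal_inf [set (enorm s)%:E | s in subdifferential h x] <= B%:E)%E ->
  exists s, subdifferential h x s.
Proof.
move=> hB; apply: contrapT => /forallNP h0.
have E : [set (enorm s)%:E | s in subdifferential h x] = set0.
  by apply/seteqP; split => // z [s hs]; case: (h0 s hs).
by move: hB; rewrite E ereal_inf0 leye_eq.
Qed.

Lemma saddle_settingP (R : realType) (n m : nat)
    (f : 'rV[R]_n -> \bar R) (g : 'rV[R]_m -> \bar R)
    (Phi : 'rV[R]_n -> 'rV[R]_m -> R) (gamma mu Lxx Lxy Lyx Lyy : R) :
  structural_assumption f g Phi gamma mu ->
  smoothness_assumption f g Phi gamma Lxx Lxy Lyx Lyy ->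
  bounded_subgradient_assumption f g ->
  saddle_setting f g Phi gamma mu Lxx Lxy Lyx Lyy.
Proof.
move=> SA SM [Bf [Bg [_ _ Bfs Bgs]]].
have [xf hxf] := (f_proper SA).2; have [xg hxg] := (g_proper SA).2.
have [sf hsf] := subgradient_exists (Bfs _ hxf).
have [sg hsg] := subgradient_exists (Bgs _ hxg).
have [U [oU sU dU]] := Phi_differentiable SA.
have diffPx x y : edom f x -> edom g y ->
    differentiable ((fun x' => Phi x' y) : 'rV[R]_n -> R^o) x.
  move=> fx gy.
  apply: (@differentiable_comp _ _ _ _ (fun x' => (x', y))
    (fun z : 'rV[R]_n * 'rV[R]_m => (Phi z.1 z.2 : R^o))).
    by apply: differentiable_pair; [exact: ex_diff|exact: differentiable_cst].
  by apply: dU; apply: sU.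
have diffPy x y : edom f x -> edom g y ->
    differentiable ((fun y' => Phi x y') : 'rV[R]_m -> R^o) y.
  move=> fx gy.
  apply: (@differentiable_comp _ _ _ _ (fun y' => (x, y'))
    (fun z : 'rV[R]_n * 'rV[R]_m => (Phi z.1 z.2 : R^o))).
    by apply: differentiable_pair; [exact: differentiable_cst|exact: ex_diff].
  by apply: dU; apply: sU.
split.
- exact: gamma_gt0 SA.
- exact: muy_gt0 SA.
- exact: Lxx_ge0 SM.
- exact: Lyy_ge0 SM.
- exact: Lxy_gt0 SM.
- exact: Lyx_gt0 SM.
- exact: edom_fineK (f_proper SA).
- exact: edom_fineK (g_proper SA).
- exact: edom_convex (f_proper SA) (f_convex SA).
- exact: edom_convex (g_proper SA) (g_convex SA).
- move=> tau u; exact: prox_proximal (f_proper SA) (f_closed SA) (f_convex SA) _ _ hxf hsf _ _.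
- move=> tau u; exact: prox_proximal (g_proper SA) (g_closed SA) (g_convex SA) _ _ hxg hsg _ _.
- move=> x x' y fx gy.
  exact: (@convex_gradient_le _ _ (fun x => Phi x y) _ _ _ (Phi_weakly_convex SA gy) (diffPx _ _ fx gy)).
- move=> x y y' fx gy.
  have cP : convex_function [set: 'rV[R]_m]
      (fun y => - Phi x y + - (mu / 2) * enorm y ^+ 2).
    have := Phi_strongly_concave SA fx; congr convex_function; apply/funext => z.
    by rewrite opprD mulNr.
  have := @convex_gradient_le _ _ (fun y => - Phi x y) _ y y' cP (differentiableN (diffPy _ _ fx gy)).
  have -> : gradient (fun y => - Phi x y) y = - grad_y Phi x y.
    apply/rowP => i; rewrite !mxE.
    by rewrite (@deriveN _ _ _ (Phi x : _ -> R^o))//; exact: diff_derivable (diffPy _ _ fx gy).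
  rewrite dotpNl; lra.
- move=> x x' y fx fx' gy.
  apply: (@descent_le _ _ (edom f) (fun x => Phi x y)).
  + by move=> t t01; exact: edom_convex (f_proper SA) (f_convex SA) _ _ _ _ _ _.
  + by move=> u fu; exact: diffPx.
  + move=> u fu; have := grad_x_lip SM fu fx gy gy.
    by rewrite subrr enorm0 mulr0 addr0.
- exact: grad_x_lip SM.
- exact: grad_y_lip SM.
Qed.

(** * Consequences of proximal growth *)

Section ProximalPoint.
Context {R : realType} {n : nat}.
Variables (h : 'rV[R]_n -> \bar R).
Hypothesis h_prox : forall tau u, 0 < tau -> edom h (prox tau h u) /\
  forall x, edom h x ->
    fine (h (prox tau h u)) + (2 * tau)^-1 * enorm (prox tau h u - u) ^+ 2
      + (2 * tau)^-1 * enorm (x - prox tau h u) ^+ 2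
    <= fine (h x) + (2 * tau)^-1 * enorm (x - u) ^+ 2.
Implicit Types (u v x s : 'rV[R]_n).

(** The two growth inequalities, each tested at the other proximal point, add up to firm
    nonexpansiveness |q - p|^2 <= <q - p, v - u>; Cauchy-Schwarz then lets |q - p| be divided
    out. *)
Lemma prox_lip (tau : R) u v : 0 < tau ->
  enorm (prox tau h u - prox tau h v) <= enorm (u - v).
Proof.
move=> tau0; have [du pu] := h_prox u tau0; have [dv pv] := h_prox v tau0.
have := pu _ dv; have := pv _ du; move: (prox tau h u) (prox tau h v) => p q h1 h2.
have k0 : 0 < (2 * tau)^-1 by rewrite invr_gt0 mulr_gt0.
have : enorm (q - p) ^+ 2 <= dotp (q - p) (v - u).
  rewrite -(@ler_pM2l _ (2 * tau)^-1)//; move: h1 h2; move: (_^-1) => k; dotp_expand; lra.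
rewrite (enormB p q) (enormB u); have := dotp_le (q - p) (v - u).
have := enorm_ge0 (q - p); have := enorm_ge0 (v - u).
move: (dotp _ _) (enorm (v - u)) (enorm (q - p)) => d a b a0 b0 h3 h4.
have [->//|bn0] := eqVneq b 0.
have bp : 0 < b by rewrite lt_def bn0.
rewrite -(@ler_pM2l _ b)//; move: h3 h4; rewrite expr2; lra.
Qed.

(** Three-point inequality, the form in which both SAPD updates enter the analysis. *)
Lemma prox_step (tau : R) x u s (p := prox tau h (x + tau *: s)) : 0 < tau -> edom h u ->
  fine (h p) - fine (h u) <= dotp s (p - u) + (2 * tau)^-1 *
    (enorm (u - x) ^+ 2 - enorm (u - p) ^+ 2 - enorm (p - x) ^+ 2).
Proof.
move=> tau0 du; have [dp /(_ _ du)] := h_prox (x + tau *: s) tau0.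
rewrite -/p; set k := (2 * tau)^-1.
have kE : 2 * k * tau = 1 by rewrite /k; field; rewrite gt_eqF.
have : k * enorm (u - (x + tau *: s)) ^+ 2 - k * enorm (p - (x + tau *: s)) ^+ 2 =
  k * (enorm (u - x) ^+ 2 - enorm (p - x) ^+ 2) + (2 * k * tau) * dotp s (p - u).
  by dotp_expand; ring.
rewrite kE mul1r => E h1.
have h2 : fine (h p) - fine (h u) + k * enorm (u - p) ^+ 2 <=
  k * (enorm (u - x) ^+ 2 - enorm (p - x) ^+ 2) + dotp s (p - u) by lra.
lra.
Qed.

(** At a fixed point the squared distances of [prox_step] cancel; what remains is the first-order
    optimality condition. *)
Lemma prox_fixpoint (tau : R) x u s : 0 < tau -> x = prox tau h (x - tau *: s) ->
  edom h u -> fine (h x) <= fine (h u) + dotp s (u - x).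
Proof.
move=> tau0 xE du; have := @prox_step tau x u (- s) tau0 du.
cbv zeta; rewrite scalerN -xE (subrr x) enorm0 expr0n/= subr0 subrr mulr0.
by dotp_expand; lra.
Qed.

End ProximalPoint.

(** * Saddle points of the regularized problem *)

Section SaddlePoints.
Context {R : realType} {n m : nat}.
Variables (f : 'rV[R]_n -> \bar R) (g : 'rV[R]_m -> \bar R).
Variable Phi : 'rV[R]_n -> 'rV[R]_m -> R.
Variables (gamma mu Lxx Lxy Lyx Lyy : R).
Hypothesis H : saddle_setting f g Phi gamma mu Lxx Lxy Lyx Lyy.
Implicit Types (x c X : 'rV[R]_n) (y Y : 'rV[R]_m).

Let gamma0 : 0 < gamma := set_gamma_gt0 H.
Let mu0 : 0 < mu := set_mu_gt0 H.

(** Real-valued counterpart of [Lag], meaningful on the domains only, since [fine] sends infinite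
    values to 0. *)
Definition Lagr x y := fine (f x) + Phi x y - fine (g y).

(* [(X, Y)] is a saddle point, with quadratic growth, of
   [L(x, y) + gamma |x - c|^2] *)
Definition is_saddle c X Y := [/\ edom f X, edom g Y,
  forall x, edom f x -> Lagr X Y + gamma * enorm (X - c) ^+ 2 +
    gamma / 2 * enorm (x - X) ^+ 2 <= Lagr x Y + gamma * enorm (x - c) ^+ 2 &
  forall y, edom g y -> Lagr X y + mu / 2 * enorm (y - Y) ^+ 2 <= Lagr X Y].

(** Four first-order inequalities, in [x] and in [y] from each of the two points, add up so that all
    values of [Phi] cancel. The regularizer will later turn [- gamma] into [+ gamma]. *)
Lemma grad_strongly_monotone x x' y y' :
  edom f x -> edom f x' -> edom g y -> edom g y' ->
  - gamma * enorm (x - x') ^+ 2 + mu * enorm (y - y') ^+ 2 <=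
  dotp (grad_x Phi x y - grad_x Phi x' y') (x - x') -
  dotp (grad_y Phi x y - grad_y Phi x' y') (y - y').
Proof.
move=> fx fx' gy gy'.
have := set_weakly_convex H x' fx gy; have := set_weakly_convex H x fx' gy'.
have := set_strongly_concave H y' fx gy; have := set_strongly_concave H y fx' gy'.
rewrite (enormB x' x) (enormB y' y) -(opprB x x') -(opprB y y').
rewrite !dotpNr !dotpDl !dotpNl; lra.
Qed.

(** The operator ([Mx], [- grad_y]) is [a]-strongly monotone, and Lipschitz with squared constant
    [K]. A forward step of size [s = a / K] then multiplies squared distances by at most 1 - 2 s a +
    s^2 K = 1 - a^2 / K. *)
Lemma saddle_exists c : exists X Y, is_saddle c X Y.
Proof.
pose Mx x y := grad_x Phi x y + (2 * gamma) *: (x - c).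
pose K := 2 * (Lxx + 2 * gamma) ^+ 2 + 2 * Lxy ^+ 2 + (2 * Lyx ^+ 2 + 2 * Lyy ^+ 2).
pose a := Num.min gamma mu.
have a0 : 0 < a by rewrite lt_min gamma0.
have ag : a <= gamma by rewrite ge_min lexx.
have am : a <= mu by rewrite ge_min lexx orbT.
have Lxx0 := set_Lxx_ge0 H; have Lyy0 := set_Lyy_ge0 H.
have Lxy0 := set_Lxy_gt0 H; have Lyx0 := set_Lyx_gt0 H.
have aK : a ^+ 2 <= K.
  have : a ^+ 2 <= gamma ^+ 2 by apply: lerXn2r => //; rewrite nnegrE ltW.
  have := sqr_ge0 gamma; have := sqr_ge0 Lxx; have := sqr_ge0 Lxy.
  have := sqr_ge0 Lyx; have := sqr_ge0 Lyy; have := mulr_ge0 Lxx0 (ltW gamma0).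
  rewrite /K sqrrD exprMn -mulr_natr; lra.
have K0 : 0 < K by apply: lt_le_trans aK; rewrite exprn_gt0.
pose s : R := a / K; have s0 : 0 < s by rewrite divr_gt0.
pose px (u : 'rV[R]_(n + m)) := prox s f (lsubmx u).
pose py (u : 'rV[R]_(n + m)) := prox s g (rsubmx u).
(* The proximal maps act first, so that gradients are evaluated inside the domains, where they are
   Lipschitz. A fixed point [u] yields the forward-backward fixed point [(px u, py u)]. *)
pose S (u : 'rV[R]_(n + m)) : 'rV[R]_(n + m) :=
  row_mx (px u - s *: Mx (px u) (py u)) (py u + s *: grad_y Phi (px u) (py u)).
have Df u : edom f (px u) by exact: (set_f_prox H (lsubmx u) s0).1.
have Dg u : edom g (py u) by exact: (set_g_prox H (rsubmx u) s0).1.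
pose r := Num.sqrt (1 - a ^+ 2 / K).
have r2 : r ^+ 2 = 1 - a ^+ 2 / K by rewrite sqr_sqrtr// subr_ge0 ler_pdivrMr// mul1r.
have r01 : 0 <= r < 1.
  rewrite sqrtr_ge0/= -(@ltr_pXn2r _ 2) ?nnegrE ?sqrtr_ge0// r2 expr1n.
  by rewrite ltrBlDr ltrDl divr_gt0// exprn_gt0.
have Slip u v : enorm (S u - S v) <= r * enorm (u - v).
  have r0 := (andP r01).1.
  rewrite -(@ler_pXn2r _ 2) ?nnegrE ?mulr_ge0 ?enorm_ge0// exprMn r2.
  have -> : enorm (u - v) ^+ 2 =
      enorm (lsubmx u - lsubmx v) ^+ 2 + enorm (rsubmx u - rsubmx v) ^+ 2.
    by rewrite -enorm2_row_mx; congr (enorm _ ^+ 2);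
       rewrite -[LHS]hsubmxK; congr row_mx; apply/rowP => i; rewrite !mxE.
  have -> : S u - S v = row_mx (px u - px v - s *: (Mx (px u) (py u) - Mx (px v) (py v)))
      (py u - py v + s *: (grad_y Phi (px u) (py u) - grad_y Phi (px v) (py v))).
    rewrite /S opp_row_mx add_row_mx; congr row_mx.
      by rewrite scalerBr !opprD !opprK !addrA; congr (_ + _); rewrite addrAC.
    by rewrite scalerBr !opprD !addrA; congr (_ + _); rewrite addrAC.
  rewrite enorm2_row_mx.
  have hx : enorm (px u - px v) ^+ 2 <= enorm (lsubmx u - lsubmx v) ^+ 2.
    by rewrite lerXn2r ?nnegrE ?enorm_ge0//; exact: (prox_lip (set_f_prox H)).
  have hy : enorm (py u - py v) ^+ 2 <= enorm (rsubmx u - rsubmx v) ^+ 2.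
    by rewrite lerXn2r ?nnegrE ?enorm_ge0//; exact: (prox_lip (set_g_prox H)).
  set dX := px u - px v in hx *; set dY := py u - py v in hy *.
  set dM := Mx _ _ - Mx _ _; set dG := grad_y _ _ _ - grad_y _ _ _.
  have mono : a * (enorm dX ^+ 2 + enorm dY ^+ 2) <= dotp dM dX - dotp dG dY.
    have := grad_strongly_monotone (Df u) (Df v) (Dg u) (Dg v).
    rewrite -/dX -/dY -/dG.
    have -> : dM = grad_x Phi (px u) (py u) - grad_x Phi (px v) (py v) + (2 * gamma) *: dX.
      rewrite /dM /Mx /dX opprD addrACA; congr (_ + _).
      by rewrite -scalerBr opprB addrA subrK.
    rewrite (dotpDl (_ - _) (_ *: _)) dotpZl -enorm2E.
    have := ler_wpM2r (sqr_ge0 (enorm dX)) ag; have := ler_wpM2r (sqr_ge0 (enorm dY)) am.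
    lra.
  have lip : enorm dM ^+ 2 + enorm dG ^+ 2 <= K * (enorm dX ^+ 2 + enorm dY ^+ 2).
    have hM : enorm dM <= (Lxx + 2 * gamma) * enorm dX + Lxy * enorm dY.
      have -> : dM = grad_x Phi (px u) (py u) - grad_x Phi (px v) (py v) + (2 * gamma) *: dX.
        rewrite /dM /Mx /dX opprD addrACA; congr (_ + _).
        by rewrite -scalerBr opprB addrA subrK.
      rewrite (le_trans (ler_enormD _ _))// enormZ ger0_norm ?mulr_ge0 ?(ltW gamma0)//.
      have := set_grad_x_lip H (Df u) (Df v) (Dg u) (Dg v); rewrite -/dX -/dY; lra.
    have hG := set_grad_y_lip H (Df u) (Df v) (Dg u) (Dg v).
    rewrite -/dX -/dY -/dG in hG.
    have sq (p q z : R) : 0 <= z -> z <= p + q -> z ^+ 2 <= 2 * p ^+ 2 + 2 * q ^+ 2.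
      move=> z0 zpq; apply: (@le_trans _ _ ((p + q) ^+ 2)).
        by rewrite lerXn2r ?nnegrE// (le_trans z0).
      by have := sqr_ge0 (p - q); rewrite !sqrrD sqrrN; lra.
    have := sq _ _ _ (enorm_ge0 _) hM; have := sq _ _ _ (enorm_ge0 _) hG.
    rewrite !exprMn /K.
    have p1 : 0 <= Lxy ^+ 2 * enorm dX ^+ 2 by rewrite mulr_ge0 ?sqr_ge0.
    have p2 : 0 <= Lyx ^+ 2 * enorm dY ^+ 2 by rewrite mulr_ge0 ?sqr_ge0.
    have p3 : 0 <= Lyy ^+ 2 * enorm dX ^+ 2 by rewrite mulr_ge0 ?sqr_ge0.
    have p4 : 0 <= (Lxx + 2 * gamma) ^+ 2 * enorm dY ^+ 2 by rewrite mulr_ge0 ?sqr_ge0.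
    move: p1 p2 p3 p4; move: ((Lxx + 2 * gamma) ^+ 2) (enorm dX ^+ 2) (enorm dY ^+ 2).
    move=> q1 q2 q3; lra.
  have -> : enorm (dX - s *: dM) ^+ 2 + enorm (dY + s *: dG) ^+ 2 =
      enorm dX ^+ 2 + enorm dY ^+ 2 - 2 * s * (dotp dM dX - dotp dG dY)
      + s ^+ 2 * (enorm dM ^+ 2 + enorm dG ^+ 2).
    by rewrite -scaleNr !enorm2_addZ; ring.
  have h1 := ler_wpM2l (ltW s0) mono; have h2 := ler_wpM2l (sqr_ge0 s) lip.
  have sK : s ^+ 2 * K = s * a by rewrite /s; field; rewrite gt_eqF.
  have sa : a ^+ 2 / K = s * a by rewrite /s; field; rewrite gt_eqF.
  rewrite sa mulrA sK in h2 *.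
  have sa1 : 0 <= 1 - s * a by rewrite -sa subr_ge0 ler_pdivrMr// mul1r.
  have h3 := ler_wpM2l sa1 (lerD hx hy).
  lra.
have [u Su] := contraction_fixpoint r01 Slip.
exists (px u), (py u).
have eX : px u = prox s f (px u - s *: Mx (px u) (py u)).
  by rewrite {1}/px -{1}Su /S row_mxKl.
have eY : py u = prox s g (py u - s *: - grad_y Phi (px u) (py u)).
  by rewrite scalerN opprK {1}/py -{1}Su /S row_mxKr.
split=> //.
(* The regularizer grows like gamma |x - X|^2 beyond its linear part; weak convexity costs half of
   it. *)
- move=> x fx; have := prox_fixpoint (set_f_prox H) s0 eX fx.
  have := set_weakly_convex H x (Df u) (Dg u).
  rewrite /Lagr /Mx; set X := px u.
  have -> : enorm (x - c) ^+ 2 = enorm (X - c) ^+ 2 + 2 * dotp (X - c) (x - X) + enorm (x - X) ^+ 2.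
    by dotp_expand; ring.
  rewrite !(dotpDl (grad_x _ _ _)) dotpZl; lra.
- move=> y gy; have := prox_fixpoint (set_g_prox H) s0 eY gy.
  have := set_strongly_concave H y (Df u) (Dg u).
  rewrite dotpNl /Lagr; lra.
Qed.

End SaddlePoints.

(** * The Moreau envelope expressed by saddle points *)

Section MoreauEnvelope.
Context {R : realType} {n m : nat}.
Variables (f : 'rV[R]_n -> \bar R) (g : 'rV[R]_m -> \bar R).
Variable Phi : 'rV[R]_n -> 'rV[R]_m -> R.
Variables (gamma mu Lxx Lxy Lyx Lyy : R).
Hypothesis H : saddle_setting f g Phi gamma mu Lxx Lxy Lyx Lyy.
Variables (sx : 'rV[R]_n -> 'rV[R]_n) (sy : 'rV[R]_n -> 'rV[R]_m).
Hypothesis Hs : forall c, is_saddle f g Phi gamma mu c (sx c) (sy c).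
Implicit Types (x c X : 'rV[R]_n) (y Y : 'rV[R]_m).

Let gamma0 : 0 < gamma := set_gamma_gt0 H.
Let mu0 : 0 < mu := set_mu_gt0 H.
Let L := Lagr f g Phi.

(** This is the Moreau envelope of [primal] at [c], as [moreau_primal] shows. *)
Definition saddle_value c := L (sx c) (sy c) + gamma * enorm (sx c - c) ^+ 2.

(** In the sum of the growth inequalities at the two saddle points, each tested at the other, all
    Lagrangian values cancel and only the regularizers remain. *)
Lemma saddle_lip c c' :
  gamma * enorm (sx c - sx c') ^+ 2 + mu * enorm (sy c - sy c') ^+ 2 <=
  2 * gamma * dotp (sx c - sx c') (c - c').
Proof.
have [fX gY hX hY] := Hs c; have [fX' gY' hX' hY'] := Hs c'.
have := hX _ fX'; have := hY _ gY'; have := hX' _ fX; have := hY' _ gY.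
rewrite (enormB (sx c') (sx c)) (enormB (sy c') (sy c)).
have : enorm (sx c' - c) ^+ 2 - enorm (sx c - c) ^+ 2 + enorm (sx c - c') ^+ 2
  - enorm (sx c' - c') ^+ 2 = 2 * dotp (sx c - sx c') (c - c').
  by dotp_expand; ring.
move=> E h1 h2 h3 h4; rewrite mulrAC -E; lra.
Qed.

Lemma sx_lip c c' : enorm (sx c - sx c') <= 2 * enorm (c - c').
Proof.
have := saddle_lip c c'; have := dotp_le (sx c - sx c') (c - c').
have := enorm_ge0 (sx c - sx c'); have := enorm_ge0 (c - c').
have := mulr_ge0 (ltW mu0) (sqr_ge0 (enorm (sy c - sy c'))).
move: (dotp _ _) (mu * _) (enorm (c - c')) (enorm (sx c - sx c')) => d q a b q0 a0 b0 h1 h2.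
have [->|bn0] := eqVneq b 0; first by rewrite mulr_ge0.
have bp : 0 < b by rewrite lt_def bn0.
have h3 : gamma * (b * b) <= gamma * (2 * d) by rewrite -expr2; lra.
move: h3; rewrite ler_pM2l// => h3.
by rewrite -(@ler_pM2l _ b)//; lra.
Qed.

(** Completes the square in [saddle_lip] with |(sx c - sx c') - (c - c')|^2 >= 0. *)
Lemma sy_lip c c' : mu * enorm (sy c - sy c') ^+ 2 <= gamma * enorm (c - c') ^+ 2.
Proof.
have := saddle_lip c c'.
have : 0 <= gamma * enorm (sx c - sx c' - (c - c')) ^+ 2.
  by rewrite mulr_ge0 ?sqr_ge0 ?ltW.
have -> : enorm (sx c - sx c' - (c - c')) ^+ 2 = enorm (sx c - sx c') ^+ 2
  - 2 * dotp (sx c - sx c') (c - c') + enorm (c - c') ^+ 2.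
  by dotp_expand; ring.
lra.
Qed.

(** [sx c] competes in the minimization at [c'], and [sy c] is the best response to it. With
    consecutive starting points as [c] and [c'] this is the decrease of the envelope over one call;
    used in both directions it yields the gradient. *)
Lemma saddle_value_le c c' : saddle_value c' <= saddle_value c +
  gamma * (enorm (sx c - c') ^+ 2 - enorm (sx c - c) ^+ 2).
Proof.
have [fX gY hX hY] := Hs c; have [fX' gY' hX' hY'] := Hs c'.
have := hX' _ fX; have := hY _ gY'; rewrite /saddle_value /L.
have := mulr_ge0 (ltW mu0) (sqr_ge0 (enorm (sy c' - sy c))).
have := mulr_ge0 (ltW gamma0) (sqr_ge0 (enorm (sx c - sx c'))).
lra.
Qed.

Lemma saddle_value_le_Lagr c : edom f c ->
  saddle_value c + gamma / 2 * enorm (c - sx c) ^+ 2 <= L c (sy c).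
Proof.
move=> fc; have [fX gY hX hY] := Hs c.
by have := hX _ fc; rewrite /saddle_value subrr enorm0 expr0n/= mulr0 addr0.
Qed.

Lemma Lagr_le_saddle_value c y : edom g y ->
  L (sx c) y + gamma * enorm (sx c - c) ^+ 2 + mu / 2 * enorm (y - sy c) ^+ 2
  <= saddle_value c.
Proof.
by move=> gy; have [fX gY hX hY] := Hs c; have := hY _ gy; rewrite /saddle_value /L; lra.
Qed.

Lemma Lag_fine x y : edom f x -> edom g y -> Lag f g Phi x y = (L x y)%:E.
Proof.
by move=> fx gy; rewrite /Lag (set_f_fineK H fx) (set_g_fineK H gy).
Qed.

Lemma Lag_out_g x y : edom f x -> ~ edom g y -> Lag f g Phi x y = -oo%E.
Proof.
move=> fx gy; rewrite /Lag (set_f_fineK H fx).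
by have -> : g y = +oo%E by apply/eqP; rewrite -leye_eq leNgt; apply/negP.
Qed.

Lemma Lag_out_f x y : ~ edom f x -> edom g y -> Lag f g Phi x y = +oo%E.
Proof.
move=> fx gy; rewrite /Lag (set_g_fineK H gy).
by have -> : f x = +oo%E by apply/eqP; rewrite -leye_eq leNgt; apply/negP.
Qed.

Lemma primal_ge x y : edom f x -> edom g y -> ((L x y)%:E <= primal f g Phi x)%E.
Proof.
move=> fx gy; rewrite -Lag_fine//; apply: ereal_sup_ubound; exact: imageT.
Qed.

Lemma primal_out x : ~ edom f x -> primal f g Phi x = +oo%E.
Proof.
move=> fx; have [_ gY _ _] := Hs x.
apply/eqP; rewrite -leye_eq -(Lag_out_f fx gY); apply: ereal_sup_ubound; exact: imageT.
Qed.

Lemma primal_saddle c : primal f g Phi (sx c) = (L (sx c) (sy c))%:E.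
Proof.
have [fX gY hX hY] := Hs c; apply/eqP; rewrite eq_le primal_ge// andbT.
apply: ge_ereal_sup => _ [y _ <-].
have [gy|gy] := pselect (edom g y); last by rewrite Lag_out_g// leNye.
rewrite Lag_fine// lee_fin; have := hY _ gy.
have := mulr_ge0 (ltW mu0) (sqr_ge0 (enorm (y - sy c))); rewrite /L; lra.
Qed.

(** At [sx c] the supremum over [y] is attained at [sy c]; elsewhere [primal] is at least the
    Lagrangian at [sy c], which [sx c] minimizes after regularization. *)
Lemma moreau_primal c : moreau (2 * gamma)^-1 (primal f g Phi) c = saddle_value c.
Proof.
rewrite /moreau /prox_objective.
have -> : (2 * (2 * gamma)^-1)^-1 = gamma by field; rewrite gt_eqF.
have [fX gY hX hY] := Hs c.
suff -> : ereal_inf (range (fun w => (primal f g Phi w + (gamma * enorm (w - c) ^+ 2)%:E)%E))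
  = (saddle_value c)%:E by [].
apply/eqP; rewrite eq_le; apply/andP; split.
  by apply: ereal_inf_lbound; exists (sx c) => //; rewrite primal_saddle.
apply: le_ereal_inf_tmp => _ [x _ <-].
have [fx|fx] := pselect (edom f x); last by rewrite primal_out// leey.
apply: (@le_trans _ _ ((L x (sy c))%:E + (gamma * enorm (x - c) ^+ 2)%:E)%E).
  rewrite -EFinD lee_fin; have := hX _ fx; rewrite /saddle_value /L.
  have := mulr_ge0 (ltW gamma0) (sqr_ge0 (enorm (x - sx c))); lra.
by rewrite leeD2r// primal_ge.
Qed.

(** [saddle_value_le] from [c] to [h *: v + c] and back encloses the increment between two
    expressions linear in [h] up to O(h^2); they differ by the move from [sx c] to
    [sx (h *: v + c)], which [sx_lip] makes O(h). *)
Lemma gradient_moreau c :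
  gradient (moreau (2 * gamma)^-1 (primal f g Phi)) c = (2 * gamma) *: (c - sx c).
Proof.
have -> : moreau (2 * gamma)^-1 (primal f g Phi) = saddle_value.
  by apply/funext => x; rewrite moreau_primal.
apply/rowP => i; rewrite !mxE; set v := delta_mx 0 i : 'rV[R]_n.
have vE x : dotp x v = x 0 i.
  rewrite /dotp (bigD1 i)//= big1 ?addr0 ?mxE ?eqxx ?mulr1// => j ji.
  by rewrite mxE (negbTE ji) andbF mulr0.
have key (h : R) : h != 0 ->
    `|2 * gamma * (c 0 i - sx c 0 i) - h^-1 * (saddle_value (h *: v + c) - saddle_value c)|
    <= 5 * gamma * enorm v ^+ 2 * `|h|.
  move=> h0; have habs : 0 < `|h| by rewrite normr_gt0.
  rewrite -(@ler_pM2l _ `|h|)// -normrM mulrBr mulVKf//.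
  have h1 := saddle_value_le c (h *: v + c).
  have h2 := saddle_value_le (h *: v + c) c.
  move: h1 h2; have := sx_lip (h *: v + c) c; set X := sx c; set X' := sx _.
  rewrite addrK => lipX.
  have e1 : enorm (X - (h *: v + c)) ^+ 2 - enorm (X - c) ^+ 2 =
      2 * h * (c 0 i - X 0 i) + h ^+ 2 * enorm v ^+ 2.
    have -> : X - (h *: v + c) = (X - c) + (- h) *: v by rewrite scaleNr opprD addrCA addrC addrAC.
    rewrite enorm2_addZ (dotpC v) vE !mxE sqrrN; ring.
  have e2 : enorm (X' - c) ^+ 2 - enorm (X' - (h *: v + c)) ^+ 2 =
      2 * h * (X' 0 i - c 0 i) - h ^+ 2 * enorm v ^+ 2.
    have -> : X' - (h *: v + c) = (X' - c) + (- h) *: v by rewrite scaleNr opprD addrCA addrC addrAC.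
    rewrite enorm2_addZ (dotpC v) vE !mxE sqrrN; ring.
  have -> : `|h| * (5 * gamma * enorm v ^+ 2 * `|h|) = 5 * gamma * (h ^+ 2 * enorm v ^+ 2).
    by rewrite -[h ^+ 2]real_normK ?num_real//; ring.
  rewrite e1 e2.
  have : `|h * (X' 0 i - X 0 i)| <= 2 * h ^+ 2 * enorm v ^+ 2.
    rewrite normrM (_ : 2 * h ^+ 2 * _ = `|h| * (2 * (`|h| * enorm v) * enorm v)).
      rewrite ler_pM2l//.
      have -> : X' 0 i - X 0 i = dotp (X' - X) v by rewrite vE !mxE.
      apply: (@le_trans _ _ (enorm (X' - X) * enorm v)).
        by rewrite ler_norml dotp_le dotp_ge.
      by rewrite ler_wpM2r ?enorm_ge0// -enormZ.
    by rewrite -[h ^+ 2]real_normK ?num_real//; ring.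
  have := mulr_ge0 (ltW gamma0) (mulr_ge0 (sqr_ge0 h) (sqr_ge0 (enorm v))).
  move: (c 0 i) (X 0 i) (X' 0 i) (enorm v ^+ 2) (saddle_value _) (saddle_value _).
  move=> ci Xi Xi' N V V' p0; rewrite ler_norml => /andP[p1 p2] h1 h2.
  have := ler_wpM2l (ltW gamma0) p1; have := ler_wpM2l (ltW gamma0) p2.
  by move=> p3 p4; rewrite ler_norml; apply/andP; split; lra.
rewrite /derive; apply/cvg_lim => //.
apply/cvgrPdist_lt => e e0; pose K := 5 * gamma * enorm v ^+ 2 + 1.
have K0 : 0 < K by have := mulr_ge0 (ltW gamma0) (sqr_ge0 (enorm v)); rewrite /K; lra.
near=> h.
have hn0 : h != 0 by near: h; exact: nbhs_dnbhs_neq.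
apply: (le_lt_trans (key h hn0)).
apply: (@le_lt_trans _ _ (K * `|h|)); first by rewrite ler_wpM2r// lerDl.
rewrite mulrC -ltr_pdivlMr//; near: h; apply: dnbhs0_lt; exact: divr_gt0.
Unshelve. all: by end_near.
Qed.

End MoreauEnvelope.

(** * One SAPD run for a fixed sample, with arbitrary gradient estimates *)

Section PathwiseSAPD.
Context {R : realType} {n m : nat}.
Variables (f : 'rV[R]_n -> \bar R) (g : 'rV[R]_m -> \bar R).
Variable Phi : 'rV[R]_n -> 'rV[R]_m -> R.
Variables (gamma mu Lxx Lxy Lyx Lyy tau sigma : R).
Hypothesis H : saddle_setting f g Phi gamma mu Lxx Lxy Lyx Lyy.
Hypotheses (tau0 : 0 < tau) (sigma0 : 0 < sigma).
Hypotheses (tauL : tau * (Lyx + Lxx + 2 * gamma) <= 1) (tauLxy : tau * Lxy <= 1).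
Hypothesis sigmaL : sigma * (Lyx + 2 * Lyy) <= 1.
Variables (x gx : nat -> 'rV[R]_n) (y gy q : nat -> 'rV[R]_m).
Hypothesis y_step : forall k, y k.+1 = prox sigma g (y k + sigma *: (gy k + q k)).
Hypothesis x_step : forall k,
  x k.+1 = prox tau f (x k - tau *: (gx k + (2 * gamma) *: (x k - x 0%N))).
Hypotheses (q_0 : q 0%N = 0) (q_S : forall k, q k.+1 = gy k.+1 - gy k).
Hypotheses (fx : forall k, edom f (x k)) (gyd : forall k, edom g (y k)).
Variables (X : 'rV[R]_n) (Y : 'rV[R]_m).
Hypothesis XY : is_saddle f g Phi gamma mu (x 0%N) X Y.

Let gamma0 : 0 < gamma := set_gamma_gt0 H.
Let mu0 : 0 < mu := set_mu_gt0 H.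
Let Lxx0 : 0 <= Lxx := set_Lxx_ge0 H.
Let Lyy0 : 0 <= Lyy := set_Lyy_ge0 H.
Let Lyx0 : 0 <= Lyx := ltW (set_Lyx_gt0 H).
Let Lxy0 : 0 <= Lxy := ltW (set_Lxy_gt0 H).

Definition err_x k := gx k - grad_x Phi (x k) (y k.+1).
Definition err_y k := gy k - grad_y Phi (x k) (y k).

Let Gy k := grad_y Phi (x k) (y k).
(** Momentum of the exact gradients, equal to 0 at the first step like that of the algorithm. *)
Let Q k := if k is j.+1 then Gy k - Gy j else 0.
Let sqx k := if k is j.+1 then enorm (x k - x j) ^+ 2 else 0.
Let sqy k := if k is j.+1 then enorm (y k - y j) ^+ 2 else 0.

(** Beside the distances to the comparison point, it stores the pending momentum term and the
    squared last steps that will pay for that term one iteration later. *)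
Let potential k := (2 * tau)^-1 * enorm (X - x k) ^+ 2
  + (2 * sigma)^-1 * enorm (Y - y k) ^+ 2 + dotp (Q k) (y k - Y)
  + Lyx / 2 * sqx k + Lyy / 2 * sqy k.

(** Since [theta = 1], the ascent direction carries twice the current [y]-error minus the previous
    one; at [k = 0] there is no momentum. *)
Definition sapd_noise k := - dotp (err_x k) (x k.+1 - X)
  + (if k is j.+1 then 2 * dotp (err_y k) (y k.+1 - Y) - dotp (err_y j) (y k.+1 - Y)
     else dotp (err_y k) (y k.+1 - Y)).

(** Lipschitz bound on the momentum followed by Young's inequality, with weights matching the step
    terms stored in [potential]. *)
Let Q_bound k v :
  2 * `|dotp (Q k) v| <= Lyx * sqx k + Lyy * sqy k + (Lyx + Lyy) * enorm v ^+ 2.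
Proof.
case: k => [|k] /=.
  rewrite dotp0l normr0 !mulr0 !add0r mulr_ge0 ?sqr_ge0 ?addr_ge0//.
have hQ := set_grad_y_lip H (fx k.+1) (fx k) (gyd k.+1) (gyd k).
apply: (@le_trans _ _ (2 * (enorm (Gy k.+1 - Gy k) * enorm v))).
  by rewrite ler_pM2l// ler_norml dotp_le dotp_ge.
have := ler_wpM2r (enorm_ge0 v) hQ; rewrite -/(Gy _) -/(Gy _).
move: (enorm (x _ - _)) (enorm (y _ - _)) (enorm v) (enorm (Gy _ - _)) => a b c e h.
have := mulr_ge0 Lyx0 (sqr_ge0 (a - c)); have := mulr_ge0 Lyy0 (sqr_ge0 (b - c)).
by lra.
Qed.

(** The coefficient of |x_{k+1} - x_k|^2 to be absorbed: Lxx/2 from the descent inequality, gamma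
    from the regularizer, Lyx/2 to be stored in [potential]. *)
Let inv_tau : (Lyx + Lxx + 2 * gamma) / 2 <= (2 * tau)^-1.
Proof. by rewrite invfM mulrC ler_pM2l// -[leRHS]mul1r ler_pdivlMr// mulrC. Qed.

(** Likewise for |y_{k+1} - y_k|^2: (Lyx + Lyy)/2 from [Q_bound] and Lyy/2 to be stored in
    [potential]. *)
Let inv_sigma : (Lyx + 2 * Lyy) / 2 <= (2 * sigma)^-1.
Proof. by rewrite invfM mulrC ler_pM2l// -[leRHS]mul1r ler_pdivlMr// mulrC. Qed.

(** Strong concavity is used at the new point while the step used the old gradient. The discrepancy
    is [- Q k.+1], paired with [y k.+1 - Y]; the momentum [Q k] offsets it up to its own pairing
    with [y k.+1 - y k], so these terms telescope. *)
Lemma sapd_step k :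
  gamma / 2 * enorm (x k.+1 - X) ^+ 2 + mu / 2 * enorm (y k.+1 - Y) ^+ 2
    + potential k.+1 <= potential k + sapd_noise k.
Proof.
have [fX gY hX hY] := XY.
have Py := prox_step (set_g_prox H) (y k) (gy k + q k) sigma0 gY.
have Px := prox_step (set_f_prox H) (x k) (- (gx k + (2 * gamma) *: (x k - x 0%N))) tau0 fX.
move: Py Px; cbv zeta; rewrite scalerN -y_step -x_step => Py Px.
have h1 := hX _ (fx k.+1); have h2 := hY _ (gyd k.+1).
have h3 := set_strongly_concave H Y (fx k.+1) (gyd k.+1).
have h4 := set_descent H (fx k) (fx k.+1) (gyd k.+1).
have h5 := set_weakly_convex H X (fx k) (gyd k.+1).
(* The regularizer enters the step linearized at [x k]. Its exact expansion supplies - gamma |X - x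
   k|^2, which covers the loss gamma/2 |X - x k|^2 from weak convexity in [h5]. *)
have h6 : enorm (x k.+1 - x 0%N) ^+ 2 - enorm (X - x 0%N) ^+ 2 =
    2 * dotp (x k - x 0%N) (x k.+1 - X) + enorm (x k.+1 - x k) ^+ 2 - enorm (X - x k) ^+ 2.
  by dotp_expand; ring.
have h7 := Q_bound k (y k.+1 - y k).
have h8 : dotp (Q k) (y k.+1 - y k) <= `|dotp (Q k) (y k.+1 - y k)| by exact: ler_norm.
have h9 := ler_wpM2r (sqr_ge0 (enorm (x k.+1 - x k))) inv_tau.
have h10 := ler_wpM2r (sqr_ge0 (enorm (y k.+1 - y k))) inv_sigma.
have hn : dotp (gy k + q k) (y k.+1 - Y) - dotp (gx k) (x k.+1 - X) =
    sapd_noise k + dotp (Gy k + Q k) (y k.+1 - Y)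
    - dotp (grad_x Phi (x k) (y k.+1)) (x k.+1 - X).
  rewrite /sapd_noise /err_x /err_y; case: (k) => [|j].
    by rewrite q_0 /Q /Gy; move: (y 1%N - Y) (x 1%N - X) => u v; dotp_expand; ring.
  by rewrite q_S /Q /Gy; move: (y j.+2 - Y) (x j.+2 - X) => u v; dotp_expand; ring.
have e1 : dotp (Q k) (y k.+1 - Y) = dotp (Q k) (y k - Y) + dotp (Q k) (y k.+1 - y k).
  by rewrite -dotpDr; congr dotp; rewrite [RHS]addrC addrA subrK.
have e2 : dotp (Q k.+1) (y k.+1 - Y) = dotp (Gy k.+1) (y k.+1 - Y) - dotp (Gy k) (y k.+1 - Y).
  by rewrite /Q dotpDl dotpNl.
have e3 : dotp (grad_y Phi (x k.+1) (y k.+1)) (Y - y k.+1) = - dotp (Gy k.+1) (y k.+1 - Y).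
  by rewrite -dotpNr opprB.
have e4 : dotp (grad_x Phi (x k) (y k.+1)) (x k.+1 - X) =
    dotp (grad_x Phi (x k) (y k.+1)) (x k.+1 - x k) - dotp (grad_x Phi (x k) (y k.+1)) (X - x k).
  by rewrite -dotpNr -dotpDr opprB addrA subrK.
rewrite (dotpDl (Gy k)) in hn; rewrite e3 in h3.
rewrite dotpNl (dotpDl (gx k)) dotpZl in Px.
have p1 := mulr_ge0 (ltW gamma0) (sqr_ge0 (enorm (X - x k))).
have p2 := mulr_ge0 (ltW mu0) (sqr_ge0 (enorm (Y - y k.+1))).
rewrite /potential e2 /sqx /sqy -/(sqx k) -/(sqy k).
move: h1 h2 h6; rewrite /Lagr.
have -> : enorm (X - x k.+1) = enorm (x k.+1 - X) by rewrite enormB.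
have E : enorm (Y - y k.+1) = enorm (y k.+1 - Y) by rewrite enormB.
rewrite E in p2 h3 *.
rewrite (enormB X (x k.+1)) in Px; rewrite E in Py.
move=> h1 h2 h6.
have h6' : gamma * (enorm (x k.+1 - x 0%N) ^+ 2 - enorm (X - x 0%N) ^+ 2) =
  gamma * (2 * dotp (x k - x 0%N) (x k.+1 - X) + enorm (x k.+1 - x k) ^+ 2 - enorm (X - x k) ^+ 2).
  by rewrite h6.
lra.
Qed.

Lemma sapd_sum (N : nat) :
  \sum_(k < N) (gamma / 2 * enorm (x k.+1 - X) ^+ 2 + mu / 2 * enorm (y k.+1 - Y) ^+ 2)
  <= (2 * tau)^-1 * enorm (x 0%N - X) ^+ 2 + (2 * sigma)^-1 * enorm (y 0%N - Y) ^+ 2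
     + \sum_(k < N) sapd_noise k.
Proof.
have h : \sum_(k < N) (gamma / 2 * enorm (x k.+1 - X) ^+ 2 + mu / 2 * enorm (y k.+1 - Y) ^+ 2)
    + potential N <= potential 0 + \sum_(k < N) sapd_noise k.
  elim: N => [|N ih]; first by rewrite !big_ord0 add0r addr0.
  by rewrite !big_ord_recr/=; have := sapd_step N; lra.
(* The momentum term can be negative; [Q_bound] with [y N - Y] charges it to the stored step terms
   and to the [sigma] term. *)
have pN : 0 <= potential N.
  have := Q_bound N (y N - Y); have : - `|dotp (Q N) (y N - Y)| <= dotp (Q N) (y N - Y).
    by rewrite lerNl -normrN ler_norm.
  have := ler_wpM2r (sqr_ge0 (enorm (y N - Y))) inv_sigma.
  have : 0 <= (2 * tau)^-1 * enorm (X - x N) ^+ 2.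
    by rewrite mulr_ge0 ?sqr_ge0// invr_ge0 mulr_ge0// ltW.
  have := mulr_ge0 Lyy0 (sqr_ge0 (enorm (y N - Y))).
  by rewrite /potential (enormB Y); lra.
have p0 : potential 0 = (2 * tau)^-1 * enorm (x 0%N - X) ^+ 2
    + (2 * sigma)^-1 * enorm (y 0%N - Y) ^+ 2.
  by rewrite /potential /= dotp0l !mulr0 !addr0 (enormB X) (enormB Y).
by rewrite -p0; lra.
Qed.

(* [sapd_xbar], [sapd_ybar]: the next iterates when the current error is removed;
   [sapd_xhat], [sapd_yhat]: the next [x] and the [y] after next when the error of
   the current [y]-estimate and all later errors are removed. *)
Definition sapd_xbar k :=
  prox tau f (x k - tau *: (grad_x Phi (x k) (y k.+1) + (2 * gamma) *: (x k - x 0%N))).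
Definition sapd_ybar k := prox sigma g (y k + sigma *:
  (if k is j.+1 then 2 *: grad_y Phi (x k) (y k) - gy j else grad_y Phi (x k) (y k))).
Definition sapd_xhat k := prox tau f
  (x k - tau *: (grad_x Phi (x k) (sapd_ybar k) + (2 * gamma) *: (x k - x 0%N))).
Definition sapd_yhat k := prox sigma g (sapd_ybar k + sigma *:
  (2 *: grad_y Phi (sapd_xhat k) (sapd_ybar k) - grad_y Phi (x k) (y k))).

(** [sapd_noise] with each error paired with an iterate that does not depend on it: two steps later,
    [y] is replaced by [sapd_yhat j]. *)
Definition sapd_martingale k := - dotp (err_x k) (sapd_xbar k - X)
  + (if k is j.+1 then 2 * dotp (err_y k) (sapd_ybar k - Y) - dotp (err_y j) (sapd_yhat j - Y)
     else dotp (err_y k) (sapd_ybar k - Y)).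

Let xbar_dist k : enorm (x k.+1 - sapd_xbar k) <= tau * enorm (err_x k).
Proof.
rewrite x_step (le_trans (prox_lip (set_f_prox H) _ _ tau0))//.
rewrite (_ : _ - _ = (- tau) *: err_x k); first by rewrite enormZ normrN gtr0_norm.
by apply/rowP => i; rewrite /err_x !mxE; ring.
Qed.

(** The factor 2 arises because the error enters through the estimate and again through the
    momentum. *)
Let ybar_dist k : enorm (y k.+1 - sapd_ybar k) <= 2 * sigma * enorm (err_y k).
Proof.
rewrite y_step (le_trans (prox_lip (set_g_prox H) _ _ sigma0))//.
case: k => [|k].
  rewrite q_0 addr0 (_ : _ - _ = sigma *: err_y 0).
    rewrite enormZ gtr0_norm//; apply: ler_wpM2r; rewrite ?enorm_ge0//. have := sigma0; lra.
  by apply/rowP => i; rewrite /err_y !mxE; ring.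
rewrite q_S (_ : _ - _ = (2 * sigma) *: err_y k.+1).
  by rewrite enormZ gtr0_norm ?mulr_gt0.
by apply/rowP => i; rewrite /err_y !mxE; ring.
Qed.

Let Dybar k : edom g (sapd_ybar k). Proof. exact: (set_g_prox H _ sigma0).1. Qed.
Let Dxhat k : edom f (sapd_xhat k). Proof. exact: (set_f_prox H _ tau0).1. Qed.

(** The error of [y k.+1] passes through grad_x; [tau * Lxy <= 1] keeps it from being amplified. *)
Let xhat_dist k :
  enorm (x k.+1 - sapd_xhat k) <= tau * enorm (err_x k) + 2 * sigma * enorm (err_y k).
Proof.
rewrite (le_trans (ler_enormBD (sapd_xbar k) _ _))// lerD ?xbar_dist//.
rewrite (le_trans (prox_lip (set_f_prox H) _ _ tau0))//.
rewrite (_ : _ - _ = tau *: (grad_x Phi (x k) (sapd_ybar k) - grad_x Phi (x k) (y k.+1))); last first.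
  by apply/rowP => i; rewrite !mxE; ring.
rewrite enormZ gtr0_norm//.
have := set_grad_x_lip H (fx k) (fx k) (Dybar k) (gyd k.+1).
rewrite subrr enorm0 mulr0 add0r enormB => /(ler_wpM2l (ltW tau0)).
rewrite enormB => /le_trans -> //.
rewrite mulrA (enormB (sapd_ybar k)).
apply: (@le_trans _ _ (1 * enorm (y k.+1 - sapd_ybar k))).
  by rewrite ler_wpM2r ?enorm_ge0.
by rewrite mul1r ybar_dist.
Qed.

(** The 7 is 2 from [ybar_dist], 1 from the estimate [gy k], and 4 from the doubled exact gradient,
    because sigma (Lyx + Lyy) <= 1. *)
Let yhat_dist k : enorm (sapd_ybar k.+1 - sapd_yhat k) <=
  7 * sigma * enorm (err_y k) + 2 * sigma * Lyx * tau * enorm (err_x k).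
Proof.
rewrite (le_trans (prox_lip (set_g_prox H) _ _ sigma0))//.
set G' := grad_y Phi (sapd_xhat k) (sapd_ybar k).
rewrite (_ : _ - _ = (y k.+1 - sapd_ybar k) + ((2 * sigma) *: (Gy k.+1 - G') + (- sigma) *: err_y k)); last first.
  by apply/rowP => i; rewrite /Gy /G' /err_y !mxE; ring.
rewrite (le_trans (ler_enormD _ _))//.
have := ler_enormD ((2 * sigma) *: (Gy k.+1 - G')) ((- sigma) *: err_y k).
rewrite !enormZ normrN !gtr0_norm ?mulr_gt0//.
have := set_grad_y_lip H (fx k.+1) (Dxhat k) (gyd k.+1) (Dybar k).
have := xhat_dist k; have := ybar_dist k.
rewrite -/(Gy k.+1) -/G'.
move: (enorm (_ *: _ + _)) (enorm (Gy k.+1 - G')) (enorm (x k.+1 - _)) (enorm (y k.+1 - _)).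
have := enorm_ge0 (err_x k); have := enorm_ge0 (err_y k).
move: (enorm (err_x k)) (enorm (err_y k)) => ex ey ey0 ex0 S dG dX dY h1 h2 h3 h4.
have k1 := ler_wpM2l (mulr_ge0 (ltW sigma0) Lyx0) h2.
have k2 := ler_wpM2l (mulr_ge0 (ltW sigma0) Lyy0) h1.
have k3 := ler_wpM2l (ltW sigma0) h3.
have k4 := ler_wpM2r (mulr_ge0 (ltW sigma0) ey0) sigmaL.
have k5 := mulr_ge0 (mulr_ge0 (mulr_ge0 (ltW sigma0) (ltW sigma0)) Lyy0) ey0; lra.
Qed.

(** Replacing the true iterates costs error times distance. For the current [y]-error, 5 is 2 * 2
    from [ybar_dist] plus 1 from the mixed product; for the previous one, 9 is 7 from [yhat_dist]
    plus 1 from each of two mixed products. *)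
Lemma sapd_noise_le k : sapd_noise k <= sapd_martingale k
  + tau * enorm (err_x k) ^+ 2 + 5 * sigma * enorm (err_y k) ^+ 2
  + (if k is j.+1 then tau * enorm (err_x j) ^+ 2 + 9 * sigma * enorm (err_y j) ^+ 2 else 0).
Proof.
have hx : - dotp (err_x k) (x k.+1 - X) <=
    - dotp (err_x k) (sapd_xbar k - X) + tau * enorm (err_x k) ^+ 2.
  have := dotp_ge (err_x k) (x k.+1 - sapd_xbar k).
  have := ler_wpM2l (enorm_ge0 (err_x k)) (xbar_dist k).
  have -> : dotp (err_x k) (x k.+1 - X) =
      dotp (err_x k) (x k.+1 - sapd_xbar k) + dotp (err_x k) (sapd_xbar k - X).
    by rewrite -dotpDr addrA subrK.
  lra.
have hy : dotp (err_y k) (y k.+1 - Y) <=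
    dotp (err_y k) (sapd_ybar k - Y) + 2 * sigma * enorm (err_y k) ^+ 2.
  have := dotp_le (err_y k) (y k.+1 - sapd_ybar k).
  have := ler_wpM2l (enorm_ge0 (err_y k)) (ybar_dist k).
  have -> : dotp (err_y k) (y k.+1 - Y) =
      dotp (err_y k) (y k.+1 - sapd_ybar k) + dotp (err_y k) (sapd_ybar k - Y).
    by rewrite -dotpDr addrA subrK.
  lra.
rewrite /sapd_noise /sapd_martingale.
have := mulr_ge0 (ltW sigma0) (sqr_ge0 (enorm (err_y k))).
case: k hx hy => [|j] hx hy p0; first lra.
have hz : - dotp (err_y j) (y j.+2 - Y) <= - dotp (err_y j) (sapd_yhat j - Y) +
    enorm (err_y j) * (2 * sigma * enorm (err_y j.+1) +
    (7 * sigma * enorm (err_y j) + 2 * sigma * Lyx * tau * enorm (err_x j))).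
  have := dotp_ge (err_y j) (y j.+2 - sapd_yhat j).
  have := ler_enormBD (sapd_ybar j.+1) (y j.+2) (sapd_yhat j).
  have := yhat_dist j; have := ybar_dist j.+1.
  have -> : dotp (err_y j) (y j.+2 - Y) =
      dotp (err_y j) (y j.+2 - sapd_yhat j) + dotp (err_y j) (sapd_yhat j - Y).
    by rewrite -dotpDr addrA subrK.
  move=> h1 h2 h3 h4.
  have h5 := ler_wpM2l (enorm_ge0 (err_y j)) (le_trans h3 (lerD h1 h2)).
  by rewrite opprD addrC lerD2l (le_trans _ h5)// lerNl.
move: hx hy hz p0; have := enorm_ge0 (err_y j); have := enorm_ge0 (err_x j).
move: (enorm (err_y j)) (enorm (err_x j)) (enorm (err_y j.+1)) => e d e1 d0 e0 hx hy hz p0.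
have k1 := mulr_ge0 (ltW sigma0) (sqr_ge0 (e - e1)).
(* AM-GM for [2 sigma Lyx tau e d], using [sigma Lyx <= 1] and [tau Lyx <= 1] *)
have k2 : 2 * (sigma * Lyx * tau * (e * d)) <= sigma * e ^+ 2 + tau * d ^+ 2.
  clear hx hy hz p0 k1.
  have s1 : 0 <= sigma * (1 - tau * Lyx) * e ^+ 2.
    rewrite !mulr_ge0 ?sqr_ge0 ?(ltW sigma0)// subr_ge0 (le_trans _ tauL)//.
    by rewrite ler_wpM2l ?(ltW tau0)// -addrA lerDl addr_ge0// mulr_ge0// ltW.
  have s2 : 0 <= tau * (1 - sigma * Lyx) * d ^+ 2.
    rewrite !mulr_ge0 ?sqr_ge0 ?(ltW tau0)// subr_ge0 (le_trans _ sigmaL)//.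
    by rewrite ler_wpM2l ?(ltW sigma0)// lerDl mulr_ge0.
  have s3 := mulr_ge0 (mulr_ge0 (mulr_ge0 (ltW sigma0) (ltW tau0)) Lyx0) (sqr_ge0 (e - d)).
  move: s1 s2 s3; rewrite (_ : sigma * (1 - tau * Lyx) * e ^+ 2 = sigma * e ^+ 2 - sigma * tau * Lyx * e ^+ 2); last by ring.
  rewrite (_ : tau * (1 - sigma * Lyx) * d ^+ 2 = tau * d ^+ 2 - sigma * tau * Lyx * d ^+ 2); last by ring.
  rewrite (_ : sigma * tau * Lyx * (e - d) ^+ 2 = sigma * tau * Lyx * e ^+ 2 + sigma * tau * Lyx * d ^+ 2 - 2 * (sigma * Lyx * tau * (e * d))); last by ring.
  move: (sigma * Lyx * tau * (e * d)) (sigma * tau * Lyx * e ^+ 2) (sigma * tau * Lyx * d ^+ 2) => p p1 p2; lra.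
move: hz k1 k2.
rewrite (_ : e * _ = 2 * (sigma * e * e1) + 7 * (sigma * e ^+ 2) + 2 * (sigma * Lyx * tau * (e * d))); last by ring.
rewrite (_ : sigma * (e - e1) ^+ 2 = sigma * e ^+ 2 - 2 * (sigma * e * e1) + sigma * e1 ^+ 2); last by ring.
clear p0.
move: (dotp _ _) hx hy => d1.
move: (sigma * Lyx * tau * (e * d)) (sigma * e * e1) => p p1.
rewrite -!mulrA; move: (sigma * e ^+ 2) (sigma * e1 ^+ 2) (tau * d ^+ 2) => p2 p3 p4.
move: (dotp _ (sapd_xbar _ - X)) (dotp _ (sapd_yhat _ - Y)) (dotp _ (sapd_ybar _ - Y)).
move: (dotp _ (y j.+2 - Y)) (dotp _ (y j.+2 - Y)) => d2 d3 d4 d5 d6 {d0 e0}; lra.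
Qed.

End PathwiseSAPD.

(** * Measurability and orthogonality for a sub-sigma-algebra *)

Section SubSigmaAlgebra.
Context {R : realType} {d : measure_display} {Omega : measurableType d}.
Variable F : set_system Omega.
Hypothesis sF : sigma_algebra [set: Omega] F.

(** Histories are plain set systems on a type that already has its sigma-algebra; [meas_wrtP]
    translates to the generated measurable type. *)
Definition meas_wrt (F : set_system Omega) (V : Omega -> R) :=
  forall B : set R, measurable B -> F (V @^-1` B).

Lemma meas_wrtP (V : Omega -> R) :
  meas_wrt F V <-> measurable_fun [set: g_sigma_algebraType F]
    (V : g_sigma_algebraType F -> R).
Proof.
have E := measurable_g_measurableTypeE sF.
split=> [hV _ B mB|hV B mB].
  by rewrite setTI E; exact: hV.
by have := hV measurableT B mB; rewrite setTI E.
Qed.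

Lemma meas_wrt_cst c : meas_wrt F (cst c).
Proof. by apply/meas_wrtP; exact: measurable_cst. Qed.

Lemma meas_wrtD (U V : Omega -> R) :
  meas_wrt F U -> meas_wrt F V -> meas_wrt F (fun w => U w + V w).
Proof.
by move=> /meas_wrtP hU /meas_wrtP hV; apply/meas_wrtP; exact: measurable_funD.
Qed.

Lemma meas_wrtM (U V : Omega -> R) :
  meas_wrt F U -> meas_wrt F V -> meas_wrt F (fun w => U w * V w).
Proof.
by move=> /meas_wrtP hU /meas_wrtP hV; apply/meas_wrtP; exact: measurable_funM.
Qed.

Lemma meas_wrt_sum (I : Type) (s : seq I) (h : I -> Omega -> R) :
  (forall i, meas_wrt F (h i)) -> meas_wrt F (fun w => \sum_(i <- s) h i w).
Proof.
move=> hm; apply/meas_wrtP; apply: measurable_sum => i.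
by apply/meas_wrtP; exact: hm.
Qed.

Lemma rational_dense_enorm (p : nat) (z : 'rV[R]_p) (r : R) : 0 < r ->
  exists q : 'rV[rat]_p, enorm (z - map_mx ratr q) < r.
Proof.
move=> r0; pose e := r / p.+1%:R.
have e0 : 0 < e by rewrite divr_gt0.
have /choice [q hq] : forall i : 'I_p, exists q : rat, `|z 0 i - ratr q| < e.
  move=> i; have /rat_in_itvoo [q] : z 0 i - e < z 0 i + e by rewrite ltrD2l gtrN.
  rewrite in_itv/= => /andP[h1 h2]; exists q.
  by rewrite distrC ltr_distl h1.
exists (\row_i q i); apply: (le_lt_trans (enorm_le_sum _)).
apply: (@le_lt_trans _ _ (\sum_(i < p) e)).
  by apply: ler_sum => i _; rewrite !mxE ltW.
rewrite sumr_const card_ord -mulr_natr /e mulrAC ltr_pdivrMr//.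
by rewrite ltr_pM2l// ltr_nat.
Qed.

(* The superlevel sets of [h o V] are countable unions of preimages of balls with
   rational centers, so the domain [D] of [h] need not be measurable. *)
Lemma meas_wrt_lip (p : nat) (D : set 'rV[R]_p) (h : 'rV[R]_p -> R) (K : R)
    (V : Omega -> 'rV[R]_p) :
  (forall z z', D z -> D z' -> `|h z - h z'| <= K * enorm (z - z')) ->
  (forall w, D (V w)) -> (forall i, meas_wrt F (fun w => V w 0 i)) ->
  meas_wrt F (fun w => h (V w)).
Proof.
move=> hK DV mV; apply/meas_wrtP.
apply: (measurability _ (RGenOInfty.measurableE R)).
move=> _ [_ [a ->] <-]; rewrite setTI.
(* Selects the rational balls whose trace on [D] lies in the superlevel set; there are countably
   many. *)
pose J (qk : 'rV[rat]_p * nat) := forall z, D z ->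
  enorm (z - map_mx ratr qk.1) < qk.2.+1%:R^-1 -> a < h z.
pose A (qk : 'rV[rat]_p * nat) : set Omega :=
  [set w | J qk /\ enorm (V w - map_mx ratr qk.1) ^+ 2 < qk.2.+1%:R^-1 ^+ 2].
have -> : (fun w => h (V w)) @^-1` `]a, +oo[ = \bigcup_qk A qk.
  apply/seteqP; split => [w|w [[q k] _ [/= Jqk]]] /=.
    rewrite in_itv/= andbT => aw.
    have K0 : 0 < 2 * `|K| + 1 by rewrite ltr_wpDl.
    (* The radius is so small that two points of the ball, at distance at most 2/(k+1), cannot
       differ in [h] by [h (V w) - a]. *)
    have [k hk] : exists k : nat, k.+1%:R^-1 * (2 * `|K| + 1) < h (V w) - a.
      have /cvgrPdist_lt : (fun k => k.+1%:R^-1 * (2 * `|K| + 1) : R) @ \oo --> 0.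
        rewrite -(mul0r (2 * `|K| + 1)); apply: cvgM; last exact: cvg_cst.
        exact: cvg_harmonic.
      move=> /(_ (h (V w) - a)); rewrite subr_gt0 => /(_ aw) [k _ /(_ k (leqnn k))] /=.
      by rewrite sub0r normrN => hk; exists k; exact: le_lt_trans (ler_norm _) hk.
    have k0 : (0 : R) < k.+1%:R^-1 by rewrite invr_gt0.
    have [q hq] := rational_dense_enorm (V w) k0.
    exists (q, k) => //; split => /=; last by rewrite ltr_pXn2r ?nnegrE ?enorm_ge0.
    move=> z Dz /= hz.
    have zw : enorm (V w - z) <= 2 * k.+1%:R^-1.
      rewrite (le_trans (ler_enormBD (map_mx ratr q) _ _))//.
      by rewrite (enormB _ z) mulr2n mulrDl !mul1r lerD// ltW.
    have h1 : h (V w) - h z <= `|K| * (2 * k.+1%:R^-1).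
      rewrite (le_trans (ler_norm _))// (le_trans (hK _ _ (DV w) Dz))//.
      apply: (@le_trans _ _ (`|K| * enorm (V w - z))).
        by rewrite ler_wpM2r ?enorm_ge0// ler_norm.
      by rewrite ler_wpM2l.
    move: h1 hk; have : 0 <= (k.+1%:R^-1 : R) by [].
    move: (k.+1%:R^-1) => r r0; lra.
  rewrite in_itv/= andbT ltr_pXn2r ?nnegrE ?enorm_ge0// => hq.
  exact: Jqk (DV w) hq.
apply: countable_bigcupT_measurable; first exact: countableP.
move=> [q k]; have [Jqk|nJ] := pselect (J (q, k)); last first.
  rewrite (_ : A _ = set0) ?measurable_g_measurableTypeE//; first by case: sF.
  by apply/seteqP; split => // w [].
have -> : A (q, k) = (fun w => \sum_(i < p) ((V w - map_mx ratr q) 0 i * (V w - map_mx ratr q) 0 i))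
    @^-1` `]-oo, (k.+1%:R^-1 ^+ 2)[.
  apply/seteqP; split => w; rewrite /A /= in_itv/= -/(dotp _ _) -enorm2E.
    by case.
  by [].
rewrite measurable_g_measurableTypeE//; suff : meas_wrt F
  (fun w => \sum_(i < p) ((V w - map_mx ratr q) 0 i * (V w - map_mx ratr q) 0 i)).
  by apply.
apply: meas_wrt_sum => i.
have h1 : meas_wrt F (fun w => (V w - map_mx ratr q) 0 i).
  have -> : (fun w => (V w - map_mx ratr q) 0 i) = (fun w => V w 0 i + cst (- ratr (q 0 i)) w).
    by apply/funext => w; rewrite !mxE.
  by apply: meas_wrtD => //; exact: meas_wrt_cst.
exact: meas_wrtM.
Qed.

End SubSigmaAlgebra.

Import HBSimple HBNNSimple.

Section Orthogonality.
Context {R : realType} {d : measure_display} {Omega : measurableType d}.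
Variable P : probability Omega R.
Variable F : set_system Omega.
Hypotheses (sF : sigma_algebra [set: Omega] F) (Fm : F `<=` measurable).
Implicit Types (U V Z D : Omega -> R).

Lemma meas_wrt_measurable U : meas_wrt F U -> measurable_fun [set: Omega] U.
Proof. by move=> mU _ B mB; rewrite setTI; apply: Fm; exact: mU. Qed.

Section CenteredOnF.
Variable D : Omega -> R.
Hypothesis iD : P.-integrable [set: Omega] (EFin \o D).
Hypothesis D0 : forall A, F A -> (\int[P]_(w in A) (D w)%:E = 0)%E.

Let D_indic A : F A -> (\int[P]_w (D w * \1_A w)%:E = 0)%E.
Proof.
move=> FA; rewrite -(D0 FA) [RHS]integral_mkcond; apply: eq_integral => w _.
by rewrite patchE indicE; case: ifPn => _; rewrite ?mulr1 ?mulr0.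
Qed.

Let iD_indic A : F A -> P.-integrable [set: Omega] (fun w => (D w * \1_A w)%:E).
Proof.
move=> FA; apply: le_integrable iD => //.
  apply/measurable_EFinP; apply: measurable_funM.
    by apply/measurable_EFinP; exact: measurable_int iD.
  by apply: measurable_indic; exact: Fm.
move=> w _ /=; rewrite lee_fin normrM indicE.
by case: (_ \in _); rewrite ?normr1 ?mulr1// normr0 mulr0.
Qed.

Let D_nnsfun (phi : {nnsfun g_sigma_algebraType F >-> R}) :
  (\int[P]_w (D w * phi (w : g_sigma_algebraType F))%:E = 0)%E.
Proof.
have Fphi (r : R) : F (phi @^-1` [set r]).
  have /(_ measurableT [set r] (measurable_set1 r)) : measurable_fun setT phi by [].
  by rewrite setTI measurable_g_measurableTypeE.
have [s phiE] : exists s : seq R, forall z : g_sigma_algebraType F,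
    phi z = \sum_(y <- s) y * \1_(phi @^-1` [set y]) z.
  by exists (finmap.enum_fset (fset_set (range phi))) => z; rewrite fimfunE fsbig_finite.
transitivity (\int[P]_w (\sum_(y <- s) y%:E * (D w * \1_(phi @^-1` [set y]) w)%:E))%E.
  apply: eq_integral => w _; rewrite phiE mulr_sumr -sumEFin.
  by apply: eq_bigr => y _; rewrite -EFinM mulrCA.
rewrite integral_sum//; last by move=> y; apply: integrableZl => //; exact: iD_indic.
rewrite big1_seq// => y _; rewrite integralZl//; last exact: iD_indic.
by rewrite D_indic// mule0.
Qed.

(** Simple functions approximate [U] from below, so |D U| dominates; boundedness of [U] is replaced
    by integrability of the product. *)
Let D_ge0 U : meas_wrt F U -> (forall w, 0 <= U w) ->
  P.-integrable [set: Omega] (fun w => (D w * U w)%:E) ->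
  (\int[P]_w (D w * U w)%:E = 0)%E.
Proof.
move=> mU U0 iDU.
have mU' : measurable_fun [set: g_sigma_algebraType F] (EFin \o U : g_sigma_algebraType F -> \bar R).
  by apply/measurable_EFinP; exact/(meas_wrtP sF).
pose phi' := nnsfun_approx (@measurableT _ (g_sigma_algebraType F)) mU'.
pose phi k (w : Omega) : R := phi' k (w : g_sigma_algebraType F).
have phiU w : phi ^~ w @ \oo --> U w.
  have := @cvg_nnsfun_approx _ _ _ _ (@measurableT _ (g_sigma_algebraType F)) _ mU' _ w I.
  by move=> /(_ (fun z _ => U0 z)) /fine_cvgP [_].
have le_phi k w : phi k w <= U w.
  rewrite -lee_fin /phi nnsfun_approxE; apply: (le_approx k (f := EFin \o U)) => // z _.
  by rewrite lee_fin.
have mphi k : measurable_fun [set: Omega] (phi k : Omega -> R).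
  apply: meas_wrt_measurable; apply/(meas_wrtP sF).
  by have : measurable_fun setT (phi' k) by [].
have mD : measurable_fun [set: Omega] D by apply/measurable_EFinP; exact: measurable_int iD.
have [] := @dominated_convergence _ _ _ P [set: Omega] measurableT
  (fun k w => (D w * phi k w)%:E) (fun w => (D w * U w)%:E) (fun w => `|(D w * U w)%:E|%E).
- by move=> k; apply/measurable_EFinP; exact: measurable_funM.
- by apply/measurable_EFinP; apply: measurable_funM => //; exact: meas_wrt_measurable.
- apply: nearW => w _; apply: cvg_EFin; first exact: nearW.
  by apply: cvgM; [exact: cvg_cst|exact: phiU].
- exact: integrable_abse.
- apply: nearW => w k _; rewrite !abse_EFin lee_fin !normrM ler_wpM2l//.
  by rewrite !ger0_norm.
move=> _ _ /=; under eq_fun do rewrite D_nnsfun.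
by move=> /(cvg_unique _ (cvg_cst _)) <-.
Qed.

(** The usual extension from indicators to simple functions, nonnegative functions and differences
    of positive parts. It is how every martingale term gets mean zero. *)
Lemma centered_orthogonal U : meas_wrt F U ->
  P.-integrable [set: Omega] (fun w => (D w * U w)%:E) ->
  (\int[P]_w (D w * U w)%:E = 0)%E.
Proof.
move=> mU iDU.
have mD : measurable_fun [set: Omega] D by apply/measurable_EFinP; exact: measurable_int iD.
have pos (V : Omega -> R) : meas_wrt F V -> P.-integrable [set: Omega] (fun w => (D w * V w)%:E) ->
    (P.-integrable [set: Omega] (fun w => (D w * Num.max (V w) 0)%:E) *
    (\int[P]_w (D w * Num.max (V w) 0)%:E = 0)%E)%type.
  move=> mV iDV.
  have mV' : meas_wrt F (fun w => Num.max (V w) 0).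
    by apply/(meas_wrtP sF); apply: measurable_maxr => //; exact/(meas_wrtP sF).
  have iV : P.-integrable [set: Omega] (fun w => (D w * Num.max (V w) 0)%:E).
    apply: le_integrable iDV => //.
      by apply/measurable_EFinP; apply: measurable_funM => //; exact: meas_wrt_measurable.
    move=> w _; rewrite !abse_EFin lee_fin !normrM ler_wpM2l//.
    by rewrite /Num.max; case: ifPn => // _; rewrite normr0.
  by split => //; apply: D_ge0 => // w; rewrite le_max lexx orbT.
have mN : meas_wrt F (fun w => - U w).
  by apply/(meas_wrtP sF); apply: measurableT_comp => //; exact/(meas_wrtP sF).
have iN : P.-integrable [set: Omega] (fun w => (D w * - U w)%:E).
  have := integrableN iDU.
  by apply: eq_integrable => // w _; rewrite /= mulrN.
have [i1 e1] := pos _ mU iDU; have [i2 e2] := pos _ mN iN.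
transitivity (\int[P]_w ((D w * Num.max (U w) 0)%:E - (D w * Num.max (- U w) 0)%:E))%E.
  apply: eq_integral => w _; rewrite -EFinB -mulrBr; congr (_ * _)%:E.
  rewrite /Num.max; case: (ltrP (U w) 0) => h.
    by rewrite ltNge oppr_ge0 (ltW h) sub0r opprK.
  by case: (ltrP (- U w) 0); rewrite ?subr0// oppr_ge0 => h'; apply/eqP; rewrite opprK eq_le; lra.
by rewrite integralB_EFin// e1 e2 subee.
Qed.

End CenteredOnF.
End Orthogonality.

(** * Real-valued expectations and square-integrable vectors *)

Section RealIntegrable.
Context {R : realType} {d : measure_display} {Omega : measurableType d}.
Variable P : probability Omega R.
Implicit Types (U V : Omega -> R).

Definition rint U := P.-integrable [set: Omega] (EFin \o U).

Lemma rint_measurable U : rint U -> measurable_fun [set: Omega] U.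
Proof. by move=> iU; apply/measurable_EFinP; exact: measurable_int iU. Qed.

Lemma rint_le U V : measurable_fun [set: Omega] U -> (forall w, `|U w| <= V w) ->
  rint V -> rint U.
Proof.
move=> mU UV; apply: le_integrable => //; first exact/measurable_EFinP.
by move=> w _ /=; rewrite lee_fin (le_trans (UV w))// ler_norm.
Qed.

Lemma rint_cst c : rint (cst c).
Proof. exact: finite_measure_integrable_cst. Qed.

Lemma rintD U V : rint U -> rint V -> rint (fun w => U w + V w).
Proof. by move=> iU iV; have := integrableD measurableT iU iV; apply: eq_integrable. Qed.

Lemma rintZ c U : rint U -> rint (fun w => c * U w).
Proof. by move=> iU; have := integrableZl measurableT c iU; apply: eq_integrable. Qed.

Lemma rintN U : rint U -> rint (fun w => - U w).
Proof. by move=> /(rintZ (-1)); congr rint; apply/funext => w; rewrite mulN1r. Qed.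

Lemma rintB U V : rint U -> rint V -> rint (fun w => U w - V w).
Proof. by move=> iU iV; apply: rintD => //; exact: rintN. Qed.

Lemma rint_sum (I : Type) (s : seq I) (h : I -> Omega -> R) :
  (forall i, rint (h i)) -> rint (fun w => \sum_(i <- s) h i w).
Proof.
move=> ih; elim: s => [|i s IH].
  have := rint_cst 0; congr rint; apply/funext => w; by rewrite big_nil.
by have := rintD (ih i) IH; congr rint; apply/funext => w; rewrite big_cons.
Qed.

(** [fine] turns an infinite integral into 0, hence the assumption [rint] in the rules of
    linearity. *)
Definition mean U : R := fine (\int[P]_w (U w)%:E).

Lemma meanE U : rint U -> (\int[P]_w (U w)%:E = (mean U)%:E)%E.
Proof. by move=> iU; rewrite /mean fineK//; exact: (integrable_fin_num measurableT iU). Qed.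

Lemma mean_cst c : mean (cst c) = c.
Proof.
by have := expectation_cst P c; rewrite unlock /mean => ->.
Qed.

Lemma meanD U V : rint U -> rint V -> mean (fun w => U w + V w) = mean U + mean V.
Proof.
move=> iU iV; apply: EFin_inj; rewrite -meanE ?EFinD -?meanE//; last exact: rintD.
by rewrite -integralD_EFin.
Qed.

Lemma meanZ c U : rint U -> mean (fun w => c * U w) = c * mean U.
Proof.
move=> iU; apply: EFin_inj; rewrite -meanE ?EFinM -?meanE//; last exact: rintZ.
by rewrite -integralZl.
Qed.

Lemma meanN U : rint U -> mean (fun w => - U w) = - mean U.
Proof.
move=> iU; rewrite -mulN1r -meanZ//; congr mean; apply/funext => w.
by rewrite mulN1r.
Qed.

Lemma meanB U V : rint U -> rint V -> mean (fun w => U w - V w) = mean U - mean V.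
Proof. by move=> iU iV; rewrite meanD ?meanN//; exact: rintN. Qed.

Lemma mean_sum (I : Type) (s : seq I) (h : I -> Omega -> R) :
  (forall i, rint (h i)) -> mean (fun w => \sum_(i <- s) h i w) = \sum_(i <- s) mean (h i).
Proof.
move=> ih; elim: s => [|i s IH].
  rewrite big_nil -[RHS]mean_cst; congr mean; apply/funext => w; by rewrite big_nil.
rewrite big_cons -IH -meanD//; last exact: rint_sum.
by congr mean; apply/funext => w; rewrite big_cons.
Qed.

Lemma le_mean U V : rint U -> rint V -> (forall w, U w <= V w) -> mean U <= mean V.
Proof.
move=> iU iV UV; rewrite -lee_fin -!meanE//; apply: le_integral => // w _.
by rewrite lee_fin.
Qed.

Lemma mean_ge0 U : (forall w, 0 <= U w) -> 0 <= mean U.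
Proof. by move=> U0; rewrite fine_ge0// integral_ge0// => w _; rewrite lee_fin. Qed.

End RealIntegrable.

Section SquareIntegrable.
Context {R : realType} {d : measure_display} {Omega : measurableType d}.
Variable P : probability Omega R.

Definition sub_sigma (F : set_system Omega) :=
  sigma_algebra [set: Omega] F /\ F `<=` d.-measurable.

(** [F] restricts measurability only; integrability refers to the whole space. One predicate thus
    expresses both finite second moments and being a function of the history. *)
Definition L2 (F : set_system Omega) {p : nat} (V : Omega -> 'rV[R]_p) :=
  forall i, meas_wrt F (fun w => V w 0 i) /\ rint P (fun w => V w 0 i ^+ 2).

Lemma sub_sigmaT : sub_sigma d.-measurable.
Proof. by split => //; exact: sigma_algebra_measurable. Qed.

Lemma L2_sub (F F' : set_system Omega) p (V : Omega -> 'rV[R]_p) :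
  F `<=` F' -> L2 F V -> L2 F' V.
Proof.
by move=> FF' hV i; have [mV iV] := hV i; split => // B mB; apply: FF'; exact: mV.
Qed.

Section WithRespectTo.
Variable F : set_system Omega.
Hypothesis sF : sub_sigma F.

Lemma L2_cst p (v : 'rV[R]_p) : L2 F (cst v).
Proof.
by move=> i; split; [exact: (meas_wrt_cst sF.1 (v 0 i))|exact: (rint_cst P (v 0 i ^+ 2))].
Qed.

Lemma L2D p (U V : Omega -> 'rV[R]_p) : L2 F U -> L2 F V -> L2 F (fun w => U w + V w).
Proof.
move=> hU hV i; have [mU iU] := hU i; have [mV iV] := hV i.
have m : meas_wrt F (fun w => (U w + V w) 0 i).
  have := meas_wrtD sF.1 mU mV; congr meas_wrt; apply/funext => w; by rewrite mxE.
split=> //; apply: rint_le (rintD (rintZ 2 iU) (rintZ 2 iV)).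
  by apply: measurable_funX; exact: meas_wrt_measurable sF.2 _ m.
move=> w; rewrite ger0_norm ?sqr_ge0// mxE.
by have := sqr_ge0 (U w 0 i - V w 0 i); lra.
Qed.

Lemma L2Z p c (U : Omega -> 'rV[R]_p) : L2 F U -> L2 F (fun w => c *: U w).
Proof.
move=> hU i; have [mU iU] := hU i; split.
  have := meas_wrtM sF.1 (meas_wrt_cst sF.1 c) mU; congr meas_wrt; apply/funext => w.
  by rewrite mxE.
have := rintZ (c ^+ 2) iU; congr rint; apply/funext => w; by rewrite mxE exprMn.
Qed.

Lemma L2B p (U V : Omega -> 'rV[R]_p) : L2 F U -> L2 F V -> L2 F (fun w => U w - V w).
Proof.
move=> hU /(L2Z (-1)) /(L2D hU); congr L2; apply/funext => w; by rewrite scaleN1r.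
Qed.

Lemma L2_sum p (I : Type) (s : seq I) (h : I -> Omega -> 'rV[R]_p) :
  (forall i, L2 F (h i)) -> L2 F (fun w => \sum_(i <- s) h i w).
Proof.
move=> ih; elim: s => [|i s IH].
  have := @L2_cst p 0; congr L2; apply/funext => w; by rewrite big_nil.
by have := L2D (ih i) IH; congr L2; apply/funext => w; rewrite big_cons.
Qed.

Lemma L2_row n m (U : Omega -> 'rV[R]_n) (V : Omega -> 'rV[R]_m) :
  L2 F U -> L2 F V -> L2 F (fun w => row_mx (U w) (V w)).
Proof.
move=> hU hV i; rewrite -(fintype.splitK i); case: (fintype.split i) => j /=.
  by have [a b] := hU j; split; [move: a; congr meas_wrt|move: b; congr rint];
    apply/funext => w; rewrite row_mxEl.
by have [a b] := hV j; split; [move: a; congr meas_wrt|move: b; congr rint];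
  apply/funext => w; rewrite row_mxEr.
Qed.

Lemma rint_enorm2 p (U : Omega -> 'rV[R]_p) : L2 F U -> rint P (fun w => enorm (U w) ^+ 2).
Proof.
move=> hU; have := @rint_sum _ _ _ P _ (index_enum 'I_p) _ (fun i => (hU i).2).
by congr rint; apply/funext => w; rewrite enorm2E; apply: eq_bigr => i _; rewrite expr2.
Qed.

(** Measurability is [meas_wrt_lip]; the second moment is finite because a Lipschitz map has at most
    affine growth. *)
Lemma L2_lip p q (D : set 'rV[R]_p) (h : 'rV[R]_p -> 'rV[R]_q) (K : R)
    (V : Omega -> 'rV[R]_p) :
  (forall z z', D z -> D z' -> enorm (h z - h z') <= K * enorm (z - z')) ->
  (forall w, D (V w)) -> L2 F V -> L2 F (fun w => h (V w)).
Proof.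
move=> hK DV hV i.
have m : meas_wrt F (fun w => h (V w) 0 i).
  apply: (@meas_wrt_lip _ _ _ _ sF.1 p D (fun z => h z 0 i) K V) => //.
    move=> z z' Dz Dz'; apply: le_trans (hK _ _ Dz Dz').
    by have := ler_abs_enorm (h z - h z') i; rewrite !mxE.
  by move=> j; exact: (hV j).1.
split=> //.
(* Any value of [V] serves as base point of the growth bound; this one lies in [D]. *)
pose v := V point.
have iV := rint_enorm2 (L2B hV (L2_cst v)).
apply: rint_le (rintD (rint_cst P (2 * enorm (h v) ^+ 2)) (rintZ (2 * K ^+ 2) iV)).
  by apply: measurable_funX; exact: meas_wrt_measurable sF.2 _ m.
move=> w /=; rewrite ger0_norm ?sqr_ge0//.
apply: (@le_trans _ _ (enorm (h (V w)) ^+ 2)).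
  rewrite -real_normK ?num_real// lerXn2r ?nnegrE ?enorm_ge0//; exact: ler_abs_enorm.
rewrite -[h (V w)](subrK (h v)) addrC (le_trans (enormD2_le _ _))// lerD2l.
have h1 := hK _ _ (DV w) (DV point).
rewrite -mulrA ler_pM2l// -exprMn; apply: lerXn2r => //; rewrite nnegrE ?enorm_ge0//.
exact: le_trans (enorm_ge0 _) h1.
Qed.

Lemma L2_lip2 n m q (D1 : set 'rV[R]_n) (D2 : set 'rV[R]_m)
    (h : 'rV[R]_n -> 'rV[R]_m -> 'rV[R]_q) (K1 K2 : R)
    (U : Omega -> 'rV[R]_n) (V : Omega -> 'rV[R]_m) : 0 <= K1 -> 0 <= K2 ->
  (forall x x' y y', D1 x -> D1 x' -> D2 y -> D2 y' ->
    enorm (h x y - h x' y') <= K1 * enorm (x - x') + K2 * enorm (y - y')) ->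
  (forall w, D1 (U w)) -> (forall w, D2 (V w)) -> L2 F U -> L2 F V ->
  L2 F (fun w => h (U w) (V w)).
Proof.
move=> K10 K20 hK DU DV hU hV.
have := @L2_lip (n + m) q [set z | D1 (lsubmx z) /\ D2 (rsubmx z)]
  (fun z => h (lsubmx z) (rsubmx z)) (K1 + K2) _ _ _ (L2_row hU hV).
have -> : (fun w => h (lsubmx (row_mx (U w) (V w))) (rsubmx (row_mx (U w) (V w)))) =
    (fun w => h (U w) (V w)) by apply/funext => w; rewrite row_mxKl row_mxKr.
apply; last by move=> w /=; rewrite row_mxKl row_mxKr.
move=> z z' [d1 d2] [d1' d2']; rewrite (le_trans (hK _ _ _ _ d1 d1' d2 d2'))// mulrDl.
have E : enorm (z - z') ^+ 2 = enorm (lsubmx z - lsubmx z') ^+ 2 + enorm (rsubmx z - rsubmx z') ^+ 2.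
  rewrite -enorm2_row_mx; congr (enorm _ ^+ 2).
  by rewrite -[LHS]hsubmxK; congr row_mx; apply/rowP => i; rewrite !mxE.
rewrite lerD// ler_wpM2l// -(@ler_pXn2r _ 2) ?nnegrE ?enorm_ge0// E.
  by rewrite lerDl sqr_ge0.
by rewrite lerDr sqr_ge0.
Qed.

End WithRespectTo.

Lemma rint_mul (U V : Omega -> R) :
  measurable_fun [set: Omega] U -> measurable_fun [set: Omega] V ->
  rint P (fun w => U w ^+ 2) -> rint P (fun w => V w ^+ 2) ->
  rint P (fun w => U w * V w).
Proof.
move=> mU mV iU iV; apply: rint_le (rintD iU iV); first exact: measurable_funM.
move=> w; rewrite normrM -(real_normK (num_real (U w))) -(real_normK (num_real (V w))).
have := sqr_ge0 (`|U w| - `|V w|); have := mulr_ge0 (normr_ge0 (U w)) (normr_ge0 (V w)).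
lra.
Qed.

Lemma rint_sqr (U : Omega -> R) : measurable_fun [set: Omega] U ->
  rint P (fun w => U w ^+ 2) -> rint P U.
Proof.
move=> mU iU; apply: rint_le (rintD iU (rint_cst P 1)) => // w /=.
have := sqr_ge0 (`|U w| - 1); have := normr_ge0 (U w).
by rewrite -(real_normK (num_real (U w))); lra.
Qed.

Lemma rint_dotp F F' p (U V : Omega -> 'rV[R]_p) : sub_sigma F -> sub_sigma F' ->
  L2 F U -> L2 F' V -> rint P (fun w => dotp (U w) (V w)).
Proof.
move=> sF sF' hU hV; apply: rint_sum => i; have [mU iU] := hU i; have [mV iV] := hV i.
by apply: rint_mul => //; [exact: meas_wrt_measurable sF.2 _ mU|exact: meas_wrt_measurable sF'.2 _ mV].
Qed.

(** [W] equals a version of the conditional expectation only almost everywhere; its own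
    measurability allows the exchange under the integral over [A]. *)
Lemma cond_exp_eq_centered (F : set_system Omega) (V W : Omega -> R) : sub_sigma F ->
  cond_exp_eq P F V W -> meas_wrt F W -> rint P (fun w => V w - W w) ->
  forall A, F A -> (\int[P]_(w in A) (V w - W w)%:E = 0)%E.
Proof.
move=> sF [Z [_ iV mZ ZV] ZW] mW iVW A FA.
have mA : measurable A by exact: sF.2.
have iW : rint P W.
  have := rintB iV iVW; congr rint; apply/funext => w; ring.
have sub U : rint P U -> P.-integrable A (EFin \o U).
  by move=> iU; apply: (@integrableS _ _ _ _ setT).
rewrite (_ : (\int[P]_(w in A) _ = \int[P]_(w in A) ((V w)%:E - (W w)%:E))%E)//.
rewrite integralB_EFin//; [|exact: sub..].
rewrite -ZV// (@ae_eq_integral _ _ _ _ _ (EFin \o W) (EFin \o Z))//.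
- rewrite subee//; exact: (integrable_fin_num mA (sub _ iW)).
- apply/measurable_EFinP; apply: measurable_funTS.
  by apply: meas_wrt_measurable sF.2 _ mZ.
- apply/measurable_EFinP; apply: measurable_funTS.
  by apply: meas_wrt_measurable sF.2 _ mW.
- by apply: filterS ZW => w /= -> _.
Qed.

(** The whole space belongs to [F], so the mean is that of the version [Z], which is bounded through
    its positive part. *)
Lemma cond_exp_le_mean (F : set_system Omega) (V : Omega -> R) (c : R) : sub_sigma F -> 0 <= c ->
  cond_exp_le P F V c -> rint P V /\ mean P V <= c.
Proof.
move=> sF c0 [Z [_ iV mZ ZV] Zc]; split => //.
have FT : F [set: Omega] by have [F0 FC _] := sF.1; rewrite -(setD0 setT); exact: FC.
rewrite -lee_fin -meanE// -(ZV _ FT) integralE.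
have mZ' : measurable_fun [set: Omega] Z by apply: meas_wrt_measurable sF.2 _ mZ.
apply: (@le_trans _ _ (\int[P]_w ((fun w => (Z w)%:E)^\+ w))%E).
  by apply: geeDl; rewrite oppe_le0 integral_ge0.
have -> : c%:E = (\int[P]_w (cst c w)%:E)%E by rewrite meanE ?mean_cst//; exact: rint_cst.
apply: ae_ge0_le_integral => //.
- by apply: measurable_funepos; exact/measurable_EFinP.
- by apply/measurable_EFinP; exact: measurable_cst.
- by apply: filterS Zc => w Zwc _; rewrite funeposE ge_max !lee_fin Zwc.
Qed.

End SquareIntegrable.

(** * One SAPD run in expectation, for abstract histories [hx] and [hy] *)

Section ExpectedSAPD.
Context {R : realType} {d : measure_display} {Omega : measurableType d}.
Variable P : probability Omega R.

Definition centered_wrt (F : set_system Omega) {p : nat} (e : Omega -> 'rV[R]_p) :=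
  forall i A, F A -> (\int[P]_(w in A) (e w 0 i)%:E = 0)%E.

Lemma mean_dotp_centered (F : set_system Omega) (p : nat) (e U : Omega -> 'rV[R]_p) :
  sub_sigma F -> L2 P d.-measurable e -> centered_wrt F e -> L2 P F U ->
  mean P (fun w => dotp (e w) (U w)) = 0.
Proof.
move=> sF he ce hU.
have me i : measurable_fun [set: Omega] (fun w => e w 0 i).
  by apply: (meas_wrt_measurable (F := d.-measurable)) => //; exact: (he i).1.
have mU i : measurable_fun [set: Omega] (fun w => U w 0 i).
  by apply: (meas_wrt_measurable sF.2); exact: (hU i).1.
have ie i : rint P (fun w => e w 0 i * U w 0 i).
  by apply: rint_mul => //; [exact: (he i).2|exact: (hU i).2].
rewrite /dotp mean_sum// big1// => i _.
rewrite /mean (@centered_orthogonal _ _ _ P F sF.1 sF.2 (fun w => e w 0 i)) //.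
- by apply: rint_sqr => //; exact: (he i).2.
- exact: ce.
- exact: (hU i).1.
- exact: ie.
Qed.

Context {n m : nat}.
Variables (f : 'rV[R]_n -> \bar R) (g : 'rV[R]_m -> \bar R).
Variable Phi : 'rV[R]_n -> 'rV[R]_m -> R.
Variables (gamma mu Lxx Lxy Lyx Lyy tau sigma : R).
Hypothesis H : saddle_setting f g Phi gamma mu Lxx Lxy Lyx Lyy.
Variables (sx : 'rV[R]_n -> 'rV[R]_n) (sy : 'rV[R]_n -> 'rV[R]_m).
Hypothesis Hs : forall c, is_saddle f g Phi gamma mu c (sx c) (sy c).
Hypotheses (tau0 : 0 < tau) (sigma0 : 0 < sigma).

Section Closure.
Variable F : set_system Omega.
Hypothesis sF : sub_sigma F.

Lemma L2_prox_f U : L2 P F U -> L2 P F (fun w => prox tau f (U w)).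
Proof.
apply: (@L2_lip _ _ _ P _ sF _ _ setT _ 1) => // u v _ _.
by rewrite mul1r; exact: (prox_lip (set_f_prox H)).
Qed.

Lemma L2_prox_g U : L2 P F U -> L2 P F (fun w => prox sigma g (U w)).
Proof.
apply: (@L2_lip _ _ _ P _ sF _ _ setT _ 1) => // u v _ _.
by rewrite mul1r; exact: (prox_lip (set_g_prox H)).
Qed.

Lemma L2_sx U : L2 P F U -> L2 P F (fun w => sx (U w)).
Proof.
by apply: (@L2_lip _ _ _ P _ sF _ _ setT _ 2) => // u v _ _; exact: (sx_lip H Hs).
Qed.

Lemma L2_sy U : L2 P F U -> L2 P F (fun w => sy (U w)).
Proof.
have g0 := set_gamma_gt0 H; have m0 := set_mu_gt0 H.
apply: (@L2_lip _ _ _ P _ sF _ _ setT _ (Num.sqrt (gamma / mu))) => // u v _ _.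
rewrite -(@ler_pXn2r _ 2) ?nnegrE ?mulr_ge0 ?sqrtr_ge0 ?enorm_ge0// exprMn.
rewrite (sqr_sqrtr (ltW (divr_gt0 g0 m0))) mulrAC ler_pdivlMr// mulrC.
exact: (sy_lip H Hs).
Qed.

Lemma L2_grad_x U V : (forall w, edom f (U w)) -> (forall w, edom g (V w)) ->
  L2 P F U -> L2 P F V -> L2 P F (fun w => grad_x Phi (U w) (V w)).
Proof.
apply: (@L2_lip2 _ _ _ P _ sF _ _ _ _ _ _ Lxx Lxy).
- exact: set_Lxx_ge0 H.
- exact: ltW (set_Lxy_gt0 H).
- exact: set_grad_x_lip H.
Qed.

Lemma L2_grad_y U V : (forall w, edom f (U w)) -> (forall w, edom g (V w)) ->
  L2 P F U -> L2 P F V -> L2 P F (fun w => grad_y Phi (U w) (V w)).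
Proof.
apply: (@L2_lip2 _ _ _ P _ sF _ _ _ _ _ _ Lyx Lyy).
- exact: ltW (set_Lyx_gt0 H).
- exact: set_Lyy_ge0 H.
- exact: set_grad_y_lip H.
Qed.

End Closure.

Hypotheses (tauL : tau * (Lyx + Lxx + 2 * gamma) <= 1) (tauLxy : tau * Lxy <= 1).
Hypothesis sigmaL : sigma * (Lyx + 2 * Lyy) <= 1.
Variables (x gx : nat -> Omega -> 'rV[R]_n) (y gy q : nat -> Omega -> 'rV[R]_m).
Hypothesis y_step : forall w k,
  y k.+1 w = prox sigma g (y k w + sigma *: (gy k w + q k w)).
Hypothesis x_step : forall w k,
  x k.+1 w = prox tau f (x k w - tau *: (gx k w + (2 * gamma) *: (x k w - x 0%N w))).
Hypotheses (q_0 : forall w, q 0%N w = 0) (q_S : forall w k, q k.+1 w = gy k.+1 w - gy k w).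
Hypotheses (fx : forall w k, edom f (x k w)) (gyd : forall w k, edom g (y k w)).
Variables (N : nat) (hx hy : nat -> set_system Omega) (deltax deltay : R).
Hypothesis N0 : (0 < N)%N.
Hypotheses (sub_hx : forall k, (k < N)%N -> sub_sigma (hx k))
           (sub_hy : forall k, (k < N)%N -> sub_sigma (hy k)).
Hypothesis hist_x_L2 : forall k, (k < N)%N ->
  [/\ L2 P (hx k) (x 0%N), L2 P (hx k) (x k) & L2 P (hx k) (y k.+1)].
Hypothesis hist_y_L2 : forall k, (k < N)%N ->
  [/\ L2 P (hy k) (x 0%N), L2 P (hy k) (x k), L2 P (hy k) (y k) &
      forall j, (j < k)%N -> L2 P (hy k) (gy j)].
Let ex k w := err_x Phi (x^~ w) (gx^~ w) (y^~ w) k.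
Let ey k w := err_y Phi (x^~ w) (y^~ w) (gy^~ w) k.
Hypotheses (x_L2 : forall k, (k <= N)%N -> L2 P d.-measurable (x k))
  (y_L2 : forall k, (k <= N)%N -> L2 P d.-measurable (y k))
  (gx_L2 : forall k, (k < N)%N -> L2 P d.-measurable (gx k))
  (gy_L2 : forall k, (k < N)%N -> L2 P d.-measurable (gy k)).
Hypotheses (ex_centered : forall k, (k < N)%N -> centered_wrt (hx k) (ex k))
  (ey_centered : forall k, (k < N)%N -> centered_wrt (hy k) (ey k)).
Hypotheses
  (ex_var : forall k, (k < N)%N -> mean P (fun w => enorm (ex k w) ^+ 2) <= deltax ^+ 2)
  (ey_var : forall k, (k < N)%N -> mean P (fun w => enorm (ey k w) ^+ 2) <= deltay ^+ 2).

Let X w := sx (x 0%N w).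
Let Y w := sy (x 0%N w).

Let sT := @sub_sigmaT _ Omega.

Let ex_L2 k : (k < N)%N -> L2 P d.-measurable (ex k).
Proof.
move=> kN; apply: (L2B sT (gx_L2 kN)); apply: (L2_grad_x sT) => //.
  exact: x_L2 (ltnW kN).
exact: y_L2.
Qed.

Let ey_L2 k : (k < N)%N -> L2 P d.-measurable (ey k).
Proof.
move=> kN; apply: (L2B sT (gy_L2 kN)); apply: (L2_grad_y sT) => //.
  exact: x_L2 (ltnW kN).
exact: y_L2 (ltnW kN).
Qed.

Let xbar k w := sapd_xbar f Phi gamma tau (x^~ w) (y^~ w) k.
Let ybar k w := sapd_ybar g Phi sigma (x^~ w) (y^~ w) (gy^~ w) k.
Let xhat k w := sapd_xhat f g Phi gamma tau sigma (x^~ w) (y^~ w) (gy^~ w) k.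
Let yhat k w := sapd_yhat f g Phi gamma tau sigma (x^~ w) (y^~ w) (gy^~ w) k.

Let xbar_L2 k : (k < N)%N -> L2 P (hx k) (xbar k).
Proof.
move=> kN; have sF := sub_hx kN; have [x0 xk yk] := hist_x_L2 kN.
apply: (L2_prox_f sF); apply: (L2B sF) => //; apply: (L2Z sF); apply: (L2D sF).
  exact: (L2_grad_x sF).
by apply: (L2Z sF); exact: (L2B sF).
Qed.

Let ybar_dom k w : edom g (ybar k w).
Proof. exact: (set_g_prox H _ sigma0).1. Qed.

Let ybar_L2 k : (k < N)%N -> L2 P (hy k) (ybar k).
Proof.
move=> kN; have sF := sub_hy kN; have [x0 xk yk gj] := hist_y_L2 kN.
apply: (L2_prox_g sF); apply: (L2D sF) => //; apply: (L2Z sF).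
have gk : L2 P (hy k) (fun w => grad_y Phi (x k w) (y k w)) by exact: (L2_grad_y sF).
case: k kN sF x0 xk yk gj gk => [//|k] kN sF x0 xk yk gj gk.
by apply: (L2B sF); [exact: (L2Z sF)|exact: gj].
Qed.

Let xhat_L2 k : (k < N)%N -> L2 P (hy k) (xhat k).
Proof.
move=> kN; have sF := sub_hy kN; have [x0 xk yk gj] := hist_y_L2 kN.
apply: (L2_prox_f sF); apply: (L2B sF) => //; apply: (L2Z sF); apply: (L2D sF).
  by apply: (L2_grad_x sF) => //; [exact: ybar_dom|exact: ybar_L2].
by apply: (L2Z sF); exact: (L2B sF).
Qed.

(** The point of [sapd_yhat]: although it stands for the iterate two steps ahead, it is a function
    of the history before the [y]-estimate of step [k]. *)
Let yhat_L2 k : (k < N)%N -> L2 P (hy k) (yhat k).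
Proof.
move=> kN; have sF := sub_hy kN; have [x0 xk yk gj] := hist_y_L2 kN.
apply: (L2_prox_g sF); apply: (L2D sF); first exact: ybar_L2.
apply: (L2Z sF); apply: (L2B sF).
  apply: (L2Z sF); apply: (L2_grad_y sF).
  - by move=> w; exact: (set_f_prox H _ tau0).1.
  - exact: ybar_dom.
  - exact: xhat_L2.
  - exact: ybar_L2.
exact: (L2_grad_y sF).
Qed.

Let marting k w := sapd_martingale f g Phi gamma tau sigma (x^~ w) (gx^~ w) (y^~ w) (gy^~ w)
  (X w) (Y w) k.

Let marting_mean k : (k < N)%N -> rint P (marting k) /\ mean P (marting k) = 0.
Proof.
move=> kN; have sx' := sub_hx kN; have sy' := sub_hy kN.
have [x0 _ _] := hist_x_L2 kN; have [x0' _ _ _] := hist_y_L2 kN.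
have LX : L2 P (hx k) (fun w => xbar k w - X w).
  by apply: (L2B sx'); [exact: xbar_L2|exact: L2_sx].
have LY : L2 P (hy k) (fun w => ybar k w - Y w).
  by apply: (L2B sy'); [exact: ybar_L2|exact: L2_sy].
have iX := rint_dotp sT sx' (ex_L2 kN) LX.
have iY := rint_dotp sT sy' (ey_L2 kN) LY.
have mX := mean_dotp_centered sx' (ex_L2 kN) (ex_centered kN) LX.
have mY := mean_dotp_centered sy' (ey_L2 kN) (ey_centered kN) LY.
rewrite /marting /sapd_martingale; case: k kN => [|j] kN in sx' sy' x0 x0' LX LY iX iY mX mY *.
  split; first exact: rintD (rintN iX) iY.
  by apply: (etrans (meanD (rintN iX) iY));
    rewrite (congr2 +%R (etrans (meanN iX) (congr1 -%R mX)) mY) oppr0 addr0.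
(* The previous error is conditioned on its own, earlier history [hy j]; it is known in [hy j.+1]
   and not centered there. *)
have jN : (j < N)%N by exact: ltnW.
have sj := sub_hy jN; have [x0j _ _ _] := hist_y_L2 jN.
have LYj : L2 P (hy j) (fun w => yhat j w - Y w).
  by apply: (L2B sj); [exact: yhat_L2|exact: L2_sy].
have iYj := rint_dotp sT sj (ey_L2 jN) LYj.
have mYj := mean_dotp_centered sj (ey_L2 jN) (ey_centered jN) LYj.
have i2 := rintB (rintZ 2 iY) iYj.
split; first exact: rintD (rintN iX) i2.
have e1 := etrans (meanN iX) (congr1 -%R mX).
have e2 := etrans (meanZ 2 iY) (congr1 ( *%R 2) mY).
have e3 := etrans (meanB (rintZ 2 iY) iYj) (congr2 (fun a b => a - b) e2 mYj).
apply: (etrans (meanD (rintN iX) i2)); apply: (etrans (congr2 +%R e1 e3)).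
by rewrite mulr0 subr0 oppr0 addr0.
Qed.

Let noise k w := sapd_noise Phi (x^~ w) (gx^~ w) (y^~ w) (gy^~ w) (X w) (Y w) k.

Let noise_bound k w := marting k w
  + tau * enorm (ex k w) ^+ 2 + 5 * sigma * enorm (ey k w) ^+ 2
  + (if k is j.+1 then tau * enorm (ex j w) ^+ 2 + 9 * sigma * enorm (ey j w) ^+ 2 else 0).

Let noise_bound_mean k : (k < N)%N -> rint P (noise_bound k) /\
  mean P (noise_bound k) <= 2 * tau * deltax ^+ 2 + 14 * sigma * deltay ^+ 2.
Proof.
move=> kN.
have arith1 (t s a b u v : R) : 0 <= t * u -> 0 <= s * v -> t * a <= t * u ->
    s * b <= s * v -> 0 + t * a + 5 * s * b + 0 <= 2 * t * u + 14 * s * v by lra.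
have arith2 (t s a b c e u v : R) : 0 <= t * u -> 0 <= s * v -> t * a <= t * u ->
    s * b <= s * v -> t * c <= t * u -> s * e <= s * v ->
    0 + t * a + 5 * s * b + (t * c + 9 * s * e) <= 2 * t * u + 14 * s * v by lra.
have [iM mM] := marting_mean kN.
have iex j (jN : (j < N)%N) := rint_enorm2 (ex_L2 jN).
have iey j (jN : (j < N)%N) := rint_enorm2 (ey_L2 jN).
have tv j (jN : (j < N)%N) := ler_wpM2l (ltW tau0) (ex_var jN).
have sv j (jN : (j < N)%N) := ler_wpM2l (ltW sigma0) (ey_var jN).
have j1 := rintZ tau (iex _ kN); have j2 := rintZ (5 * sigma) (iey _ kN).
have i1 := rintD iM j1; have i2 := rintD i1 j2.
have e2 := etrans (meanD i1 j2) (congr2 +%R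
  (etrans (meanD iM j1) (congr2 +%R mM (meanZ tau (iex _ kN)))) (meanZ (5 * sigma) (iey _ kN))).
have tk := tv _ kN; have sk := sv _ kN.
have p1 := mulr_ge0 (ltW tau0) (sqr_ge0 deltax).
have p2 := mulr_ge0 (ltW sigma0) (sqr_ge0 deltay).
rewrite /noise_bound; case: k kN => [|j] kN in iM mM i1 i2 e2 j1 j2 tk sk *.
  split; first exact: rintD i2 (rint_cst P 0).
  have E := etrans (meanD i2 (rint_cst P 0)) (congr2 +%R e2 (mean_cst P 0)).
  apply: (@eq_ind_r _ _ (fun z => z <= _) _ _ E).
  exact: arith1 p1 p2 tk sk.
have jN : (j < N)%N by exact: ltnW.
have k1 := rintZ tau (iex _ jN); have k2 := rintZ (9 * sigma) (iey _ jN).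
split; first exact: rintD i2 (rintD k1 k2).
have E := etrans (meanD i2 (rintD k1 k2)) (congr2 +%R e2 (etrans (meanD k1 k2)
  (congr2 +%R (meanZ tau (iex _ jN)) (meanZ (9 * sigma) (iey _ jN))))).
apply: (@eq_ind_r _ _ (fun z => z <= _) _ _ E).
exact: arith2 p1 p2 tk sk (tv _ jN) (sv _ jN).
Qed.

Let XY w : is_saddle f g Phi gamma mu (x 0%N w) (X w) (Y w). Proof. exact: Hs. Qed.

(** [sapd_sum] and [sapd_noise_le] are divided by N and doubled, since the distances there carry the
    factor 1/2; [enorm_mean_le] passes to the averages. *)
Lemma sapd_mean :
  mean P (fun w => gamma * enorm (N%:R^-1 *: \sum_(k < N) x k.+1 w - X w) ^+ 2
    + mu * enorm (N%:R^-1 *: \sum_(k < N) y k.+1 w - Y w) ^+ 2) <=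
  (N%:R * tau)^-1 * mean P (fun w => enorm (x 0%N w - X w) ^+ 2)
  + (N%:R * sigma)^-1 * mean P (fun w => enorm (y 0%N w - Y w) ^+ 2)
  + 2 * (2 * tau * deltax ^+ 2 + 14 * sigma * deltay ^+ 2).
Proof.
have NR : (0 : R) < N%:R by rewrite ltr0n.
have g0 := set_gamma_gt0 H; have m0 := set_mu_gt0 H.
have x0L : L2 P d.-measurable (x 0%N) by exact: x_L2.
have XL : L2 P d.-measurable X by exact: L2_sx.
have YL : L2 P d.-measurable Y by exact: L2_sy.
have iX0 := rint_enorm2 (L2B sT x0L XL).
have iY0 := rint_enorm2 (L2B sT (y_L2 (leq0n N)) YL).
have sumL p (z : nat -> Omega -> 'rV[R]_p) : (forall k, (k <= N)%N -> L2 P d.-measurable (z k)) ->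
    L2 P d.-measurable (fun w => N%:R^-1 *: \sum_(k < N) z k.+1 w).
  by move=> zL; apply: (L2Z sT); apply: (L2_sum sT) => k; exact: zL.
have ixb := rint_enorm2 (L2B sT (sumL _ _ x_L2) XL).
have iyb := rint_enorm2 (L2B sT (sumL _ _ y_L2) YL).
have iB : rint P (fun w => \sum_(k < N) noise_bound k w).
  by apply: rint_sum => k; exact: (noise_bound_mean (ltn_ord k)).1.
have h w : gamma * enorm (N%:R^-1 *: \sum_(k < N) x k.+1 w - X w) ^+ 2
    + mu * enorm (N%:R^-1 *: \sum_(k < N) y k.+1 w - Y w) ^+ 2 <=
    (N%:R * tau)^-1 * enorm (x 0%N w - X w) ^+ 2
    + (N%:R * sigma)^-1 * enorm (y 0%N w - Y w) ^+ 2
    + 2 * N%:R^-1 * \sum_(k < N) noise_bound k w.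
  have h1 := @sapd_sum _ _ _ f g Phi gamma mu Lxx Lxy Lyx Lyy tau sigma H tau0 sigma0 tauL sigmaL
    (x^~ w) (gx^~ w) (y^~ w) (gy^~ w) (q^~ w) (y_step w) (x_step w) (q_0 w) (q_S w)
    (fx w) (gyd w) (X w) (Y w) (XY w) N.
  have h2 : \sum_(k < N) noise k w <= \sum_(k < N) noise_bound k w.
    apply: ler_sum => k _.
    exact: (@sapd_noise_le _ _ _ f g Phi gamma mu Lxx Lxy Lyx Lyy tau sigma H tau0 sigma0
      tauL tauLxy sigmaL (x^~ w) (gx^~ w) (y^~ w) (gy^~ w) (q^~ w) (y_step w) (x_step w) (q_0 w)
      (q_S w) (fx w) (gyd w) (X w) (Y w) k).
  have h3 := ler_wpM2l (ltW g0) (enorm_mean_le (fun k => x k.+1 w) (X w) N0).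
  have h4 := ler_wpM2l (ltW m0) (enorm_mean_le (fun k => y k.+1 w) (Y w) N0).
  move: h1; rewrite big_split/= -!mulr_sumr => h1.
  have Ni : (0 : R) < N%:R^-1 by rewrite invr_gt0.
  have h5 := ler_wpM2l (ltW Ni) (le_trans h1 (lerD (lexx _) h2)).
  have half (t : R) : 0 < t -> (N%:R * t)^-1 = 2 * (N%:R^-1 * (2 * t)^-1).
    by move=> t0; field; rewrite !gt_eqF.
  have arith (c e a' b' s1 s2 M t s a b S : R) : c * a' <= c * (M * s1) -> e * b' <= e * (M * s2) ->
      M * (c / 2 * s1 + e / 2 * s2) <= M * (t * a + s * b + S) ->
      c * a' + e * b' <= 2 * (M * t) * a + 2 * (M * s) * b + 2 * M * S by lra.
  by rewrite (half _ tau0) (half _ sigma0); exact: arith h3 h4 h5.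
have iL := rintD (rintZ gamma ixb) (rintZ mu iyb).
have iR1 := rintD (rintZ (N%:R * tau)^-1 iX0) (rintZ (N%:R * sigma)^-1 iY0).
have iR := rintD iR1 (rintZ (2 * N%:R^-1) iB).
apply: (le_trans (le_mean iL iR h)).
rewrite meanD ?meanZ//; last exact: rintZ.
rewrite meanD ?meanZ//; [|exact: rintZ..].
rewrite lerD2l -(mulrA 2 N%:R^-1) ler_pM2l// mean_sum; last by move=> k; exact: (noise_bound_mean (ltn_ord k)).1.
apply: (@le_trans _ _ (N%:R^-1 * \sum_(k < N) (2 * tau * deltax ^+ 2 + 14 * sigma * deltay ^+ 2))).
  rewrite ler_pM2l ?invr_gt0//; apply: ler_sum => k _; exact: (noise_bound_mean (ltn_ord k)).2.
by rewrite sumr_const card_ord -[(_ + _) *+ N]mulr_natl mulKf ?gt_eqF.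
Qed.

End ExpectedSAPD.

(** * The outer loop: integrability, histories and summation over calls *)

Section SAPDPlus.
Context {R : realType} {n m : nat} {S : Type}.
Context {d : measure_display} {Omega : measurableType d}.
Variable P : probability Omega R.
Variables (f : 'rV[R]_n -> \bar R) (g : 'rV[R]_m -> \bar R).
Variable Phi : 'rV[R]_n -> 'rV[R]_m -> R.
Variables (gamma mu Lxx Lxy Lyx Lyy tau sigma : R).
Hypothesis H : saddle_setting f g Phi gamma mu Lxx Lxy Lyx Lyy.
Variables (sx : 'rV[R]_n -> 'rV[R]_n) (sy : 'rV[R]_n -> 'rV[R]_m).
Hypothesis Hs : forall c, is_saddle f g Phi gamma mu c (sx c) (sy c).
Hypotheses (tau0 : 0 < tau) (sigma0 : 0 < sigma).
Variables (gX : 'rV[R]_n -> 'rV[R]_m -> S -> 'rV[R]_n)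
  (gY : 'rV[R]_n -> 'rV[R]_m -> S -> 'rV[R]_m).
Variables (wx wy : nat -> nat -> Omega -> S).
Variables (x00 : 'rV[R]_n) (y00 : 'rV[R]_m) (N : nat).
Hypotheses (fx00 : edom f x00) (gy00 : edom g y00) (N0 : (0 < N)%N).

Let plus := sapd_plus f g gX gY gamma tau sigma 1 gamma wx wy x00 y00 (fun=> N).
Let xs := iter_x f g gX gY gamma tau sigma 1 gamma wx wy x00 y00 (fun=> N).
Let ys := iter_y f g gX gY gamma tau sigma 1 gamma wx wy x00 y00 (fun=> N).
Let ex := est_x f g gX gY gamma tau sigma 1 gamma wx wy x00 y00 (fun=> N).
Let ey := est_y f g gX gY gamma tau sigma 1 gamma wx wy x00 y00 (fun=> N).
Let qs t k w := (sapd_state f g gX gY gamma tau sigma 1 gamma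
  (fun k => wx t k w) (fun k => wy t k w) (plus t w).1 (plus t w).2 k).2.

Let xs0 t w : xs t 0%N w = (plus t w).1. Proof. by []. Qed.
Let ys0 t w : ys t 0%N w = (plus t w).2. Proof. by []. Qed.

Let plusS1 t w : (plus t.+1 w).1 = N%:R^-1 *: \sum_(k < N) xs t k.+1 w.
Proof. by rewrite /plus /xs /iter_x /=; case: (sapd_plus _ _ _ _ _ _ _ _ _ _ _ _ _ _ t w). Qed.

Let plusS2 t w : (plus t.+1 w).2 = N%:R^-1 *: \sum_(k < N) ys t k.+1 w.
Proof. by rewrite /plus /ys /iter_y /=; case: (sapd_plus _ _ _ _ _ _ _ _ _ _ _ _ _ _ t w). Qed.

Let ys_step t w k : ys t k.+1 w = prox sigma g (ys t k w + sigma *: (ey t k w + qs t k w)).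
Proof.
rewrite /ys /ey /qs /est_y /iter_y /iter_x /plus /sapd_y /sapd_x /=.
by case: (sapd_state _ _ _ _ _ _ _ _ _ _ _ _ _ k) => [[x y] q] /=; rewrite scale1r.
Qed.

Let xs_step t w k : xs t k.+1 w =
  prox tau f (xs t k w - tau *: (ex t k w + (2 * gamma) *: (xs t k w - xs t 0%N w))).
Proof.
have := ys_step t w k.
rewrite /xs /ys /ex /ey /qs /est_x /est_y /iter_y /iter_x /plus /sapd_y /sapd_x /=.
case: (sapd_state _ _ _ _ _ _ _ _ _ _ _ _ _ k) => [[x y] q] /= _.
by rewrite mulr_natl mulr2n.
Qed.

Let qs0 t w : qs t 0%N w = 0. Proof. by []. Qed.

Let qsS t w k : qs t k.+1 w = ey t k.+1 w - ey t k w.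
Proof.
rewrite /ey /qs /est_y /iter_y /iter_x /plus /sapd_y /sapd_x /=.
by case: (sapd_state _ _ _ _ _ _ _ _ _ _ _ _ _ k) => [[x y] q].
Qed.

Let convex_mean p (C : set 'rV[R]_p) (z : nat -> 'rV[R]_p) M : (0 < M)%N ->
  (forall x w (t : R), C x -> C w -> 0 <= t <= 1 -> C (t *: x + (1 - t) *: w)) ->
  (forall k, C (z k)) -> C (M%:R^-1 *: \sum_(k < M) z k).
Proof.
move=> + convC Cz; elim: M => [//|[_ _|M IH _]].
  by rewrite big_ord1 invr1 scale1r.
have M0 : (0 : R) < M.+1%:R by rewrite ltr0n.
(* The last of M+2 points gets weight 1/(M+2), the mean of the others the rest. *)
rewrite big_ord_recr/=; have := convC _ _ (M.+2%:R^-1) (Cz M.+1) (IH isT).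
rewrite invr_ge0 ler0n/= invf_le1 ?ltr0n// ler1n => /(_ isT); congr C.
rewrite scalerDr addrC; congr (_ + _); rewrite scalerA; congr (_ *: _).
rewrite [M.+2%:R]mulrS; move: (M.+1%:R) M0 => c c0; field.
by apply/andP; split; rewrite gt_eqF// addr_gt0.
Qed.

Lemma xs_dom t w k : edom f (xs t k w).
Proof.
case: k => [|k]; last by rewrite xs_step; exact: (set_f_prox H _ tau0).1.
rewrite xs0; case: t => [//|t]; rewrite plusS1.
apply: (@convex_mean _ (edom f) (fun k => xs t k.+1 w)) => //; first exact: set_f_convex H.
by move=> k; rewrite xs_step; exact: (set_f_prox H _ tau0).1.
Qed.

Lemma ys_dom t w k : edom g (ys t k w).
Proof.
case: k => [|k]; last by rewrite ys_step; exact: (set_g_prox H _ sigma0).1.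
rewrite ys0; case: t => [//|t]; rewrite plusS2.
apply: (@convex_mean _ (edom g) (fun k => ys t k.+1 w)) => //; first exact: set_g_convex H.
by move=> k; rewrite ys_step; exact: (set_g_prox H _ sigma0).1.
Qed.

Section IterateL2.
Variable F : set_system Omega.
Hypothesis sF : sub_sigma F.

Let ys_next_L2 t k : L2 P F (ys t k) -> (forall j, (j <= k)%N -> L2 P F (ey t j)) ->
  L2 P F (ys t k.+1).
Proof.
move=> yk eyj; rewrite (_ : ys t k.+1 = fun w => prox sigma g
  (ys t k w + sigma *: (ey t k w + qs t k w))); last by apply/funext => w.
apply: (L2_prox_g H sigma0 sF); apply: (L2D sF) => //; apply: (L2Z sF).
apply: (L2D sF); first exact: eyj.
case: k yk eyj => [|k] yk eyj; first exact: (L2_cst P sF 0).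
rewrite (_ : qs t k.+1 = fun w => ey t k.+1 w - ey t k w); last by apply/funext => w.
by apply: (L2B sF); exact: eyj.
Qed.

Let xs_next_L2 t k : L2 P F (xs t 0%N) -> L2 P F (xs t k) -> L2 P F (ex t k) ->
  L2 P F (xs t k.+1).
Proof.
move=> x0 xk exk; rewrite (_ : xs t k.+1 = fun w => prox tau f
  (xs t k w - tau *: (ex t k w + (2 * gamma) *: (xs t k w - xs t 0%N w)))); last by apply/funext => w.
apply: (L2_prox_f H tau0 sF); apply: (L2B sF) => //; apply: (L2Z sF).
by apply: (L2D sF) => //; apply: (L2Z sF); exact: (L2B sF).
Qed.

Lemma iter_L2 t k : L2 P F (xs t 0%N) -> L2 P F (ys t 0%N) ->
  (forall j, (j < k)%N -> L2 P F (ex t j) /\ L2 P F (ey t j)) ->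
  L2 P F (xs t k) /\ L2 P F (ys t k).
Proof.
move=> x0 y0; elim: k => [//|k IH] e.
have [j jk|xk yk] := IH; first by apply: e; exact: ltnW.
split; first by apply: xs_next_L2 => //; exact: (e k _).1.
by apply: ys_next_L2 => // j jk; exact: (e j _).2.
Qed.

Lemma iter_y_L2 t k : L2 P F (xs t 0%N) -> L2 P F (ys t 0%N) ->
  (forall j, (j < k)%N -> L2 P F (ex t j) /\ L2 P F (ey t j)) -> L2 P F (ey t k) ->
  L2 P F (ys t k.+1).
Proof.
move=> x0 y0 e ek; have [xk yk] := iter_L2 x0 y0 e.
apply: ys_next_L2 => // j; rewrite leq_eqVlt => /orP[/eqP ->//|jk].
exact: (e j jk).2.
Qed.

(** [F] is arbitrary: all events when moments are established, a history when measurability is. The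
    starting point of a call is a function of the estimates of earlier calls. *)
Lemma start_L2 t : (forall s j, (s < t)%N -> (j < N)%N -> L2 P F (ex s j) /\ L2 P F (ey s j)) ->
  L2 P F (xs t 0%N) /\ L2 P F (ys t 0%N).
Proof.
elim: t => [_|t IH e]; first by split; exact: (L2_cst P sF).
have [s j st jN|x0 y0] := IH; first by apply: e => //; exact: ltnW.
have it (k : 'I_N) : L2 P F (xs t k.+1) /\ L2 P F (ys t k.+1).
  by apply: iter_L2 => // j jk; apply: e => //; exact: leq_trans jk (ltn_ord k).
split.
  rewrite (_ : xs t.+1 0%N = fun w => N%:R^-1 *: \sum_(k < N) xs t k.+1 w); last first.
    by apply/funext => w; rewrite xs0 plusS1.
  by apply: (L2Z sF); apply: (L2_sum sF) => k; exact: (it k).1.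
rewrite (_ : ys t.+1 0%N = fun w => N%:R^-1 *: \sum_(k < N) ys t k.+1 w); last first.
  by apply/funext => w; rewrite ys0 plusS2.
by apply: (L2Z sF); apply: (L2_sum sF) => k; exact: (it k).2.
Qed.

End IterateL2.

Variables (deltax deltay : R).
Hypothesis Noise : noise_assumption P Phi xs ex ys ey (fun=> N) deltax deltay.

Let sT := @sub_sigmaT _ Omega.

(** That the histories consist of events is part of the noise hypothesis, through [is_cond_exp]; the
    iterates are not yet known to be measurable. *)
Let sub_sigma_generated (A : set (Omega -> R)) (V : Omega -> R) c :
  cond_exp_le P (sigma_generated A) V c -> sub_sigma (sigma_generated A).
Proof. by move=> [Z [sm _ _ _] _]; split => //; exact: smallest_sigma_algebra. Qed.

Let sub_hx t k : (k < N)%N -> sub_sigma (hist_x xs ex ys ey (fun=> N) t k).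
Proof. by move=> kN; exact: sub_sigma_generated (variance_x Noise kN). Qed.

Let sub_hy t k : (k < N)%N -> sub_sigma (hist_y xs ex ys ey (fun=> N) t k).
Proof. by move=> kN; exact: sub_sigma_generated (variance_y Noise kN). Qed.

(** An estimate is its exact gradient plus an error, whose second moment is finite by the variance
    bound. *)
Let est_L2 p (F : set_system Omega) (V W : Omega -> 'rV[R]_p) (c : R) :
  cond_exp_vec_eq P F V W ->
  cond_exp_le P F (fun w => enorm (V w - W w) ^+ 2) c ->
  L2 P d.-measurable W -> L2 P d.-measurable V.
Proof.
move=> hV [Z [_ iV _ _] _] hW.
have mV i : measurable_fun [set: Omega] (fun w => V w 0 i).
  by have [Z' [_ iV' _ _] _] := hV i; exact: rint_measurable iV'.
have hE : L2 P d.-measurable (fun w => V w - W w).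
  move=> i; have mE : measurable_fun [set: Omega] (fun w => (V w - W w) 0 i).
    rewrite (_ : (fun w => _) = (fun w => V w 0 i - W w 0 i)); last first.
      by apply/funext => w; rewrite !mxE.
    apply: measurable_funB => //.
    by apply: (meas_wrt_measurable sT.2); exact: (hW i).1.
  split; first by move=> B mB; have := mE measurableT B mB; rewrite setTI.
  apply: rint_le iV; first exact: measurable_funX.
  move=> w; rewrite ger0_norm ?sqr_ge0// -(real_normK (num_real _)).
  by apply: lerXn2r; rewrite ?nnegrE ?enorm_ge0//; exact: ler_abs_enorm.
have := L2D sT hE hW; congr L2; apply/funext => w; by rewrite subrK.
Qed.

(** Follows the order of the draws: [ey t k] determines [ys t k.+1], at which [ex t k] is then
    taken. *)
Let call_L2 t : L2 P d.-measurable (xs t 0%N) -> L2 P d.-measurable (ys t 0%N) ->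
  forall k, (k <= N)%N -> forall j, (j < k)%N ->
    L2 P d.-measurable (ex t j) /\ L2 P d.-measurable (ey t j).
Proof.
move=> x0 y0; elim=> [//|k IH] kN j; rewrite ltnS leq_eqVlt => /orP[/eqP ->{j}|]; last first.
  by apply: IH; exact: ltnW.
have {}IH := IH (ltnW kN); have [xk yk] := iter_L2 sT x0 y0 IH.
have eyk : L2 P d.-measurable (ey t k).
  apply: (est_L2 (unbiased_y Noise kN) (variance_y Noise kN)).
  by apply: (L2_grad_y H sT) => // w; [exact: xs_dom|exact: ys_dom].
have yk1 := iter_y_L2 sT x0 y0 IH eyk.
split => //; apply: (est_L2 (unbiased_x Noise kN) (variance_x Noise kN)).
by apply: (L2_grad_x H sT) => // w; [exact: xs_dom|exact: ys_dom].
Qed.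

Let all_L2 t : [/\ L2 P d.-measurable (xs t 0%N), L2 P d.-measurable (ys t 0%N) &
  forall s j, (s < t)%N -> (j < N)%N -> L2 P d.-measurable (ex s j) /\ L2 P d.-measurable (ey s j)].
Proof.
elim: t => [|t [x0 y0 e]].
  by split => //; exact: (L2_cst P sT).
have e' s j : (s < t.+1)%N -> (j < N)%N -> L2 P d.-measurable (ex s j) /\ L2 P d.-measurable (ey s j).
  rewrite ltnS leq_eqVlt => /orP[/eqP ->|st] jN; last exact: e.
  exact: (call_L2 x0 y0 (leqnn N)).
by have [x1 y1] := start_L2 sT e'; split.
Qed.

Let est_all_L2 t k : (k < N)%N -> L2 P d.-measurable (ex t k) /\ L2 P d.-measurable (ey t k).
Proof. by move=> kN; have [_ _ e] := all_L2 t.+1; exact: e. Qed.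

Let xys_L2 t k : (k <= N)%N -> L2 P d.-measurable (xs t k) /\ L2 P d.-measurable (ys t k).
Proof.
move=> kN; have [x0 y0 _] := all_L2 t; apply: (iter_L2 sT) => // j jk.
by apply: est_all_L2; exact: leq_trans jk kN.
Qed.

Let L2_generated p (A : set (Omega -> R)) (V : Omega -> 'rV[R]_p) :
  coordinates V `<=` A -> L2 P d.-measurable V -> L2 P (sigma_generated A) V.
Proof.
move=> VA hV i; split; last exact: (hV i).2.
move=> B mB; apply: sub_sigma_algebra; exists (fun w => V w 0 i), B; split => //.
by apply: VA; exists i.
Qed.

(** The starting point of the call need not be a generator of the history; [start_L2] rebuilds it
    from the recorded estimates of earlier calls. *)
Let hist_y_L2 t k : (k < N)%N -> let F := hist_y xs ex ys ey (fun=> N) t k in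
  [/\ L2 P F (xs t 0%N), L2 P F (xs t k), L2 P F (ys t k) &
      forall j, (j < k)%N -> L2 P F (ey t j)].
Proof.
move=> kN F; have [xk yk] := xys_L2 t (ltnW kN).
have past_L2 s j : ((s < t) && (j < N) || (s == t) && (j < k))%N ->
    L2 P F (ex s j) /\ L2 P F (ey s j).
  move=> sj; have jN : (j < N)%N.
    by move: sj => /orP[/andP[]//|/andP[_ /ltn_trans]]; exact.
  have [xe ye] := est_all_L2 s jN.
  by split; apply: L2_generated => // h hh; right; exists s, j; split => //; [left|right].
split.
- by apply: (start_L2 (sub_hy t kN) _).1 => s j st jN; apply: past_L2; rewrite st jN.
- by apply: L2_generated => // h hh; left; left.
- by apply: L2_generated => // h hh; left; right.
- by move=> j jk; apply: (past_L2 t j _).2; rewrite eqxx jk orbT.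
Qed.

Let hist_x_L2 t k : (k < N)%N -> let F := hist_x xs ex ys ey (fun=> N) t k in
  [/\ L2 P F (xs t 0%N), L2 P F (xs t k) & L2 P F (ys t k.+1)].
Proof.
move=> kN F; have [xk _] := xys_L2 t (ltnW kN); have [_ yk] := xys_L2 t kN.
split.
- apply: (start_L2 (sub_hx t kN) _).1 => s j st jN.
  have [xe ye] := est_all_L2 s jN.
  by split; apply: L2_generated => // h hh; right; exists s, j; split => //;
    rewrite ?st ?jN//; [left|right].
- by apply: L2_generated => // h hh; left; left; left.
- by apply: L2_generated => // h hh; left; left; right.
Qed.

Let ex_centered t k : (k < N)%N -> centered_wrt P (hist_x xs ex ys ey (fun=> N) t k)
  (fun w => err_x Phi (fun k => xs t k w) (fun k => ex t k w) (fun k => ys t k w) k).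
Proof.
move=> kN i; have sF := sub_hx t kN; have [_ xk yk] := hist_x_L2 t kN.
have gk := L2_grad_x H sF (xs_dom t ^~ k) (ys_dom t ^~ k.+1) xk yk.
have gk' := L2_sub sF.2 gk; have [exk _] := est_all_L2 t kN.
have hE := L2B sT exk gk'.
have := cond_exp_eq_centered sF (unbiased_x Noise kN i) (gk i).1.
rewrite (_ : (fun w => ex t k w 0 i - _) =
  fun w => (ex t k w - grad_x Phi (xs t k w) (ys t k.+1 w)) 0 i); last first.
  by apply/funext => w; rewrite !mxE.
move=> h A FA; rewrite -[RHS](h _ A FA).
  by apply: eq_integral => w _; rewrite /err_x !mxE.
apply: rint_sqr; last exact: (hE i).2.
by apply: (meas_wrt_measurable sT.2); exact: (hE i).1.
Qed.

Let ey_centered t k : (k < N)%N -> centered_wrt P (hist_y xs ex ys ey (fun=> N) t k)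
  (fun w => err_y Phi (fun k => xs t k w) (fun k => ys t k w) (fun k => ey t k w) k).
Proof.
move=> kN i; have sF := sub_hy t kN; have [_ xk yk _] := hist_y_L2 t kN.
have gk := L2_grad_y H sF (xs_dom t ^~ k) (ys_dom t ^~ k) xk yk.
have gk' := L2_sub sF.2 gk; have [_ eyk] := est_all_L2 t kN.
have hE := L2B sT eyk gk'.
have := cond_exp_eq_centered sF (unbiased_y Noise kN i) (gk i).1.
rewrite (_ : (fun w => ey t k w 0 i - _) =
  fun w => (ey t k w - grad_y Phi (xs t k w) (ys t k w)) 0 i); last first.
  by apply/funext => w; rewrite !mxE.
move=> h A FA; rewrite -[RHS](h _ A FA).
  by apply: eq_integral => w _; rewrite /err_y !mxE.
apply: rint_sqr; last exact: (hE i).2.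
by apply: (meas_wrt_measurable sT.2); exact: (hE i).1.
Qed.

Hypotheses (tauL : tau * (Lyx + Lxx + 2 * gamma) <= 1) (tauLxy : tau * Lxy <= 1).
Hypothesis sigmaL : sigma * (Lyx + 2 * Lyy) <= 1.

Let X t w := sx (plus t w).1.
Let Y t w := sy (plus t w).1.
Let a t w := gamma * enorm ((plus t w).1 - X t w) ^+ 2.
Let b t w := mu * enorm ((plus t w).2 - Y t w) ^+ 2.
Let D t w := gamma * enorm ((plus t.+1 w).1 - X t w) ^+ 2 +
  mu * enorm ((plus t.+1 w).2 - Y t w) ^+ 2.
Let nu := 2 * (2 * tau * deltax ^+ 2 + 14 * sigma * deltay ^+ 2).

Let call_mean t : mean P (D t) <=
  (N%:R * tau)^-1 * mean P (fun w => enorm ((plus t w).1 - X t w) ^+ 2)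
  + (N%:R * sigma)^-1 * mean P (fun w => enorm ((plus t w).2 - Y t w) ^+ 2) + nu.
Proof.
have -> : D t = (fun w => gamma * enorm (N%:R^-1 *: \sum_(k < N) xs t k.+1 w - X t w) ^+ 2
    + mu * enorm (N%:R^-1 *: \sum_(k < N) ys t k.+1 w - Y t w) ^+ 2).
  by apply/funext => w; rewrite /D plusS1 plusS2.
apply: (@sapd_mean _ _ _ P n m f g Phi gamma mu Lxx Lxy Lyx Lyy tau sigma H sx sy Hs
  tau0 sigma0 tauL tauLxy sigmaL (xs t) (ex t) (ys t) (ey t) (qs t) (ys_step t)
  (xs_step t) (qs0 t) (qsS t) (xs_dom t) (ys_dom t) N
  (hist_x xs ex ys ey (fun=> N) t) (hist_y xs ex ys ey (fun=> N) t) deltax deltay N0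
  (sub_hx t) (sub_hy t) (hist_x_L2 t) (hist_y_L2 t)) => //.
- by move=> k kN; exact: (xys_L2 t kN).1.
- by move=> k kN; exact: (xys_L2 t kN).2.
- by move=> k kN; exact: (est_all_L2 t kN).1.
- by move=> k kN; exact: (est_all_L2 t kN).2.
- exact: ex_centered.
- exact: ey_centered.
- move=> k kN; exact: (cond_exp_le_mean (sub_hx t kN) (sqr_ge0 _) (variance_x Noise kN)).2.
- move=> k kN; exact: (cond_exp_le_mean (sub_hy t kN) (sqr_ge0 _) (variance_y Noise kN)).2.
Qed.

Let plus_L2 t : L2 P d.-measurable (fun w => (plus t w).1) /\ L2 P d.-measurable (fun w => (plus t w).2).
Proof. by have [x0 y0] := xys_L2 t (leq0n N); split; [exact: x0|exact: y0]. Qed.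

Let XL t : L2 P d.-measurable (X t). Proof. exact: (L2_sx H Hs sT (plus_L2 t).1). Qed.
Let YL t : L2 P d.-measurable (Y t). Proof. exact: (L2_sy H Hs sT (plus_L2 t).1). Qed.

Let ia0 t : rint P (fun w => enorm ((plus t w).1 - X t w) ^+ 2).
Proof. exact: rint_enorm2 (L2B sT (plus_L2 t).1 (XL t)). Qed.

Let ib0 t : rint P (fun w => enorm ((plus t w).2 - Y t w) ^+ 2).
Proof. exact: rint_enorm2 (L2B sT (plus_L2 t).2 (YL t)). Qed.

Let ia t : rint P (a t). Proof. exact: rintZ (ia0 t). Qed.
Let ib t : rint P (b t). Proof. exact: rintZ (ib0 t). Qed.

Let iD t : rint P (D t).
Proof.
by apply: rintD; apply: rintZ; apply: rint_enorm2;
  apply: (L2B sT); by [exact: (plus_L2 t.+1).1|exact: (plus_L2 t.+1).2|exact: XL|exact: YL].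
Qed.

(** mu |Y_t - Y_{t+1}|^2 <= gamma |x_t - x_{t+1}|^2 by [sy_lip]; splitting at Y_t, and then x_t -
    x_{t+1} at X_t, doubles twice, hence the 4. *)
Let b_next t w : b t.+1 w <= 4 * D t w + 4 * a t w.
Proof.
have g0 := set_gamma_gt0 H; have m0 := set_mu_gt0 H.
have h1 := sy_lip H Hs (plus t w).1 (plus t.+1 w).1.
have h2 := enormD2_le ((plus t.+1 w).2 - Y t w) (Y t w - Y t.+1 w).
have h3 := enormD2_le ((plus t w).1 - X t w) (X t w - (plus t.+1 w).1).
rewrite !addrA !subrK in h2 h3; rewrite (enormB (X t w)) in h3.
have k2 := ler_wpM2l (ltW m0) h2; have k3 := ler_wpM2l (ltW g0) h3.
have p1 := mulr_ge0 (ltW m0) (sqr_ge0 (enorm ((plus t.+1 w).2 - Y t w))).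
rewrite -/(Y t w) -/(Y t.+1 w) in h1.
rewrite /b /D /a; move: h1 k2 k3 p1.
have arith (e c u1 u2 u3 v1 v2 v3 : R) : e * u1 <= c * v1 -> e * u3 <= e * (2 * u2 + 2 * u1) ->
  c * v1 <= c * (2 * v2 + 2 * v3) -> 0 <= e * u2 ->
  e * u3 <= 4 * (c * v3 + e * u2) + 4 * (c * v2) by lra.
exact: arith.
Qed.

Let value := saddle_value f g Phi gamma sx sy.

(** The envelope inequality [saddle_value_le] telescopes over the calls. *)
Let sum_a T w : \sum_(t < T) a t w <= value x00 - value (plus T w).1 + \sum_(t < T) D t w.
Proof.
have g0 := set_gamma_gt0 H; have m0 := set_mu_gt0 H.
elim: T => [|T IH]; first by rewrite !big_ord0 /plus /= subrr addr0.
rewrite !big_ord_recr/=; move: IH.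
have := saddle_value_le H Hs (plus T w).1 (plus T.+1 w).1; rewrite -/value -/(X T w).
have := mulr_ge0 (ltW m0) (sqr_ge0 (enorm ((plus T.+1 w).2 - Y T w))).
rewrite /D /a (enormB (X T w) (plus T.+1 w).1) (enormB (X T w) (plus T w).1).
have arith (v0 v1 v2 s1 s2 c p q e : R) : 0 <= e -> v2 <= v1 + c * (p - q) -> s1 <= v0 - v1 + s2 ->
  s1 + c * q <= v0 - v2 + (s2 + (c * p + e)) by lra.
exact: arith.
Qed.

Variables (U0 I0 : R).
Hypotheses (U0P : forall y, edom g y -> Lagr f g Phi x00 y <= U0)
  (I0P : forall x, edom f x -> I0 <= Lagr f g Phi x y00).

Let value_ge c : I0 + mu / 2 * enorm (y00 - sy c) ^+ 2 <= value c.
Proof.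
have [fX _ _ _] := Hs c; have := Lagr_le_saddle_value Hs c gy00.
have := I0P fX; have := mulr_ge0 (ltW (set_gamma_gt0 H)) (sqr_ge0 (enorm (sx c - c))).
rewrite /value; lra.
Qed.

Let value_le : value x00 + gamma / 2 * enorm (x00 - sx x00) ^+ 2 <= U0.
Proof.
have [_ gy _ _] := Hs x00.
exact: le_trans (saddle_value_le_Lagr Hs fx00) (U0P gy).
Qed.

Hypotheses (NtauL : (N%:R * tau)^-1 <= gamma / 132) (NsigmaL : (N%:R * sigma)^-1 <= mu / 264).

Let mean_D t : mean P (D t) <= (mean P (a t) + mean P (b t)) / 33 + nu.
Proof.
apply: (le_trans (call_mean t)); rewrite lerD2r.
have -> : mean P (a t) = gamma * mean P (fun w => enorm ((plus t w).1 - X t w) ^+ 2).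
  exact: meanZ.
have -> : mean P (b t) = mu * mean P (fun w => enorm ((plus t w).2 - Y t w) ^+ 2).
  exact: meanZ.
have p1 : 0 <= mean P (fun w => enorm ((plus t w).1 - X t w) ^+ 2).
  by apply: mean_ge0 => w; exact: sqr_ge0.
have p2 : 0 <= mean P (fun w => enorm ((plus t w).2 - Y t w) ^+ 2).
  by apply: mean_ge0 => w; exact: sqr_ge0.
have k1 := ler_wpM2r p1 NtauL; have k2 := ler_wpM2r p2 NsigmaL.
have q1 := mulr_ge0 (ltW (set_gamma_gt0 H)) p1; have q2 := mulr_ge0 (ltW (set_mu_gt0 H)) p2.
have arith (u v c e s1 s2 : R) : u <= c / 132 * s1 -> v <= e / 264 * s2 -> 0 <= c * s1 ->
  0 <= e * s2 -> u + v <= (c * s1 + e * s2) / 33 by lra.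
exact: arith k1 k2 q1 q2.
Qed.

(** Solves the linear system in the three sums. The envelope lies between [I0] and [U0] along the
    run, and [value_le] with [value_ge] at the start gives mu/2 |y00 - Y|^2 <= U0 - I0, which bounds
    the initial b. *)
Lemma sapd_plus_sum T : \sum_(t < T.+1)
    mean P (fun w => gamma * enorm ((plus t w).1 - sx (plus t w).1) ^+ 2)
  <= 31 / 24 * (U0 - I0) + 33 / 24 * (T.+1%:R * nu).
Proof.
have sA : \sum_(t < T.+1) mean P (a t) <= U0 - I0 + \sum_(t < T.+1) mean P (D t).
  rewrite -!mean_sum// -[U0 - I0](mean_cst P) -meanD//; [|exact: rint_cst|exact: rint_sum].
  apply: le_mean.
  - exact: rint_sum.
  - by apply: rintD; [exact: rint_cst|exact: rint_sum].
  move=> w; apply: (le_trans (sum_a T.+1 w)); rewrite lerD2r lerB//.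
    have := value_le; have := mulr_ge0 (ltW (set_gamma_gt0 H)) (sqr_ge0 (enorm (x00 - sx x00))).
    lra.
  have := value_ge (plus T.+1 w).1.
  have := mulr_ge0 (ltW (set_mu_gt0 H)) (sqr_ge0 (enorm (y00 - sy (plus T.+1 w).1))); lra.
have b0 : mean P (b 0%N) <= 2 * (U0 - I0).
  rewrite -[2 * _](mean_cst P); apply: le_mean => //; first exact: rint_cst.
  move=> w; rewrite /b /plus /= /Y /=.
  have := value_le; have := value_ge x00.
  have := mulr_ge0 (ltW (set_gamma_gt0 H)) (sqr_ge0 (enorm (x00 - sx x00))).
  move: (value _) (enorm _ ^+ 2) (enorm _ ^+ 2) => v p q; lra.
have sB : \sum_(t < T.+1) mean P (b t) <=
    2 * (U0 - I0) + 4 * \sum_(t < T.+1) mean P (D t) + 4 * \sum_(t < T.+1) mean P (a t).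
  rewrite big_ord_recl -addrA; apply: lerD; first exact: b0.
  apply: (@le_trans _ _ (\sum_(t < T) (4 * mean P (D t) + 4 * mean P (a t)))).
    apply: ler_sum => t _.
    rewrite -!meanZ// -meanD; [|exact: rintZ..].
    apply: le_mean => //; first by apply: rintD; exact: rintZ.
    exact: b_next.
  rewrite big_split/= -!mulr_sumr !(big_ord_recr T)/=.
  have Dpos : 0 <= mean P (D T).
    apply: mean_ge0 => w; rewrite addr_ge0// mulr_ge0 ?sqr_ge0//.
      exact: ltW (set_gamma_gt0 H).
    exact: ltW (set_mu_gt0 H).
  have apos : 0 <= mean P (a T).
    by apply: mean_ge0 => w; rewrite mulr_ge0 ?sqr_ge0//; exact: ltW (set_gamma_gt0 H).
  by rewrite lerD// ler_pM2l// lerDl.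
have sD : \sum_(t < T.+1) mean P (D t) <=
    (\sum_(t < T.+1) mean P (a t) + \sum_(t < T.+1) mean P (b t)) / 33 + T.+1%:R * nu.
  apply: (@le_trans _ _ (\sum_(t < T.+1) ((mean P (a t) + mean P (b t)) / 33 + nu))).
    by apply: ler_sum => t _; exact: mean_D.
  by rewrite big_split/= -mulr_suml big_split/= sumr_const card_ord mulr_natl.
have arith (sa sb sd u v : R) : sa <= u + sd -> sb <= 2 * u + 4 * sd + 4 * sa ->
  sd <= (sa + sb) / 33 + v -> sa <= 31 / 24 * u + 33 / 24 * v by lra.
exact: arith sA sB sD.
Qed.

Lemma prox_residual_L2 t :
  L2 P d.-measurable (fun w => (plus t w).1 - sx (plus t w).1).
Proof. by apply: (L2B sT); [exact: (plus_L2 t).1|exact: XL]. Qed.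

End SAPDPlus.

(** * Step sizes, number of iterations and oracle calls *)

Section StepSizes.
Context {R : realType}.

(** The last bound says that the inverse of a minimum is at most the sum of the inverses; it makes
    the cost additive. For [delta = 0] the second entry of the minimum is [+oo]. *)
Lemma step_size (r c eps delta : R) (s := fine (Order.min r%:E (c^-1%:E * noise_ratio eps delta))%E) :
  0 < r -> 0 < c -> 0 < eps ->
  [/\ 0 < s, s <= r, s * delta ^+ 2 <= eps ^+ 2 / c &
      s^-1 <= r^-1 + c * delta ^+ 2 / eps ^+ 2].
Proof.
move=> r0 c0 e0; have e2 : 0 < eps ^+ 2 by rewrite exprn_gt0.
rewrite /s /noise_ratio; have [->|dn0] := eqVneq delta 0.
  rewrite gt0_muley ?lte_fin ?invr_gt0// min_l ?leey//= !expr0n/= !mulr0 mul0r addr0.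
  by split => //; rewrite divr_ge0 ?(ltW c0) ?(ltW e2).
have d2 : 0 < delta ^+ 2 by rewrite exprn_even_gt0.
rewrite -EFinM -EFin_min/=; set u := c^-1 * _.
have u0 : 0 < u by rewrite mulr_gt0 ?invr_gt0 ?divr_gt0.
have uV : u^-1 = c * delta ^+ 2 / eps ^+ 2.
  by rewrite /u; field; rewrite dn0 !gt_eqF.
have ud : u * delta ^+ 2 = eps ^+ 2 / c.
  by rewrite /u; field; rewrite dn0 gt_eqF.
split.
- by rewrite lt_min r0.
- by rewrite ge_min lexx.
- by rewrite -ud ler_pM2r// ge_min lexx orbT.
- rewrite -uV minEle; case: ifP => _; first by rewrite lerDl invr_ge0 ltW.
  by rewrite lerDr invr_ge0 ltW.
Qed.

Lemma ceil_nat (z : R) : 0 < z ->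
  z <= (`|Num.ceil z|%N)%:R < z + 1.
Proof.
move=> z0; rewrite natr_absz ger0_norm ?ceil_ge0 ?(lt_trans _ z0) ?oppr_lt0//.
by have := ceil_itv z; rewrite intrB ltrBlDr => /andP[-> ->].
Qed.

Lemma outer_mean_fin (T : nat) (a : nat -> R) :
  outer_mean T (fun t => (a t)%:E) = (T.+1%:R^-1 * \sum_(t < T.+1) a t)%:E.
Proof. by rewrite /outer_mean sumEFin -EFinM big_mkord. Qed.

(** [c1] and [c2] stand for 480 and 4512; only the three inequalities on them matter, and they keep
    large numerals out of the arithmetic. *)
Lemma sapd_parameters (c1 c2 gamma mu Lxx Lxy Lyx Lyy deltax deltay eps : R)
    (tau := fine (Order.min (Order.min (Lyx + Lxx + 2 * gamma)^-1%:E Lxy^-1%:E)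
      ((c1 * gamma)^-1%:E * noise_ratio eps deltax))%E)
    (sigma := fine (Order.min (Lyx + 2 * Lyy)^-1%:E
      ((c2 * gamma)^-1%:E * noise_ratio eps deltay))%E)
    (N := `|Num.ceil (33 * Num.max (4 / (gamma * tau)) (8 / (mu * sigma)))|%N) :
  0 < c1 -> 3 <= c2 -> c1 <= 2 * c2 -> 0 < gamma -> 0 < mu -> gamma <= Lxx -> 0 <= Lyy -> 0 < Lxy -> 0 < Lyx -> 0 < eps ->
  [/\ 0 < tau, 0 < sigma & (0 < N)%N] /\
  [/\ tau * (Lyx + Lxx + 2 * gamma) <= 1, tau * Lxy <= 1, sigma * (Lyx + 2 * Lyy) <= 1,
    (N%:R * tau)^-1 <= gamma / 132 & (N%:R * sigma)^-1 <= mu / 264] /\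
  [/\ tau * deltax ^+ 2 <= eps ^+ 2 / (c1 * gamma),
    sigma * deltay ^+ 2 <= eps ^+ 2 / (c2 * gamma) &
    (sapd_calls N)%:R <= 102 * (8 * c2) * (Num.max Lxx (Num.max Lyx Lxy) / gamma
      + Num.max Lyy Lyx / mu + deltax ^+ 2 / eps ^+ 2
      + gamma * (deltay ^+ 2 / eps ^+ 2) / mu)].
Proof.
move=> c10 c23 c12 g0 m0 gL Lyy0 Lxy0 Lyx0 e0.
have Lxx0 : 0 < Lxx by exact: lt_le_trans gL.
pose A := Lyx + Lxx + 2 * gamma; have A0 : 0 < A by rewrite /A; lra.
pose B := Lyx + 2 * Lyy; have B0 : 0 < B by rewrite /B; lra.
pose r := Num.min A^-1 Lxy^-1.
have r0 : 0 < r by rewrite lt_min !invr_gt0 A0.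
have rV : r^-1 <= A + Lxy.
  by rewrite /r minEle; case: ifP => _; rewrite invrK ?lerDl ?lerDr ltW.
have cg1 : 0 < c1 * gamma by exact: mulr_gt0.
have cg2 : 0 < c2 * gamma by apply: mulr_gt0 => //; lra.
have [t0 tr tn tV] : [/\ 0 < tau, tau <= r, tau * deltax ^+ 2 <= eps ^+ 2 / (c1 * gamma) &
    tau^-1 <= r^-1 + c1 * gamma * deltax ^+ 2 / eps ^+ 2].
  by have := step_size deltax r0 cg1 e0; rewrite EFin_min.
have [s0 sr sn sV] : [/\ 0 < sigma, sigma <= B^-1, sigma * deltay ^+ 2 <= eps ^+ 2 / (c2 * gamma) &
    sigma^-1 <= B + c2 * gamma * deltay ^+ 2 / eps ^+ 2].
  have B1 : 0 < B^-1 by rewrite invr_gt0.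
  by have := step_size deltay B1 cg2 e0; rewrite invrK.
clearbody tau sigma.
pose z := 33 * Num.max (4 / (gamma * tau)) (8 / (mu * sigma)).
have z1 : 132 / (gamma * tau) <= z.
  by rewrite /z (_ : 132 = 33 * 4) -?mulrA ?ler_pM2l// ?le_max ?lexx//; lra.
have z2 : 264 / (mu * sigma) <= z.
  by rewrite /z (_ : 264 = 33 * 8) -?mulrA ?ler_pM2l// ?le_max ?lexx ?orbT//; lra.
have gt0 : 0 < gamma * tau by rewrite mulr_gt0.
have ms0 : 0 < mu * sigma by rewrite mulr_gt0.
have z0 : 0 < z by apply: lt_le_trans z1; rewrite divr_gt0.
have /andP[zN Nz] : z <= N%:R < z + 1 by exact: ceil_nat.
have NR : (0 : R) < N%:R by exact: lt_le_trans zN.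
have tA : tau * A <= 1.
  by rewrite -ler_pdivlMr// div1r (le_trans tr)// /r ge_min lexx.
split; first by split => //; rewrite -(ltr0n R).
split.
  split => //.
  - by rewrite -ler_pdivlMr// div1r (le_trans tr)// /r ge_min lexx orbT.
  - by rewrite -ler_pdivlMr// div1r.
  - rewrite -ler_pV2 ?inE ?unitf_gt0 ?invr_gt0 ?divr_gt0 ?mulr_gt0// invrK invf_div.
    by have := le_trans z1 zN; rewrite !ler_pdivrMr//; lra.
  - rewrite -ler_pV2 ?inE ?unitf_gt0 ?invr_gt0 ?divr_gt0 ?mulr_gt0// invrK invf_div.
    by have := le_trans z2 zN; rewrite !ler_pdivrMr//; lra.
split => //.
have M1 : [/\ Lxx <= Num.max Lxx (Num.max Lyx Lxy), Lyx <= Num.max Lxx (Num.max Lyx Lxy) &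
    Lxy <= Num.max Lxx (Num.max Lyx Lxy)] by rewrite !le_max !lexx !orbT.
have M2 : Lyy <= Num.max Lyy Lyx /\ Lyx <= Num.max Lyy Lyx by rewrite !le_max !lexx !orbT.
move: M1 M2; set L1 := Num.max Lxx _; set L2 := Num.max Lyy _ => -[a1 a2 a3] [b1 b2].
set u := deltax ^+ 2 / eps ^+ 2; set v := deltay ^+ 2 / eps ^+ 2.
have u0 : 0 <= u by rewrite divr_ge0 ?sqr_ge0.
have v0 : 0 <= v by rewrite divr_ge0 ?sqr_ge0.
have q1 : 4 / (gamma * tau) <= 20 * (L1 / gamma) + (4 * c1) * u.
  have -> : 4 / (gamma * tau) = 4 / gamma * tau^-1 by field; rewrite !gt_eqF.
  have -> : 20 * (L1 / gamma) + (4 * c1) * u = 4 / gamma * (5 * L1 + c1 * gamma * u).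
    by field; rewrite gt_eqF.
  rewrite ler_pM2l ?divr_gt0//; move: tV; rewrite -!mulrA -/u /A in rV *; lra.
have q2 : 8 / (mu * sigma) <= 24 * (L2 / mu) + (8 * c2) * (gamma * v / mu).
  have -> : 8 / (mu * sigma) = 8 / mu * sigma^-1 by field; rewrite !gt_eqF.
  have -> : 24 * (L2 / mu) + (8 * c2) * (gamma * v / mu) = 8 / mu * (3 * L2 + c2 * gamma * v).
    by field; rewrite gt_eqF.
  rewrite ler_pM2l ?divr_gt0//; move: sV; rewrite -!mulrA -/v /B; lra.
(* Lets the rounding in N and the additional [y]-estimate be absorbed by the main term. *)
have q0 : 1 <= 4 / (gamma * tau).
  rewrite ler_pdivlMr// mul1r; apply: le_trans (_ : 1 <= 4); last by lra.
  apply: le_trans tA; rewrite mulrC ler_pM2l// /A; lra.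
have p1 : 0 <= L1 / gamma by rewrite divr_ge0// ltW// (lt_le_trans Lxx0).
have p2 : 0 <= L2 / mu by rewrite divr_ge0// ?ltW// (lt_le_trans Lyx0).
have p3 : 0 <= gamma * v / mu := divr_ge0 (mulr_ge0 (ltW g0) v0) (ltW m0).
have z3 : z <= 33 * (4 / (gamma * tau) + 8 / (mu * sigma)).
  rewrite /z ler_pM2l//; have := divr_gt0 (ltr0n R 8) ms0; rewrite /Num.max; case: ifP => _ ?; lra.
have -> : (sapd_calls N)%:R = 2 * N%:R + 1 :> R.
  by rewrite /sapd_calls addnS -addn1 !natrD; lra.
(* All of 20, 4 c1, 24 and 8 c2 are at most 8 c2. Moreover 2 N + 1 <= 2 z + 3 is at most 69 times
   the sum of the two quotients, within the 102. *)
have k1 := ler_wpM2r u0 c12; have k2 := ler_wpM2r p1 c23; have k3 := ler_wpM2r p2 c23.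
have k4 := ler_wpM2r u0 c23; have k5 := ler_wpM2r p3 c23.
lra.
Qed.

End StepSizes.

Section Gap.
Context {R : realType} {n m : nat}.
Variables (f : 'rV[R]_n -> \bar R) (g : 'rV[R]_m -> \bar R).
Variable Phi : 'rV[R]_n -> 'rV[R]_m -> R.
Variables (gamma mu Lxx Lxy Lyx Lyy : R).
Hypothesis H : saddle_setting f g Phi gamma mu Lxx Lxy Lyx Lyy.
Variables (x00 : 'rV[R]_n) (y00 : 'rV[R]_m).
Hypotheses (fx00 : edom f x00) (gy00 : edom g y00).

(** Supremum and infimum are each compared with the finite value at [(x00, y00)], so an infinite one
    makes the gap [+oo]. *)
Lemma gapP : gap f g Phi x00 y00 = +oo%E \/ exists U0 I0 : R,
  [/\ gap f g Phi x00 y00 = (U0 - I0)%:E,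
      forall y, edom g y -> Lagr f g Phi x00 y <= U0 &
      forall x, edom f x -> I0 <= Lagr f g Phi x y00].
Proof.
rewrite /gap -/(primal f g Phi x00); set p := primal _ _ _ _; set q := ereal_inf _.
have pP y : edom g y -> ((Lagr f g Phi x00 y)%:E <= p)%E by move=> gy; exact: (primal_ge H).
have qP x : edom f x -> (q <= (Lagr f g Phi x y00)%:E)%E.
  by move=> fx; rewrite -(Lag_fine H)//; apply: ereal_inf_lbound; exists x.
have := pP _ gy00; have := qP _ fx00.
case: p pP => [U0| |] pP; case: q qP => [I0| |] qP //= _ _; try by left.
right; exists U0, I0; split => // [y /pP|x /qP]; by rewrite lee_fin.
Qed.

End Gap.

(** * From distances to gradients of the envelope *)

Section GradientMean.
Context {R : realType} {n m : nat} {S : Type}.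
Context {d : measure_display} {Omega : measurableType d}.
Variable P : probability Omega R.
Variables (f : 'rV[R]_n -> \bar R) (g : 'rV[R]_m -> \bar R).
Variable Phi : 'rV[R]_n -> 'rV[R]_m -> R.
Variables (gamma mu Lxx Lxy Lyx Lyy tau sigma : R).
Hypothesis H : saddle_setting f g Phi gamma mu Lxx Lxy Lyx Lyy.
Hypotheses (tau0 : 0 < tau) (sigma0 : 0 < sigma).
Variables (gX : 'rV[R]_n -> 'rV[R]_m -> S -> 'rV[R]_n)
  (gY : 'rV[R]_n -> 'rV[R]_m -> S -> 'rV[R]_m).
Variables (wx wy : nat -> nat -> Omega -> S).
Variables (x00 : 'rV[R]_n) (y00 : 'rV[R]_m) (N : nat).
Hypotheses (fx00 : edom f x00) (gy00 : edom g y00) (N0 : (0 < N)%N).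
Variables (deltax deltay : R).
Hypothesis Noise : noise_assumption P Phi
  (iter_x f g gX gY gamma tau sigma 1 gamma wx wy x00 y00 (fun=> N))
  (est_x f g gX gY gamma tau sigma 1 gamma wx wy x00 y00 (fun=> N))
  (iter_y f g gX gY gamma tau sigma 1 gamma wx wy x00 y00 (fun=> N))
  (est_y f g gX gY gamma tau sigma 1 gamma wx wy x00 y00 (fun=> N))
  (fun=> N) deltax deltay.
Hypotheses (tauL : tau * (Lyx + Lxx + 2 * gamma) <= 1) (tauLxy : tau * Lxy <= 1).
Hypothesis sigmaL : sigma * (Lyx + 2 * Lyy) <= 1.
Hypotheses (NtauL : (N%:R * tau)^-1 <= gamma / 132) (NsigmaL : (N%:R * sigma)^-1 <= mu / 264).
Variable eps : R.
Hypothesis eps0 : 0 < eps.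
Hypotheses (tau_noise : tau * deltax ^+ 2 <= eps ^+ 2 / (480 * gamma))
  (sigma_noise : sigma * deltay ^+ 2 <= eps ^+ 2 / (4512 * gamma)).

Let x0 t w := (sapd_plus f g gX gY gamma tau sigma 1 gamma wx wy x00 y00 (fun=> N) t w).1.
Let grad := gradient (moreau (2 * gamma)^-1 (primal f g Phi)).

Let gamma0 : 0 < gamma := set_gamma_gt0 H.

Variables (U0 I0 : R).
Hypotheses (U0P : forall y, edom g y -> Lagr f g Phi x00 y <= U0)
  (I0P : forall x, edom f x -> I0 <= Lagr f g Phi x y00).

Section WithSaddles.
Variables (sx : 'rV[R]_n -> 'rV[R]_n) (sy : 'rV[R]_n -> 'rV[R]_m).
Hypothesis Hs : forall c, is_saddle f g Phi gamma mu c (sx c) (sy c).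

Let res_L2 t : L2 P d.-measurable (fun w => grad (x0 t w)).
Proof.
rewrite (_ : (fun w => _) = fun w => (2 * gamma) *: (x0 t w - sx (x0 t w))).
  apply: (L2Z (@sub_sigmaT _ Omega)).
  exact: (prox_residual_L2 H Hs tau0 sigma0 fx00 gy00 N0 Noise).
by apply/funext => w; rewrite /grad (gradient_moreau H Hs).
Qed.

Let grad2 t w : enorm (grad (x0 t w)) ^+ 2 =
  4 * gamma * (gamma * enorm (x0 t w - sx (x0 t w)) ^+ 2).
Proof.
rewrite /grad (gradient_moreau H Hs) enormZ exprMn real_normK ?num_real//; ring.
Qed.

Let rint_grad2 t : rint P (fun w => enorm (grad (x0 t w)) ^+ 2).
Proof. exact: rint_enorm2 (res_L2 t). Qed.

Let rint_grad t : rint P (fun w => enorm (grad (x0 t w))).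
Proof.
apply: rint_le (rintD (rint_grad2 t) (rint_cst P 1)).
  apply: (meas_wrt_measurable (F := d.-measurable)) => //.
  apply: (@meas_wrt_lip _ _ _ _ (sigma_algebra_measurable Omega) n setT (@enorm R n) 1) => //.
    move=> z z' _ _; rewrite mul1r ler_norml.
    have := ler_enormBD z' z 0; have := ler_enormBD z z' 0.
    by rewrite !subr0 (enormB z' z) => h1 h2; apply/andP; split; lra.
  by move=> i; exact: (res_L2 t i).1.
move=> w /=; rewrite ger0_norm ?enorm_ge0//.
by have := sqr_ge0 (enorm (grad (x0 t w)) - 1); have := enorm_ge0 (grad (x0 t w)); lra.
Qed.

Let grad_sq_mean_le T : 96 * (U0 - I0) * (gamma / eps ^+ 2) <= T%:R ->
  T.+1%:R^-1 * \sum_(t < T.+1) mean P (fun w => enorm (grad (x0 t w)) ^+ 2) <= eps ^+ 2.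
Proof.
move=> hT; have e2 : 0 < eps ^+ 2 by rewrite exprn_gt0.
have TR : (0 : R) < T.+1%:R by rewrite ltr0n.
have hS := sapd_plus_sum H Hs tau0 sigma0 fx00 gy00 N0 Noise tauL tauLxy sigmaL U0P I0P NtauL NsigmaL T.
have -> : \sum_(t < T.+1) mean P (fun w => enorm (grad (x0 t w)) ^+ 2) =
    4 * gamma * \sum_(t < T.+1) mean P (fun w => gamma * enorm (x0 t w - sx (x0 t w)) ^+ 2).
  rewrite mulr_sumr; apply: eq_bigr => t _; rewrite -meanZ.
    by congr mean; apply/funext => w; rewrite grad2.
  apply: rintZ; apply: rint_enorm2.
  exact: (prox_residual_L2 H Hs tau0 sigma0 fx00 gy00 N0 Noise).
rewrite ler_pdivrMl//.
apply: (le_trans (ler_wpM2l _ hS)); first by rewrite mulr_ge0// ltW.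
have h1 : 96 * (U0 - I0) * gamma <= T.+1%:R * eps ^+ 2.
  rewrite -ler_pdivrMr// mulrA in hT *; apply: (le_trans hT); by rewrite ler_nat.
have h2 : gamma * (tau * deltax ^+ 2) <= eps ^+ 2 / 480.
  apply: (le_trans (ler_wpM2l (ltW gamma0) tau_noise)); rewrite le_eqVlt; apply/orP; left.
  by apply/eqP; field; rewrite gt_eqF.
have h3 : gamma * (sigma * deltay ^+ 2) <= eps ^+ 2 / 4512.
  apply: (le_trans (ler_wpM2l (ltW gamma0) sigma_noise)); rewrite le_eqVlt; apply/orP; left.
  by apply/eqP; field; rewrite gt_eqF.
have k2 := ler_wpM2l (ltW TR) h2; have k3 := ler_wpM2l (ltW TR) h3.
have p := mulr_ge0 (ltW TR) (ltW e2).
(* The shares of M e are 31/576 for the gap, and 11 * 2/480 and 11 * 14/4512 for the two noises,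
   about 0.13 in total. *)
have arith (G c M e u v : R) : 96 * G * c <= M * e -> M * (c * u) <= M * (e / 480) ->
    M * (c * v) <= M * (e / 4512) -> 0 <= M * e ->
    4 * c * (31 / 24 * G + 33 / 24 * (M * (2 * (2 * u + 14 * v)))) <= M * e by lra.
rewrite -!(mulrA 2 tau) -!(mulrA 14 sigma); exact: arith h1 k2 k3 p.
Qed.

(** From u <= u^2 / (2 eps) + eps / 2: averaged over the sample and over t, each half is at most eps
    / 2. *)
Let grad_mean_le T : 96 * (U0 - I0) * (gamma / eps ^+ 2) <= T%:R ->
  T.+1%:R^-1 * \sum_(t < T.+1) mean P (fun w => enorm (grad (x0 t w))) <= eps.
Proof.
move=> hT; have h := grad_sq_mean_le hT.
have TR : (0 : R) < T.+1%:R by rewrite ltr0n.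
have i1 := rint_grad; have i2 := rint_grad2.
have key t : mean P (fun w => enorm (grad (x0 t w))) <=
    (2 * eps)^-1 * mean P (fun w => enorm (grad (x0 t w)) ^+ 2) + eps / 2.
  rewrite -meanZ// -[X in _ <= _ + X](mean_cst P) -meanD//; [|exact: rintZ|exact: rint_cst].
  apply: le_mean => //; first by apply: rintD; [exact: rintZ|exact: rint_cst].
  move=> w /=; move: (enorm _) => u.
  rewrite -(@ler_pM2l _ (2 * eps)) ?mulr_gt0// mulrDr mulVKf ?gt_eqF ?mulr_gt0//.
  by have := sqr_ge0 (u - eps); lra.
apply: (@le_trans _ _ (T.+1%:R^-1 * \sum_(t < T.+1)
    ((2 * eps)^-1 * mean P (fun w => enorm (grad (x0 t w)) ^+ 2) + eps / 2))).
  by rewrite ler_pM2l ?invr_gt0//; apply: ler_sum => t _; exact: key.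
rewrite big_split/= -mulr_sumr sumr_const card_ord -[(_ / 2) *+ _]mulr_natl mulrDr.
rewrite (mulKf _ (eps / 2)) ?gt_eqF// mulrCA.
have i0 : 0 <= (2 * eps)^-1 by rewrite invr_ge0 mulr_ge0// ltW.
have E : (2 * eps)^-1 * eps ^+ 2 = eps / 2 by field; rewrite gt_eqF.
have := ler_wpM2l i0 h; rewrite E.
have arith (u : R) : u <= eps / 2 -> u + eps / 2 <= eps by lra.
exact: arith.
Qed.

Lemma grad_sq_outer_mean_le T : 96 * (U0 - I0) * (gamma / eps ^+ 2) <= T%:R ->
  (outer_mean T (fun t => 'E_P[fun w => enorm (grad (x0 t w)) ^+ 2]%R) <= (eps ^+ 2)%:E)%E.
Proof.
move=> /grad_sq_mean_le; rewrite -lee_fin.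
rewrite -(outer_mean_fin T (fun t => mean P (fun w => enorm (grad (x0 t w)) ^+ 2))); congr (outer_mean _ _ <= _)%E.
by apply/funext => t; rewrite unlock -meanE.
Qed.

Lemma grad_outer_mean_le T : 96 * (U0 - I0) * (gamma / eps ^+ 2) <= T%:R ->
  (outer_mean T (fun t => 'E_P[fun w => enorm (grad (x0 t w))]%R) <= eps%:E)%E.
Proof.
move=> /grad_mean_le; rewrite -lee_fin.
rewrite -(outer_mean_fin T (fun t => mean P (fun w => enorm (grad (x0 t w))))); congr (outer_mean _ _ <= _)%E.
by apply/funext => t; rewrite unlock -meanE.
Qed.

End WithSaddles.
End GradientMean.

Theorem theorem3 (R : realType) :
  exists2 C : R, 0 < C &
  forall (n m : nat)
    (f : 'rV[R]_n -> \bar R) (g : 'rV[R]_m -> \bar R)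
    (Phi : 'rV[R]_n -> 'rV[R]_m -> R)
    (gamma muy Lxx Lxy Lyx Lyy : R)
    (d : measure_display) (Omega : measurableType d) (P : probability Omega R)
    (S : Type)
    (gX : 'rV[R]_n -> 'rV[R]_m -> S -> 'rV[R]_n)
    (gY : 'rV[R]_n -> 'rV[R]_m -> S -> 'rV[R]_m)
    (wx wy : nat -> nat -> Omega -> S)
    (deltax deltay : R)
    (x00 : 'rV[R]_n) (y00 : 'rV[R]_m),
  let mux := gamma in
  let theta := 1 in
  let lam := (2 * gamma)^-1 in
  let tau eps := fine (Order.min (Order.min
      (Lyx + Lxx + 2 * gamma)^-1%:E
      Lxy^-1%:E)
      ((480 * gamma)^-1%:E * noise_ratio eps deltax))%E in
  let sigma eps := fine (Order.min
      (Lyx + 2 * Lyy)^-1%:E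
      ((4512 * gamma)^-1%:E * noise_ratio eps deltay))%E in
  let N eps : nat := `|Num.ceil
      (33 * Num.max (4 / (gamma * tau eps)) (8 / (muy * sigma eps)))|%N in
  let Nt eps : nat -> nat := fun=> N eps in
  let x0 eps t w := (sapd_plus f g gX gY gamma (tau eps) (sigma eps) theta mux
    wx wy x00 y00 (Nt eps) t w).1 in
  let xs eps := iter_x f g gX gY gamma (tau eps) (sigma eps) theta mux
    wx wy x00 y00 (Nt eps) in
  let ys eps := iter_y f g gX gY gamma (tau eps) (sigma eps) theta mux
    wx wy x00 y00 (Nt eps) in
  let ex eps := est_x f g gX gY gamma (tau eps) (sigma eps) theta mux
    wx wy x00 y00 (Nt eps) in
  let ey eps := est_y f g gX gY gamma (tau eps) (sigma eps) theta mux
    wx wy x00 y00 (Nt eps) in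
  let grad_env := gradient (moreau lam (primal f g Phi)) in
  structural_assumption f g Phi gamma muy ->
  smoothness_assumption f g Phi gamma Lxx Lxy Lyx Lyy ->
  bounded_subgradient_assumption f g ->
  0 <= deltax -> 0 <= deltay ->
  edom f x00 -> edom g y00 ->
  (forall eps, 0 < eps ->
    noise_assumption P Phi (xs eps) (ex eps) (ys eps) (ey eps) (Nt eps)
      deltax deltay) ->
  (forall eps, 0 < eps -> forall T : nat,
    ((96%:E * gap f g Phi x00 y00 * (gamma / eps ^+ 2)%R%:E + 1 <= T%:R%:E) ->
    outer_mean T (fun t => 'E_P[fun w => (enorm (grad_env (x0 eps t w)) ^+ 2)%R])
      <= (eps ^+ 2)%R%:E)%E)
  /\
  (\forall eps \near 0^'+,
    (sfo_complexity P grad_env (x0 eps) (N eps) eps <=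
      C%:E * ((Num.max Lxx (Num.max Lyx Lxy) / gamma + Num.max Lyy Lyx / muy)
                * gamma * eps ^- 2
              + (deltax ^+ 2 / gamma + deltay ^+ 2 / muy)
                * gamma ^+ 2 * eps ^- 4)%R%:E
      * gap f g Phi x00 y00)%E).
Proof.
(* Rounding up the number of outer iterations costs at most 2 u once [1 <= u]; hence the 98 in the
   final constant. *)
have arith (u : R) : 1 <= u -> 96 * u + 1 <= 98 * u by lra.
have c1pos : 0 < 480 :> R by rewrite ltr0n.
have c23 : 3 <= 4512 :> R by rewrite ler_nat.
have c12 : 480 <= 2 * 4512 :> R by rewrite -natrM ler_nat.
pose D : R := 102 * (8 * 4512).
have D0 : 0 < D by do 2 (apply: mulr_gt0; first by rewrite ltr0n); rewrite ltr0n.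
have par (gamma muy Lxx Lxy Lyx Lyy deltax deltay eps : R) g0 m0 gL Lyy0 Lxy0 Lyx0 e0 :=
  (@sapd_parameters R 480 4512 gamma muy Lxx Lxy Lyx Lyy deltax deltay eps c1pos c23 c12
    g0 m0 gL Lyy0 Lxy0 Lyx0 e0).
rewrite -/D in par; clearbody D; clear c1pos c23 c12.
exists (98 * D); first exact: mulr_gt0.
move=> n m f g Phi gamma muy Lxx Lxy Lyx Lyy d Omega P S gX gY wx wy deltax deltay x00 y00.
move=> mux theta lam tau sigma N Nt x0 xs ys ex ey grad_env SA SM SB _ _ fx00 gy00 Noise.
have H := saddle_settingP SA SM SB.
have g0 := set_gamma_gt0 H; have m0 := set_mu_gt0 H.
have [sx hsx] := choice (saddle_exists H).
have [sy Hs] := choice hsx.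
have {}par (eps : R) (e0 : 0 < eps) := par gamma muy Lxx Lxy Lyx Lyy
  deltax deltay eps g0 m0 (gamma_le_Lxx SM) (Lyy_ge0 SM) (Lxy_gt0 SM) (Lyx_gt0 SM) e0.
set L1 := Num.max Lxx (Num.max Lyx Lxy) in par *; set L2 := Num.max Lyy Lyx in par *.
have L10 : 0 < L1 by rewrite lt_max (lt_le_trans g0 (gamma_le_Lxx SM)).
have L20 : 0 < L2 by rewrite lt_max (Lyx_gt0 SM) orbT.
pose W (eps : R) := L1 / gamma + L2 / muy + deltax ^+ 2 / eps ^+ 2
  + gamma * (deltay ^+ 2 / eps ^+ 2) / muy.
have W0 eps : 0 < W eps.
  have p1 := divr_gt0 L10 g0; have p2 := divr_gt0 L20 m0.
  have p3 : 0 <= deltax ^+ 2 / eps ^+ 2 by rewrite divr_ge0 ?sqr_ge0.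
  have p4 : 0 <= deltay ^+ 2 / eps ^+ 2 by rewrite divr_ge0 ?sqr_ge0.
  have p5 := divr_ge0 (mulr_ge0 (ltW g0) p4) (ltW m0).
  by rewrite /W; do 2 apply: ltr_wpDr => //; exact: addr_gt0.
have rateE (eps : R) : 0 < eps -> (L1 / gamma + L2 / muy) * gamma * eps ^- 2
    + (deltax ^+ 2 / gamma + deltay ^+ 2 / muy) * gamma ^+ 2 * eps ^- 4
    = gamma / eps ^+ 2 * W eps.
  by move=> e0; rewrite /W; field; rewrite !gt_eqF.
have [gapE|[U0 [I0 [gapE U0P I0P]]]] := gapP H fx00 gy00.
  (* With an infinite gap no T satisfies the premise of the first claim, and the bound of the second
     is [+oo]. *)
  split.
    move=> eps e0 T.
    by rewrite gapE gt0_muley ?lte_fin// gt0_mulye ?lte_fin ?divr_gt0 ?exprn_gt0// leye_eq.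
  near=> eps; have e0 : 0 < eps by [].
  rewrite rateE// gapE gt0_muley ?leey// -EFinM lte_fin.
  by do 2 apply: mulr_gt0 => //; rewrite divr_gt0 ?exprn_gt0.
have sqm (eps : R) (e0 : 0 < eps) T : 96 * (U0 - I0) * (gamma / eps ^+ 2) <= T%:R ->
    (outer_mean T (fun t => 'E_P[fun w => enorm (grad_env (x0 eps t w)) ^+ 2]%R) <= (eps ^+ 2)%:E)%E
    /\ (outer_mean T (fun t => 'E_P[fun w => enorm (grad_env (x0 eps t w))]%R) <= eps%:E)%E.
  move=> hT; have [[t0 s0 N0] [[h1 h2 h3 h4 h5] [h6 h7 _]]] := par eps e0.
  split.
    exact: (grad_sq_outer_mean_le H t0 s0 fx00 gy00 N0 (Noise eps e0) h1 h2 h3 h4 h5 e0 h6 h7 U0P I0P Hs).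
  exact: (grad_outer_mean_le H t0 s0 fx00 gy00 N0 (Noise eps e0) h1 h2 h3 h4 h5 e0 h6 h7 U0P I0P Hs).
split.
  move=> eps e0 T; rewrite gapE -!EFinM -EFinD lee_fin => hT.
  by apply: (sqm eps e0 T _).1; apply: le_trans hT; rewrite lerDl.
have G0 : 0 <= U0 - I0 by rewrite subr_ge0 (le_trans (I0P _ fx00))// U0P.
(* A zero gap makes the claimed bound 0; the starting point already qualifies, with [T = 0] and no
   oracle call. *)
have [GE|Gn0] := eqVneq (U0 - I0) 0.
  near=> eps; have e0 : 0 < eps by [].
  rewrite gapE GE mule0; apply: ereal_inf_lbound; exists 0%N; last by rewrite mul0n.
  by apply: (sqm eps e0 0%N _).2; rewrite GE mulr0 mul0r.
have {Gn0}G0 : 0 < U0 - I0 by rewrite lt_def Gn0.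
near=> eps; have e0 : 0 < eps by [].
have e1 : eps < 1 by near: eps; exact: nbhs_right_lt.
have eG : eps < (U0 - I0) * gamma by near: eps; apply: nbhs_right_lt; exact: mulr_gt0.
have e2 : 0 < eps ^+ 2 by rewrite exprn_gt0.
(* For eps below 1 and below (U0 - I0) gamma one has eps^2 <= (U0 - I0) gamma, so [1 <= q]. This is
   where eps has to be small. *)
pose q := (U0 - I0) * (gamma / eps ^+ 2).
have q1 : 1 <= q.
  rewrite /q mulrA ler_pdivlMr// mul1r; apply: le_trans (ltW eG).
  by rewrite expr2 ler_piMl ?(ltW e0) ?(ltW e1).
have q0 : 0 < q by exact: lt_le_trans q1.
have /andP[zT Tz] := ceil_nat (mulr_gt0 (ltr0Sn R 95) q0).
set T := `|_|%N in zT Tz.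
apply: (@le_trans _ _ (T * sapd_calls (N eps))%N%:R%:E).
  apply: ereal_inf_lbound; exists T => //.
  by apply: (sqm eps e0 T _).2; rewrite -mulrA.
rewrite gapE rateE// -!EFinM lee_fin natrM.
have [_ [_ [_ _ hN]]] := par eps e0.
apply: (le_trans (ler_wpM2l (ler0n _ _) hN)); rewrite -/(W eps).
have DW : 0 < D * W eps by exact: mulr_gt0.
apply: (le_trans (ler_wpM2r (ltW DW) (ltW Tz))).
have -> : 98 * D * (gamma / eps ^+ 2 * W eps) * (U0 - I0) = 98 * q * (D * W eps).
  by rewrite /q; ring.
by rewrite ler_pM2r//; exact: arith.
Unshelve. all: by end_near.
Qed.
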